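(* Let $E\to\mathbb{R}^n$ be a vector bundle, $\nabla$ a connection on $E$ with polynomial energy growth, $x_0\in\mathbb{R}^n$ and $t_0>0$. The point $(\nabla,x_0,t_0)$ is a critical point of the $\mathcal{F}$-functional $(\nabla,x_0,t_0)\mapsto\mathcal{F}_{x_0,t_0}(\nabla)$ if and only if $\nabla$ is an $(x_0,t_0)$-soliton, i.e. $$D^*_\nabla F_\nabla+\frac{x-x_0}{2t_0}\lrcorner F_\nabla=0 .$$
   Context: $E\to\mathbb{R}^n$ is a smooth real vector bundle with a fibre metric over Euclidean space; connections are smooth and metric-compatible. The curvature has components $F_{ij}=[\nabla_i,\nabla_j]$ (skew endomorphisms of $E$); $|F|^2=-\sum_{i,j}\mathrm{tr}(F_{ij}F_{ij})$; $(D^*F)_j=-\sum_i\nabla_iF_{ij}$; $(V\lrcorner F)_j=\sum_iV^iF_{ij}$ for a vector field $V$, and likewise for any endomorphism-valued 2-form in place of $F$; $x$ is the position vector field. The $\mathcal{F}$-functional is $\mathcal{F}_{x_0,t_0}(\nabla)=t_0^2(4\pi t_0)^{-n/2}\int_{\mathbb{R}^n}|F_\nabla|^2e^{-|x-x_0|^2/(4t_0)}\,dV$. Polynomial energy growth about a point $y$: there is a polynomial $p$ with $\int_{B_y(r)}|F_\nabla|^2dV\le p(r)$ for all $r>0$. Critical point means that all partial derivatives of $\mathcal{F}$ with respect to $t_0$, $x_0$ and the connection vanish: $\frac{d}{ds}\big|_{s=0}\mathcal{F}_{x_s,t_s}(\nabla_s)=0$ for all one-parameter families $(\nabla_s,x_s,t_s)$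 through $(\nabla,x_0,t_0)$ at $s=0$ whose variation of connection $B=\frac{d}{ds}\big|_{s=0}\nabla_s$ (a 1-form with values in skew endomorphisms of $E$) is admissible, that is, lies in the weighted Sobolev space of those $B$ with $\int_{\mathbb{R}^n}\big(|B|^2+|\nabla B|^2+|LB|^2\big)e^{-|x-x_0|^2/(4t_0)}\,dV<\infty$. Here $LB=D^*DB+\frac{x-x_0}{2t_0}\lrcorner DB+[B,F]^{\#}$, with $(DB)_{ij}=\nabla_iB_j-\nabla_jB_i$, $(D^*DB)_j=-\sum_i\nabla_i(DB)_{ij}$ and $([B,F]^{\#})_j=\sum_i(B_iF_{ij}-F_{ij}B_i)$.
   Formalization: Critical points are tested only on families whose difference quotients of |F|², weighted by the Gaussian at (x_s,t_s), are dominated by an integrable function; for general admissible B the functional can be infinite for all s≠0, so the literal claim fails. *)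

(* Defs.v *)
From HB Require Import structures.
From mathcomp Require Import all_boot all_order all_algebra.
From mathcomp Require Import all_classical all_reals all_analysis.

Set Implicit Arguments.
Unset Strict Implicit.
Unset Printing Implicit Defensive.

Import Order.TTheory GRing.Theory Num.Theory.
Import numFieldNormedType.Exports.

Local Open Scope classical_set_scope.
Local Open Scope ring_scope.

(* The topology of 'rV[R]_n comes from the sup norm, but lengths, balls and
   Gaussians in R^n are always Euclidean, through [sqnorm]. *)
Definition sqnorm (R : realType) (n : nat) (v : 'rV[R]_n) : R :=
  \sum_(i < n) v 0 i ^+ 2.

Definition eball (R : realType) (n : nat) (y : 'rV[R]_n) (rho : R) :
    set 'rV[R]_n :=
  [set x | sqnorm (x - y) < rho ^+ 2].

Definition basis_vec (R : realType) (n : nat) (i : 'I_n) : 'rV[R]_n :=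
  delta_mx 0 i.

(* Only meaningful for open D: all iterated directional derivatives up to
   order k exist and are continuous at every point of D. *)
Fixpoint Ck_on (R : realType) (V W : normedModType R) (k : nat) (D : set V)
    (f : V -> W) : Prop :=
  (forall x, D x -> {for x, continuous f}) /\
  (if k is k'.+1 then
     forall v : V, (forall x, D x -> derivable f x v) /\ Ck_on k' D ('D_v f)
   else True).

Definition smooth_on (R : realType) (V W : normedModType R) (D : set V)
    (f : V -> W) : Prop :=
  forall k, Ck_on k D f.

(* Lebesgue measure on R^n, as the n-fold product of Lebesgue measure on R
   carried by the measurable space of n-tuples. *)
Section LebesgueMeasure.
Local Open Scope ereal_scope.
Context (R : realType).

Definition tcons (n : nat) (p : measurableTypeR R * n.-tuple (measurableTypeR R)) :
    n.+1.-tuple (measurableTypeR R) :=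
  [the n.+1.-tuple _ of p.1 :: p.2].

Lemma measurable_tcons (n : nat) : measurable_fun setT (@tcons n).
Proof. by apply: measurable_cons. Qed.

Section Step.
Context (n : nat)
  (mu : {sigma_finite_measure set (n.-tuple (measurableTypeR R)) -> \bar R}).

Definition lebesgue_step : set (n.+1.-tuple (measurableTypeR R)) -> \bar R :=
  pushforward (@lebesgue_measure R \x mu) (@tcons n).

Let lebesgue_step0 : lebesgue_step set0 = 0.
Proof. by rewrite /lebesgue_step /pushforward preimage_set0 measure0. Qed.

Let lebesgue_step_ge0 A : 0 <= lebesgue_step A.
Proof. by rewrite /lebesgue_step /pushforward measure_ge0. Qed.

Let lebesgue_step_sigma_additive : semi_sigma_additive lebesgue_step.
Proof.
move=> F mF tF mUF; rewrite /lebesgue_step /pushforward preimage_bigcup.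
apply: measure_semi_sigma_additive.
- by move=> k; rewrite -[X in measurable X]setTI; exact: measurable_tcons.
- apply/trivIsetP => /= i j _ _ ij; rewrite -preimage_setI.
  by move/trivIsetP : tF => /(_ _ _ _ _ ij) ->//; rewrite preimage_set0.
- rewrite -preimage_bigcup -[X in measurable X]setTI.
  exact: measurable_tcons.
Qed.

HB.instance Definition _ := isMeasure.Build _ _ _ lebesgue_step
  lebesgue_step0 lebesgue_step_ge0 lebesgue_step_sigma_additive.

Let lebesgue_step_sigma_finite : sigma_finite setT lebesgue_step.
Proof.
have /sigma_finiteP[F1 [F1T F1nd F1oo]] := sigma_finiteT (@lebesgue_measure R).
have /sigma_finiteP[F2 [F2T F2nd F2oo]] := sigma_finiteT mu.
pose hd (t : n.+1.-tuple (measurableTypeR R)) : measurableTypeR R := thead t.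
pose tl (t : n.+1.-tuple (measurableTypeR R)) := [tuple of behead t].
exists (fun k => (hd @^-1` F1 k) `&` (tl @^-1` F2 k)).
  apply/seteqP; split=> // t _.
  have : setT (hd t) by [].
  rewrite F1T => -[i _ Fi].
  have : setT (tl t) by [].
  rewrite F2T => -[j _ Fj].
  exists (maxn i j) => //; split => /=.
    by have /subsetPset := F1nd _ _ (leq_maxl i j); apply.
  by have /subsetPset := F2nd _ _ (leq_maxr i j); apply.
move=> k; have [mF1 F1k] := F1oo k; have [mF2 F2k] := F2oo k; split.
  apply: measurableI.
    by rewrite -[X in measurable X]setTI; exact: measurable_tnth.
  by rewrite -[X in measurable X]setTI; exact: measurable_behead.
rewrite /lebesgue_step /pushforward.
rewrite (_ : _ @^-1` _ = F1 k `*` F2 k).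
  by rewrite product_measure1E// lte_mul_pinfty// ge0_fin_numE.
have hdE p : hd (tcons p) = p.1 by [].
have tlE p : tl (tcons p) = p.2 by apply: val_inj.
by apply/seteqP; split=> p /=; rewrite hdE tlE.
Qed.

HB.instance Definition _ := @Measure_isSigmaFinite.Build _ _ _ lebesgue_step
  lebesgue_step_sigma_finite.

End Step.

Fixpoint lebesgue_Rn (n : nat) :
    {sigma_finite_measure set (n.-tuple (measurableTypeR R)) -> \bar R} :=
  if n is n'.+1 then lebesgue_step (lebesgue_Rn n')
  else \d_([tuple] : 0.-tuple (measurableTypeR R)).

End LebesgueMeasure.

Definition int_Rn (R : realType) (n : nat) (D : set 'rV[R]_n)
    (f : 'rV[R]_n -> R) : \bar R :=
  (\int[lebesgue_Rn R n]_(t in [set t | D (\row_i tnth t i)])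
     (f (\row_i tnth t i))%:E)%E.

Definition integrable_Rn (R : realType) (n : nat) (f : 'rV[R]_n -> R) : Prop :=
  (lebesgue_Rn R n).-integrable setT (fun t => (f (\row_i tnth t i))%:E).

(* A rank r vector bundle with fibre metric over R^n, given by an atlas of
   orthonormal local frames indexed by an arbitrary type; every metric bundle
   has such an atlas by Gram-Schmidt.  A section has coordinate columns s_a
   with s_a = (trans a b) *m s_b on overlaps. *)
Record metric_bundle (R : realType) (n r : nat) := MetricBundle {
  chart : Type;
  dom : chart -> set 'rV[R]_n;
  trans : chart -> chart -> 'rV[R]_n -> 'M[R]_r;
  dom_open : forall a, open (dom a);
  dom_cover : forall x, exists a, dom a x;
  trans_smooth : forall a b, smooth_on (dom a `&` dom b) (trans a b);
  trans_orthogonal : forall a b x, dom a x -> dom b x ->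
    (trans a b x)^T *m trans a b x = 1%:M;
  trans_cocycle : forall a b c x, dom a x -> dom b x -> dom c x ->
    trans a b x *m trans b c x = trans a c x
}.
Arguments dom {R n r E} a x : rename.
Arguments trans {R n r E} a b x : rename.

(* In the frame a, nabla_i = d/dx_i + conn_form a i.  Metric compatibility is
   skewness of the connection matrices in orthonormal frames.  Values of
   conn_form a outside dom a are irrelevant. *)
Record connection (R : realType) (n r : nat) (E : metric_bundle R n r) :=
    Connection {
  conn_form : chart E -> 'I_n -> 'rV[R]_n -> 'M[R]_r;
  conn_smooth : forall a i, smooth_on (dom a) (conn_form a i);
  conn_skew : forall a i x, dom a x ->
    (conn_form a i x)^T = - conn_form a i x;
  conn_trans : forall a b i x, dom a x -> dom b x ->
    conn_form a i x *m trans a b x + 'D_(basis_vec R i) (trans a b) x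
    = trans a b x *m conn_form b i x
}.

(* Calculus of End(E)-valued forms in one frame, A being the connection
   matrices of that frame. *)
Section LocalCalculus.
Context (R : realType) (n r : nat).
Implicit Types (A B : 'I_n -> 'rV[R]_n -> 'M[R]_r) (T : 'rV[R]_n -> 'M[R]_r).
Implicit Types (W : 'I_n -> 'I_n -> 'rV[R]_n -> 'M[R]_r) (x : 'rV[R]_n).

Definition commmx (S T : 'M[R]_r) : 'M[R]_r := S *m T - T *m S.

(* The induced connection on End(E). *)
Definition cov A (i : 'I_n) T x : 'M[R]_r :=
  'D_(basis_vec R i) T x + commmx (A i x) (T x).

(* [nabla_i, nabla_j] expanded for nabla_i = d/dx_i + A_i acting on sections. *)
Definition curv A (i j : 'I_n) x : 'M[R]_r :=
  'D_(basis_vec R i) (A j) x - 'D_(basis_vec R j) (A i) x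
  + commmx (A i x) (A j x).

Definition ext_cov A B (i j : 'I_n) x : 'M[R]_r :=
  cov A i (B j) x - cov A j (B i) x.

Definition coext_cov A W (j : 'I_n) x : 'M[R]_r :=
  - \sum_(i < n) cov A i (W i j) x.

Definition contract (v : 'rV[R]_n) W (j : 'I_n) x : 'M[R]_r :=
  \sum_(i < n) v 0 i *: W i j x.

Definition sharp_bracket B W (j : 'I_n) x : 'M[R]_r :=
  \sum_(i < n) commmx (B i x) (W i j x).

Definition soliton_form A (x0 : 'rV[R]_n) (t0 : R) (j : 'I_n) x : 'M[R]_r :=
  coext_cov A (curv A) j x
  + contract ((2 * t0)^-1 *: (x - x0)) (curv A) j x.

Definition stability_op A (x0 : 'rV[R]_n) (t0 : R) B (j : 'I_n) x : 'M[R]_r :=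
  coext_cov A (ext_cov A B) j x
  + contract ((2 * t0)^-1 *: (x - x0)) (ext_cov A B) j x
  + sharp_bracket B (curv A) j x.

Definition endo_sqnorm (T : 'M[R]_r) : R := - \tr (T *m T).

End LocalCalculus.

Section Functional.
Context (R : realType) (n r : nat) (E : metric_bundle R n r).
Implicit Types (nabla : connection E).

(* The pointwise norms below do not depend on the frame, so any frame around
   the point may be used to compute them. *)
Definition frame_at (x : 'rV[R]_n) : chart E := projT1 (cid (dom_cover E x)).

Definition energy_density nabla (x : 'rV[R]_n) : R :=
  \sum_(i < n) \sum_(j < n)
    endo_sqnorm (curv (conn_form nabla (frame_at x)) i j x).

Definition gaussian (x0 : 'rV[R]_n) (t0 : R) (x : 'rV[R]_n) : R :=
  expR (- (sqnorm (x - x0) / (4 * t0))).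

Definition F_functional nabla (x0 : 'rV[R]_n) (t0 : R) : \bar R :=
  ((t0 ^+ 2 * (4 * pi * t0) `^ (- (n%:R / 2)))%:E *
   int_Rn setT (fun x => energy_density nabla x * gaussian x0 t0 x)%R)%E.

Definition polynomial_energy_growth nabla (y : 'rV[R]_n) : Prop :=
  exists p : {poly R}, forall rho : R, 0 < rho ->
    (int_Rn (eball y rho) (energy_density nabla) <= (p.[rho])%:E)%E.

Definition soliton nabla (x0 : 'rV[R]_n) (t0 : R) : Prop :=
  forall (a : chart E) (j : 'I_n) (x : 'rV[R]_n), dom a x ->
    soliton_form (conn_form nabla a) x0 t0 j x = 0.

Definition admissible nabla (x0 : 'rV[R]_n) (t0 : R)
    (B : chart E -> 'I_n -> 'rV[R]_n -> 'M[R]_r) : Prop :=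
  (int_Rn setT (fun x =>
     let A := conn_form nabla (frame_at x) in
     let Bx := B (frame_at x) in
     (\sum_(j < n) endo_sqnorm (Bx j x)
      + \sum_(i < n) \sum_(j < n) endo_sqnorm (cov A i (Bx j) x)
      + \sum_(j < n) endo_sqnorm (stability_op A x0 t0 Bx j x))
     * gaussian x0 t0 x)%R < +oo)%E.

(* A smooth one-parameter family for |s| < eps; its values for other s are
   irrelevant. *)
Definition one_parameter_family nabla (x0 : 'rV[R]_n) (t0 : R)
    (nabla_ : R -> connection E) (x_ : R -> 'rV[R]_n) (t_ : R -> R) : Prop :=
  [/\ forall a i x, dom a x -> conn_form (nabla_ 0) a i x = conn_form nabla a i x,
      x_ 0 = x0, t_ 0 = t0 &
      exists2 eps : R, 0 < eps &
        [/\ forall a i,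
              smooth_on [set p : R * 'rV[R]_n | `|p.1| < eps /\ dom a p.2]
                (fun p : R * 'rV[R]_n => conn_form (nabla_ p.1) a i p.2),
            smooth_on [set s : R | `|s| < eps] x_,
            smooth_on [set s : R | `|s| < eps] t_ &
            forall s, `|s| < eps -> 0 < t_ s]].

Definition variation (nabla_ : R -> connection E) (a : chart E) (i : 'I_n)
    (x : 'rV[R]_n) : 'M[R]_r :=
  derive1 (fun s : R => conn_form (nabla_ s) a i x) 0.

(* A variation of connection that is only controlled to first order at s = 0
   does not make s |-> F differentiable, nor even finite for s != 0 (a family
   may have infinite weighted energy for every s != 0).  This is the usual
   hypothesis of differentiation under the integral sign, put on the energy
   density alone: it is void when nabla_ does not depend on s. *)
Definition dominated_energy (nabla_ : R -> connection E)
    (x_ : R -> 'rV[R]_n) (t_ : R -> R) : Prop :=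
  exists2 g : 'rV[R]_n -> R, integrable_Rn g &
    exists2 eps : R, 0 < eps &
      forall s, `|s| < eps -> forall x,
        `|energy_density (nabla_ s) x - energy_density (nabla_ 0) x|
          * gaussian (x_ s) (t_ s) x <= `|s| * g x.

Definition critical_point nabla (x0 : 'rV[R]_n) (t0 : R) : Prop :=
  forall (nabla_ : R -> connection E) (x_ : R -> 'rV[R]_n) (t_ : R -> R),
    one_parameter_family nabla x0 t0 nabla_ x_ t_ ->
    admissible nabla x0 t0 (variation nabla_) ->
    dominated_energy nabla_ x_ t_ ->
    (\forall s \near (0 : R),
       F_functional (nabla_ s) (x_ s) (t_ s) \is a fin_num) /\
    is_derive (0 : R) (1 : R)
      (fun s : R => fine (F_functional (nabla_ s) (x_ s) (t_ s))) 0.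

End Functional.

(* Main.v *)
(* Let Sol_j be the left-hand side of the soliton equation and g the Gaussian
   weight.  Integration by parts gives the derivative of F in the direction of
   a variation B of the connection as a positive multiple of
   int g sum_j <Sol_j, B_j>.  Testing with B = phi Sol, phi a bump function,
   shows that critical points are solitons.
   Conversely, on a soliton that term vanishes, and the derivatives in x_0 and
   t_0 vanish because of a weighted conservation law: contract the stress-energy
   tensor S_ij = sum_k <F_ik, F_jk> - delta_ij |F|^2 / 4 with a conformal field
   v = y + lam (x - x_0).  By the Bianchi identity and the soliton equation the
   divergence of the integrable field g S v is, for suitable y and lam, exactly
   the variation of t^2 (4 pi t)^(-n/2) g |F|^2 up to a constant factor, so its
   integral is zero.
   Polynomial energy growth enters only through the integrability of |F|^2
   against Gaussians, which justifies the divergence theorem and the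
   differentiation under the integral sign. *)
Require Import Defs.
From HB Require Import structures.
From mathcomp Require Import all_boot all_order all_algebra.
From mathcomp Require Import all_classical all_reals all_analysis.
From mathcomp Require Import measurable_realfun ring lra.

Set Implicit Arguments.
Unset Strict Implicit.
Unset Printing Implicit Defensive.

Import Order.TTheory GRing.Theory Num.Theory.
Import numFieldNormedType.Exports.

Local Open Scope classical_set_scope.
Local Open Scope ring_scope.

(** * Directional derivatives and smooth maps *)

(** Two features shape the proof. Scalars such as [energy_density] are computed in a frame chosen
    arbitrarily at each point, so nothing is visibly continuous; all objects are therefore handled
    as [skew_section]s, whose trace pairings do not depend on the frame and can be differentiated in
    one fixed frame near each point. Moreover a variation B need not have compact support.
    Integration by parts on the whole space is proved for integrable fields with integrable
    divergence, the boundary terms being removed by cutoffs with gradient of order 1/k. The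
    integrability comes from bounding <F, B> by |F|^2 + |B|^2 and <F, DB> by |F|^2 + |DB|^2, which
    polynomial growth and admissibility control. The conformal field is forced by the family: y is
    the velocity of x_0, and lam is half the logarithmic velocity of t_0. As the derivative of v is
    lam times the identity, its pairing with the stress tensor sees only the trace (1 - n/4)|F|^2;
    and 4 lam (1 - n/4) is exactly the logarithmic derivative (2 - n/2)/t of the prefactor times the
    velocity of t_0. *)

Section DirectionalCalculus.
Context {R : realType}.
Implicit Types (V W : normedModType R).

Lemma is_derive_compat V W (f g : V -> W) x v df :
  f = g -> is_derive x v f df -> is_derive x v g df.
Proof. by move=> ->. Qed.

Lemma is_derive_mxP V m n (M : V -> 'M[R]_(m, n)) x v dM :
  is_derive x v M dM <-> forall i j, is_derive x v (fun y => M y i j) (dM i j).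
Proof.
split=> [[dv <-] i j|H].
  by apply: DeriveDef; [exact: (derivable_mxP _ _ _).1|rewrite derive_mx// mxE].
have dv : derivable M x v by apply/derivable_mxP => i j; have [] := H i j.
apply: DeriveDef => //; rewrite derive_mx//; apply/matrixP => i j.
by rewrite mxE; have [_ <-] := H i j.
Qed.

Lemma is_derive_add V W (f g : V -> W) x v df dg :
  is_derive x v f df -> is_derive x v g dg ->
  is_derive x v (fun y => f y + g y) (df + dg).
Proof. by move=> hf hg; apply: is_deriveD. Qed.

Lemma is_derive_sub V W (f g : V -> W) x v df dg :
  is_derive x v f df -> is_derive x v g dg ->
  is_derive x v (fun y => f y - g y) (df - dg).
Proof. by move=> hf hg; apply: is_deriveB. Qed.

Lemma is_derive_oppr V W (f : V -> W) x v df :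
  is_derive x v f df -> is_derive x v (fun y => - f y) (- df).
Proof. by move=> hf; apply: is_deriveN. Qed.

Lemma is_derive_const V W (c : W) (x v : V) :
  is_derive x v (fun _ => c) 0.
Proof. exact: is_derive_cst. Qed.

Lemma is_derive_scale V W (k : R) (f : V -> W) x v df :
  is_derive x v f df -> is_derive x v (fun y => k *: f y) (k *: df).
Proof. by move=> hf; apply: is_deriveZ. Qed.

Lemma is_derive_mul V (f g : V -> R) x v df dg :
  is_derive x v f df -> is_derive x v g dg ->
  is_derive x v (fun y => f y * g y) (df * g x + f x * dg).
Proof.
move=> hf hg; have H := @is_deriveM R V f g x v df dg hf hg.
by rewrite (addrC (df * _)) (mulrC df); exact: H.
Qed.

Lemma is_derive_bigsum V W (I : Type) (s : seq I) (P : pred I)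
    (f : I -> V -> W) x v (df : I -> W) :
  (forall i, P i -> is_derive x v (f i) (df i)) ->
  is_derive x v (fun y => \sum_(i <- s | P i) f i y) (\sum_(i <- s | P i) df i).
Proof.
move=> H; elim: s => [|i s IH].
  rewrite big_nil; under eq_fun do rewrite big_nil; exact: is_derive_const.
rewrite big_cons; under eq_fun do rewrite big_cons.
case: ifPn => // Pi; apply: is_derive_add => //; exact: H.
Qed.

Lemma is_derive_mulmx V m n p (M : V -> 'M[R]_(m, n)) (N : V -> 'M[R]_(n, p))
    x v dM dN :
  is_derive x v M dM -> is_derive x v N dN ->
  is_derive x v (fun y => M y *m N y) (dM *m N x + M x *m dN).
Proof.
move=> /is_derive_mxP hM /is_derive_mxP hN; apply/is_derive_mxP => i j.
rewrite !mxE -big_split/=; under eq_fun do rewrite mxE.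
by apply: is_derive_bigsum => k _; apply: is_derive_mul.
Qed.

Lemma is_derive_scalemx V m n (f : V -> R) (M : V -> 'M[R]_(m, n)) x v df dM :
  is_derive x v f df -> is_derive x v M dM ->
  is_derive x v (fun y => f y *: M y) (df *: M x + f x *: dM).
Proof.
move=> hf /is_derive_mxP hM; apply/is_derive_mxP => i j.
rewrite !mxE; under eq_fun do rewrite mxE.
exact: is_derive_mul.
Qed.

Lemma is_derive_trmx V m n (M : V -> 'M[R]_(m, n)) x v dM :
  is_derive x v M dM -> is_derive x v (fun y => (M y)^T) dM^T.
Proof.
move=> /is_derive_mxP hM; apply/is_derive_mxP => i j.
by rewrite mxE; under eq_fun do rewrite mxE.
Qed.

Lemma is_derive_mxtrace V n (M : V -> 'M[R]_n) x v dM :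
  is_derive x v M dM -> is_derive x v (fun y => \tr (M y)) (\tr dM).
Proof. by move=> /is_derive_mxP hM; apply: is_derive_bigsum. Qed.

Lemma is_derive_near V W (D : set V) (f g : V -> W) x v df :
  open D -> D x -> (forall y, D y -> f y = g y) ->
  is_derive x v f df -> is_derive x v g df.
Proof.
move=> oD Dx fg; apply: near_eq_is_derive.
by near=> y; apply: fg; near: y; exact: open_nbhs_nbhs.
Unshelve. all: by end_near. Qed.

Lemma derive_near V W (D : set V) (f g : V -> W) x v :
  open D -> D x -> (forall y, D y -> f y = g y) -> 'D_v f x = 'D_v g x.
Proof.
move=> oD Dx fg; apply: near_eq_derive.
by near=> y; apply: fg; near: y; exact: open_nbhs_nbhs.
Unshelve. all: by end_near. Qed.

(** The two difference quotients are the same function of [h], so no regularity of [f] beyond this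
    one direction is involved. This moves derivatives between a space and its affine slices:
    coordinate lines, hyperplanes, and the factors of R x R^n. *)
Lemma is_derive_affine V V' W (iota : V -> V') (f : V' -> W) x v w df :
  (forall h : R, iota (h *: v + x) = h *: w + iota x) ->
  is_derive (iota x) w f df <-> is_derive x v (f \o iota) df.
Proof.
move=> H.
have E : (fun h : R => h^-1 *: (((f \o iota) \o shift x) (h *: v) - (f \o iota) x)) =
    (fun h => h^-1 *: ((f \o shift (iota x)) (h *: w) - f (iota x))).
  by apply/funext => h /=; rewrite H.
have E1 : derivable (f \o iota) x v = derivable f (iota x) w.
  by rewrite /derivable E.
have E2 : 'D_v (f \o iota) x = 'D_w f (iota x) by rewrite /derive E.
by split=> -[d1 <-]; split; rewrite ?E1 ?E2// -?E1.
Qed.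

Lemma derive_affine V V' W (iota : V -> V') (f : V' -> W) x v w :
  (forall h : R, iota (h *: v + x) = h *: w + iota x) ->
  'D_v (f \o iota) x = 'D_w f (iota x).
Proof.
move=> H; rewrite /derive.
set u := (X in lim (X @ _)); set u' := (X in _ = lim (X @ _)).
by have -> : u = u' by apply/funext => h; rewrite /u /u'/= H.
Qed.

Lemma derivable_affine V V' W (iota : V -> V') (f : V' -> W) x v w :
  (forall h : R, iota (h *: v + x) = h *: w + iota x) ->
  derivable f (iota x) w -> derivable (f \o iota) x v.
Proof.
move=> H; rewrite /derivable => df.
rewrite [X in cvg (X @ _)](_ : _ =
  fun h => h^-1 *: ((f \o shift (iota x)) (h *: w) - f (iota x)))//.
by apply/funext => h /=; rewrite H.
Qed.

Lemma is_derive_line V W (f : V -> W) x v df (s : R) :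
  is_derive (s *: v + x) v f df ->
  is_derive s (1 : R) (fun t : R => f (t *: v + x)) df.
Proof.
have H (h : R) : (h *: 1 + s) *: v + x = h *: v + (s *: v + x).
  by rewrite scalerDl [h *: 1]mulr1 addrA.
exact: (@is_derive_affine R^o V W (fun t => t *: v + x) f s 1 v df H).1.
Qed.

(** Only a directional derivative of [q] is given, so [q] is restricted to the line through [x] in
    direction [v], where the one-variable chain rule applies. *)
Lemma is_derive_chain V (q : V -> R) (h : R -> R) x v dq dh :
  is_derive x v q dq -> is_derive (q x) 1 h dh ->
  is_derive x v (h \o q) (dh * dq).
Proof.
move=> Hq Hh.
have Hq' : is_derive (0 : R) (1 : R) (fun t : R => q (t *: v + x)) dq.
  by apply: is_derive_line; rewrite scale0r add0r.
have [dq1 dq2] := Hq'.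
have E0 : q ((0 : R) *: v + x) = q x by rewrite scale0r add0r.
have C := @is_derive1_comp R h (fun t : R => q (t *: v + x)) 0 dh dq.
rewrite E0 in C.
have {}C : is_derive (0 : R) (1 : R) (fun t => h (q (t *: v + x))) (dh * dq).
  exact: (C Hh Hq').
have [C1 C2] := C.
split; first by apply/derivable1P.
rewrite -C2 /derive.
set u := (X in lim (X @ _)); set u' := (X in _ = lim (X @ _)).
have -> // : u = u'.
by apply/funext => t; rewrite /u /u'/= E0 addr0 [t *: 1]mulr1.
Qed.

Lemma is_derive_fun1 (f : R -> R) (x v df : R) :
  is_derive x (1 : R) f df -> is_derive x v f (df * v).
Proof. by move=> H; exact: (is_derive_chain (is_derive_id x v) H). Qed.

Lemma is_derive_coord m n (x v : 'M[R]_(m, n)) i j :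
  is_derive x v (fun y : 'M[R]_(m, n) => y i j) (v i j).
Proof. by have /is_derive_mxP := is_derive_id x v; apply. Qed.

End DirectionalCalculus.

(** * Closure properties of [Ck_on] and [smooth_on] *)

Section SmoothMaps.
Context {R : realType}.
Implicit Types (V W : normedModType R).

Lemma continuous_near V W (D : set V) (f g : V -> W) x :
  open D -> D x -> (forall y, D y -> f y = g y) ->
  {for x, continuous f} -> {for x, continuous g}.
Proof.
move=> oD Dx fg; rewrite /prop_for /continuous_at -(fg x Dx).
apply: cvg_trans; apply: near_eq_cvg.
by near=> y; apply: fg; near: y; exact: open_nbhs_nbhs.
Unshelve. all: by end_near. Qed.

Lemma continuous_mxP V m n (M : V -> 'M[R]_(m, n)) x :
  {for x, continuous M} <->
  forall i j, {for x, continuous (fun y => M y i j)}.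
Proof.
split=> [cM i j|cM].
  by apply: (@continuous_comp _ _ _ M (fun N : 'M[R]_(m, n) => N i j)) => //;
    exact: coord_continuous.
apply/cvgrPdist_le => /= e e0; near=> y.
rewrite /Num.Def.normr/= mx_normrE (bigmax_le _ (ltW e0))//= => i _.
rewrite !mxE/=; move: i; near: y; apply: filter_forall => /= i.
by move: (cM i.1 i.2) => /cvgrPdist_le/(_ _ e0).
Unshelve. all: by end_near. Qed.

Lemma Ck_on_continuous V W k (D : set V) (f : V -> W) x :
  Ck_on k D f -> D x -> {for x, continuous f}.
Proof. by case: k => [|k] [H _]; apply: H. Qed.

Lemma Ck_on_sub V W k (D D' : set V) (f : V -> W) :
  D' `<=` D -> Ck_on k D f -> Ck_on k D' f.
Proof.
move=> sD; elim: k f => [|k IH] f [cf df]; split=> //; try by move=> x /sD /cf.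
by move=> v; have [d1 d2] := df v; split; [move=> x /sD /d1|exact: IH].
Qed.

Lemma Ck_on_ext V W k (D : set V) (f g : V -> W) :
  open D -> (forall x, D x -> f x = g x) -> Ck_on k D f -> Ck_on k D g.
Proof.
move=> oD; elim: k f g => [|k IH] f g fg [cf df].
  by split=> // x Dx; apply: (continuous_near oD Dx fg (cf x Dx)).
split=> [x Dx|v]; first exact: (continuous_near oD Dx fg (cf x Dx)).
have [d1 d2] := df v; split=> [x Dx|].
  by have [] := is_derive_near oD Dx fg (derivableP (d1 x Dx)).
by apply: IH d2 => x Dx; exact: (derive_near _ oD Dx fg).
Qed.

Lemma Ck_onW V W k (D : set V) (f : V -> W) : Ck_on k.+1 D f -> Ck_on k D f.
Proof.
elim: k f => [|k IH] f [cf df]; split=> // v.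
by have [d1 d2] := df v; split=> //; exact: IH.
Qed.

Lemma Ck_on_cst V W k (D : set V) (c : W) : Ck_on k D (fun _ => c).
Proof.
have E v : 'D_v (fun _ : V => c) = fun _ => 0.
  by apply/funext => x; have [] := is_derive_const c x v.
elim: k c E => [|k IH] c E; split=> //; try by move=> x _; exact: cvg_cst.
move=> v; split=> [x _|]; first by have [] := is_derive_const c x v.
rewrite E; apply: IH => w; apply/funext => x.
by have [] := is_derive_const (0 : W) x w.
Qed.

Lemma Ck_onD V W k (D : set V) (f g : V -> W) : open D ->
  Ck_on k D f -> Ck_on k D g -> Ck_on k D (fun x => f x + g x).
Proof.
move=> oD; elim: k f g => [|k IH] f g [cf df] [cg dg]; split=> //;
  try by move=> x Dx; apply: cvgD; [exact: cf|exact: cg].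
move=> v; have [df1 df2] := df v; have [dg1 dg2] := dg v.
have H x : D x -> is_derive x v (fun y => f y + g y) ('D_v f x + 'D_v g x).
  by move=> Dx; apply: is_derive_add; apply: derivableP; auto.
split=> [x Dx|]; first by have [] := H x Dx.
apply: (Ck_on_ext (f := fun x => 'D_v f x + 'D_v g x)) => //; last exact: IH.
by move=> x Dx; have [] := H x Dx.
Qed.

(** Induction on the order. The Leibniz rule multiplies a derivative of order [k] by an
    undifferentiated factor of order [k.+1], which [Ck_onW] first weakens to order [k]. *)
Lemma Ck_onM V k (D : set V) (f g : V -> R) : open D ->
  Ck_on k D f -> Ck_on k D g -> Ck_on k D (fun x => f x * g x).
Proof.
move=> oD; elim: k f g => [|k IH] f g hf hg.
  split=> // x Dx; apply: cvgM; [by case: hf => + _; apply|].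
  by case: hg => + _; apply.
have := hf; have := hg; move=> [cg dg] [cf df]; split=> [x Dx|v].
  by apply: cvgM; [exact: cf|exact: cg].
have [df1 df2] := df v; have [dg1 dg2] := dg v.
have H x : D x -> is_derive x v (fun y => f y * g y)
    ('D_v f x * g x + f x * 'D_v g x).
  by move=> Dx; apply: is_derive_mul; apply: derivableP; auto.
split=> [x Dx|]; first by have [] := H x Dx.
apply: (Ck_on_ext (f := fun x => 'D_v f x * g x + f x * 'D_v g x)) => //.
  by move=> x Dx; have [] := H x Dx.
by apply: Ck_onD => //; apply: IH => //; exact: Ck_onW.
Qed.

Lemma Ck_on_sum V W k (D : set V) (I : Type) (s : seq I) (P : pred I)
    (f : I -> V -> W) : open D ->
  (forall i, P i -> Ck_on k D (f i)) ->
  Ck_on k D (fun x => \sum_(i <- s | P i) f i x).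
Proof.
move=> oD H; elim: s => [|i s IH].
  by under eq_fun do rewrite big_nil; exact: Ck_on_cst.
under eq_fun do rewrite big_cons; case: (boolP (P i)) => // Pi.
by apply: Ck_onD => //; exact: H.
Qed.

Lemma Ck_on_mxP V k m n (D : set V) (M : V -> 'M[R]_(m, n)) : open D ->
  Ck_on k D M <-> forall i j, Ck_on k D (fun x => M x i j).
Proof.
move=> oD; elim: k M => [|k IH] M.
  split=> [[cM _] i j|H]; split=> // x Dx.
    by apply: (continuous_mxP M x).1; exact: cM.
  by apply/continuous_mxP => i j; apply: (H i j).1.
split=> [[cM dM] i j|H].
  split=> [x Dx|v]; first by apply: (continuous_mxP M x).1; exact: cM.
  have [d1 /IH d2] := dM v; split=> [x Dx|].
    by apply: (derivable_mxP M x v).1; exact: d1.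
  apply: Ck_on_ext (d2 i j) => // x Dx.
  by rewrite derive_mx ?mxE//; exact: d1.
split=> [x Dx|v]; first by apply/continuous_mxP => i j; apply: (H i j).1.
have d x : D x -> derivable M x v.
  by move=> Dx; apply/derivable_mxP => i j; have [_ /(_ v)[+ _]] := H i j; apply.
split=> //; apply/IH => i j; have [_ /(_ v)[_ d2]] := H i j.
apply: Ck_on_ext d2 => // x Dx.
by rewrite derive_mx ?mxE//; exact: d.
Qed.

Lemma Ck_on_affine V V' W k (D : set V') (f : V' -> W) (iota : V -> V')
    (L : V -> V') :
  continuous iota -> (forall x v h, iota (h *: v + x) = h *: L v + iota x) ->
  Ck_on k D f -> Ck_on k (iota @^-1` D) (f \o iota).
Proof.
move=> ci Hi; elim: k f => [|k IH] f [cf df]; split=> //;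
  try by move=> x Dx; apply: continuous_comp; [exact: ci|exact: cf].
move=> v; have [d1 d2] := df (L v); split=> [x Dx|].
  by apply: (derivable_affine (w := L v)); [move=> h; exact: Hi|exact: d1].
rewrite [X in Ck_on _ _ X](_ : _ = 'D_(L v) f \o iota); first exact: IH.
by apply/funext => x; apply: derive_affine => h; exact: Hi.
Qed.

Lemma Ck_on_chain V k (D : set V) (h : R -> R) (q : V -> R) : open D ->
  Ck_on k [set: R] h -> Ck_on k D q -> Ck_on k D (h \o q).
Proof.
move=> oD; elim: k h q => [|k IH] h q hh hq.
  split=> // x Dx; apply: continuous_comp; first by apply: hq.1.
  exact: hh.1.
have := hh; have := hq; move=> [cq dq] [ch dh]; split=> [x Dx|v].
  by apply: continuous_comp; [exact: cq|exact: ch].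
have [dq1 dq2] := dq v; have [dh1 dh2] := dh 1.
have H x : D x -> is_derive x v (h \o q) ('D_1 h (q x) * 'D_v q x).
  move=> Dx; apply: is_derive_chain; apply: derivableP; first exact: dq1.
  exact: dh1.
split=> [x Dx|]; first by have [] := H x Dx.
apply: (Ck_on_ext (f := fun x => ('D_1 h \o q) x * 'D_v q x)) => //.
  by move=> x Dx; have [] := H x Dx.
by apply: Ck_onM => //; apply: IH => //; exact: Ck_onW.
Qed.

Lemma smooth_on_continuous V W (D : set V) (f : V -> W) x :
  smooth_on D f -> D x -> {for x, continuous f}.
Proof. by move=> H Dx; exact: (Ck_on_continuous (H 0%N) Dx). Qed.

Lemma smooth_on_is_derive V W (D : set V) (f : V -> W) x v :
  smooth_on D f -> D x -> is_derive x v f ('D_v f x).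
Proof. by move=> /(_ 1%N)[_ /(_ v)[H _]] Dx; apply: derivableP; exact: H. Qed.

Lemma smooth_on_derive V W (D : set V) (f : V -> W) v :
  smooth_on D f -> smooth_on D ('D_v f).
Proof. by move=> H k; have [_ /(_ v)[]] := H k.+1. Qed.

Lemma smooth_on_cst V W (D : set V) (c : W) : smooth_on D (fun _ => c).
Proof. by move=> k; exact: Ck_on_cst. Qed.

Lemma smooth_onS V W (D D' : set V) (f : V -> W) :
  D' `<=` D -> smooth_on D f -> smooth_on D' f.
Proof. by move=> DD H k; exact: (Ck_on_sub DD). Qed.

Lemma smooth_on_ext V W (D : set V) (f g : V -> W) :
  open D -> (forall x, D x -> f x = g x) -> smooth_on D f -> smooth_on D g.
Proof. by move=> oD fg H k; exact: (Ck_on_ext oD fg). Qed.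

Lemma smooth_onD V W (D : set V) (f g : V -> W) : open D ->
  smooth_on D f -> smooth_on D g -> smooth_on D (fun x => f x + g x).
Proof. by move=> oD hf hg k; exact: Ck_onD. Qed.

Lemma smooth_on_sum V W (D : set V) (I : Type) (s : seq I) (P : pred I)
    (f : I -> V -> W) : open D ->
  (forall i, P i -> smooth_on D (f i)) ->
  smooth_on D (fun x => \sum_(i <- s | P i) f i x).
Proof. by move=> oD H k; apply: Ck_on_sum => // i Pi; exact: H. Qed.

Lemma smooth_onM V (D : set V) (f g : V -> R) : open D ->
  smooth_on D f -> smooth_on D g -> smooth_on D (fun x => f x * g x).
Proof. by move=> oD hf hg k; exact: Ck_onM. Qed.

Lemma smooth_on_mxP V m n (D : set V) (M : V -> 'M[R]_(m, n)) : open D ->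
  smooth_on D M <-> forall i j, smooth_on D (fun x => M x i j).
Proof.
move=> oD; split=> [H i j k|H k]; first exact: (Ck_on_mxP k M oD).1.
by apply/Ck_on_mxP => // i j; exact: H.
Qed.

Lemma smooth_on_mulmx V m n p (D : set V) (M : V -> 'M[R]_(m, n))
    (N : V -> 'M[R]_(n, p)) : open D ->
  smooth_on D M -> smooth_on D N -> smooth_on D (fun x => M x *m N x).
Proof.
move=> oD /smooth_on_mxP hM /smooth_on_mxP hN; apply/smooth_on_mxP => // i j.
under eq_fun do rewrite mxE.
by apply: smooth_on_sum => // k _; apply: smooth_onM; auto.
Qed.

Lemma smooth_on_scalemx V m n (D : set V) (f : V -> R)
    (M : V -> 'M[R]_(m, n)) : open D ->
  smooth_on D f -> smooth_on D M -> smooth_on D (fun x => f x *: M x).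
Proof.
move=> oD hf /smooth_on_mxP hM; apply/smooth_on_mxP => // i j.
under eq_fun do rewrite mxE.
by apply: smooth_onM; auto.
Qed.

Lemma smooth_onN V m n (D : set V) (M : V -> 'M[R]_(m, n)) : open D ->
  smooth_on D M -> smooth_on D (fun x => - M x).
Proof.
move=> oD hM; under eq_fun do rewrite -scaleN1r.
by apply: smooth_on_scalemx => //; exact: smooth_on_cst.
Qed.

Lemma smooth_on_affine V V' W (D : set V') (f : V' -> W) (iota : V -> V')
    (L : V -> V') :
  continuous iota -> (forall x v h, iota (h *: v + x) = h *: L v + iota x) ->
  smooth_on D f -> smooth_on (iota @^-1` D) (f \o iota).
Proof. by move=> ci Hi H k; apply: Ck_on_affine => //; exact: H. Qed.

Lemma smooth_on_chain V (D : set V) (h : R -> R) (q : V -> R) : open D ->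
  smooth_on [set: R] h -> smooth_on D q -> smooth_on D (h \o q).
Proof. by move=> oD hh hq k; exact: Ck_on_chain. Qed.

Lemma smooth_on_coord m n (D : set 'M[R]_(m, n)) i j :
  smooth_on D (fun x => x i j).
Proof.
case=> [|k]; split=> //; try by move=> x _; exact: coord_continuous.
move=> v; split=> [x _|]; first by have [] := is_derive_coord x v i j.
rewrite [X in Ck_on _ _ X](_ : _ = fun _ => v i j); first exact: Ck_on_cst.
by apply/funext => x; have [] := is_derive_coord x v i j.
Qed.

End SmoothMaps.

(** * Symmetry of second derivatives *)

Section Clairaut.
Context {R : realType}.
Implicit Types V : normedModType R.

Lemma is_derive_MVT (g dg : R -> R) (h : R) : 0 <= h ->
  (forall s, 0 <= s <= h -> is_derive s (1 : R) g (dg s)) ->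
  exists2 s, 0 <= s <= h & g h - g 0 = h * dg s.
Proof.
move=> h0 H; have [||s] := @MVT_segment R g dg 0 h h0.
- by move=> s; rewrite in_itv/= => /andP[s0 sh]; apply: H; rewrite !ltW.
- apply: derivable_within_continuous => s; rewrite in_itv/= => sh.
  by have [] := H s sh.
- by rewrite in_itv/= subr0 => sh ->; exists s => //; rewrite mulrC.
Qed.

(** The mean value theorem is used twice: in direction [v] for the difference of [f] along two
    parallel segments, then in direction [w] for ['D_v f]. *)
Lemma mixed_difference V (D : set V) (f : V -> R) x v w (h : R) :
  Ck_on 2 D f -> 0 <= h ->
  (forall s t : R, 0 <= s <= h -> 0 <= t <= h -> D (s *: v + (t *: w + x))) ->
  exists s t, [/\ 0 <= s <= h, 0 <= t <= h &
    f (h *: v + (h *: w + x)) - f (h *: v + x) - (f (h *: w + x) - f x)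
    = h * (h * 'D_w ('D_v f) (s *: v + (t *: w + x)))].
Proof.
move=> [_ /(_ v)[d1 [_ /(_ w)[d2 _]]]] h0 HD.
have hh : 0 <= h <= h by rewrite h0 lexx.
have h00 : (0 : R) <= 0 <= h by rewrite h0 lexx.
have HD0 s : 0 <= s <= h -> D (s *: v + x).
  by move=> sh; have := HD s 0 sh h00; rewrite scale0r add0r.
have [s sh Es] := @is_derive_MVT
  (fun s => f (s *: v + (h *: w + x)) - f (s *: v + x))
  (fun s => 'D_v f (s *: v + (h *: w + x)) - 'D_v f (s *: v + x)) h h0
  (fun s sh => is_derive_sub
    (is_derive_line (derivableP (d1 _ (HD s h sh hh))))
    (is_derive_line (derivableP (d1 _ (HD0 s sh))))).
have HD' t : 0 <= t <= h -> D (t *: w + (s *: v + x)).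
  by move=> th; rewrite addrCA; exact: HD.
have [t th Et] := @is_derive_MVT
  (fun t => 'D_v f (t *: w + (s *: v + x)))
  (fun t => 'D_w ('D_v f) (t *: w + (s *: v + x))) h h0
  (fun t th => is_derive_line (derivableP (d2 _ (HD' t th)))).
exists s, t; split=> //.
move: Es Et; rewrite !scale0r !add0r => ->.
by rewrite (addrCA (s *: v) (h *: w)) => ->; rewrite (addrCA (t *: w)).
Qed.

Lemma distr_le_split (a b c e : R) :
  `|a - c| < e / 2 -> `|b - c| < e / 2 -> `|b - a| <= e.
Proof.
move=> ac bc; rewrite -(subrKA c) (le_trans (ler_normD _ _))// (splitr e).
by rewrite lerD// ltW// distrC.
Qed.

(** The mixed difference over a parallelogram does not change when [v] and [w] are swapped. Hence
    the two mixed derivatives agree at two possibly different points near [x], and their continuity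
    at [x] makes them differ there by at most any [e > 0]. *)
Lemma clairaut V (D : set V) (f : V -> R) x v w : open D -> D x ->
  Ck_on 2 D f -> 'D_v ('D_w f) x = 'D_w ('D_v f) x.
Proof.
move=> oD Dx f2; have := f2; move=> [_ df].
have [_ [_ /(_ w)[_ [cwv _]]]] := df v.
have [_ [_ /(_ v)[_ [cvw _]]]] := df w.
apply/eqP; rewrite -subr_eq0 -normr_le0; apply/ler_addgt0Pr => e e0.
rewrite add0r; have e2 : 0 < e / 2 by rewrite divr_gt0.
have N1 : nbhs x D by apply: open_nbhs_nbhs.
have /cvgrPdist_lt/(_ _ e2) N2 := cwv x Dx.
have /cvgrPdist_lt/(_ _ e2) N3 := cvw x Dx.
have [r /= r0 Hr] := (nbhs_ballP _ _).1 (filterI N1 (filterI N2 N3)).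
(* Small enough for the parallelogram with sides [h *: v] and [h *: w] to stay in the ball of radius
   [r]; the [+ 1] keeps the denominator positive when both vectors vanish. *)
pose h := r / (2 * (`|v| + `|w| + 1)).
have m0 : 0 < 2 * (`|v| + `|w| + 1).
  by rewrite mulr_gt0// ltr_wpDl// addr_ge0.
have h0 : 0 < h by rewrite divr_gt0.
have hr : h * (`|v| + `|w|) < r.
  rewrite /h mulrAC ltr_pdivrMr// ltr_pM2l//.
  by have := normr_ge0 v; have := normr_ge0 w; lra.
have B s t : 0 <= s <= h -> 0 <= t <= h -> ball x r (s *: v + (t *: w + x)).
  move=> /andP[s0 sh] /andP[t0 th]; rewrite -ball_normE/=.
  rewrite addrA opprD addrCA subrr addr0 normrN.
  apply: le_lt_trans hr; rewrite mulrDr (le_trans (ler_normD _ _))// !normrZ.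
  by rewrite !ger0_norm// lerD// ler_wpM2r.
have B' s t : 0 <= s <= h -> 0 <= t <= h -> ball x r (t *: w + (s *: v + x)).
  by move=> sh th; rewrite addrCA; exact: B.
have [s [t [sh th E1]]] : exists s t, _ := mixed_difference f2 (ltW h0)
   (fun s t sh th => (Hr _ (B s t sh th)).1).
have [s' [t' [sh' th' E2]]] : exists s t, _ := mixed_difference f2 (ltW h0)
   (fun s t sh th => (Hr _ (B' t s th sh)).1).
have E : 'D_w ('D_v f) (s *: v + (t *: w + x)) =
         'D_v ('D_w f) (s' *: w + (t' *: v + x)).
  have hn0 : h != 0 by rewrite gt_eqF.
  have E3 : h * (h * 'D_w ('D_v f) (s *: v + (t *: w + x))) =
      h * (h * 'D_v ('D_w f) (s' *: w + (t' *: v + x))).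
    apply: (etrans (esym E1)); apply: etrans E2.
    rewrite (addrCA (h *: v)).
    move: (f (h *: w + (h *: v + x))) (f (h *: v + x)) (f (h *: w + x)) (f x).
    by move=> a b c d; ring.
  by move/(mulfI hn0)/(mulfI hn0): E3.
have [_ [a1 _]] := Hr _ (B s t sh th); have [_ [_ a2]] := Hr _ (B' t' s' th' sh').
by apply: distr_le_split a1 _; rewrite E; exact: a2.
Qed.

Lemma clairaut_mx V m n (D : set V) (f : V -> 'M[R]_(m, n)) x v w :
  open D -> D x -> smooth_on D f -> 'D_v ('D_w f) x = 'D_w ('D_v f) x.
Proof.
move=> oD Dx sf; apply/matrixP => i j.
have sfij := (smooth_on_mxP f oD).1 sf i j.
have E u u' : 'D_u ('D_u' f) x i j = 'D_u ('D_u' (fun y => f y i j)) x.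
  have [d _] := smooth_on_is_derive u (smooth_on_derive u' sf) Dx.
  rewrite derive_mx// mxE; apply: (derive_near _ oD Dx) => y Dy.
  have [d' _] := smooth_on_is_derive u' sf Dy.
  by rewrite derive_mx// mxE.
exact: etrans (E v w) (etrans (clairaut v w oD Dx (sfij 2%N)) (esym (E w v))).
Qed.

End Clairaut.

(** * Lebesgue measure on R^n and the divergence theorem *)

Section EuclideanMeasure.
Context {R : realType}.

Definition rowt n (t : n.-tuple (measurableTypeR R)) : 'rV[R]_n :=
  \row_i tnth t i.

Lemma rV_norm_le n (x : 'rV[R]_n) (M : R) : 0 <= M ->
  `|x| <= M <-> forall i, `|x 0 i| <= M.
Proof.
move=> M0; rewrite /Num.Def.normr/= mx_normrE; split=> [H i|H].
  by apply: le_trans H; exact: (le_bigmax _ (fun ij => `|x ij.1 ij.2|) (0, i)).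
by apply: bigmax_le => // -[i j] _/=; rewrite (ord1 i); exact: H.
Qed.

Lemma rV_norm_lt n (x : 'rV[R]_n) (M : R) : 0 < M ->
  `|x| < M <-> forall i, `|x 0 i| < M.
Proof.
move=> M0; rewrite /Num.Def.normr/= mx_normrE; split=> [H i|H].
  by apply: le_lt_trans H; exact: (le_bigmax _ (fun ij => `|x ij.1 ij.2|) (0, i)).
by apply/bigmax_ltP; split=> // -[i j] _/=; rewrite (ord1 i); exact: H.
Qed.

Definition tbox n (A : 'I_n -> set (measurableTypeR R)) :
    set (n.-tuple (measurableTypeR R)) :=
  [set t | forall i, A i (tnth t i)].

Lemma measurable_tbox n (A : 'I_n -> set (measurableTypeR R)) :
  (forall i, measurable (A i)) -> measurable (tbox A).
Proof.
move=> mA; have -> : tbox A = \bigcap_(i in [set: 'I_n]) ((fun t => tnth t i) @^-1` A i).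
  by apply/seteqP; split=> t /= H i; [move=> _|]; apply: H.
apply: fin_bigcap_measurable => // i _; rewrite -[X in measurable X]setTI.
exact: measurable_tnth.
Qed.

(** This links the sup-norm topology of row vectors with the product sigma-algebra of tuples: an
    open set is the union of the countably many rational cubes that it contains. *)
Lemma measurable_rowt_preimage n (U : set 'rV[R]_n) :
  open U -> measurable (@rowt n @^-1` U).
Proof.
move=> oU.
pose box (q : 'rV[rat]_n * rat) : set (n.-tuple (measurableTypeR R)) :=
  tbox (fun i => [set y : measurableTypeR R | `|ratr (q.1 0 i) - y| < ratr q.2]).
pose F q := if asbool (box q `<=` @rowt n @^-1` U) then box q else set0.
have mbox q : measurable (box q).
  apply: measurable_tbox => i.
  have -> : [set y : measurableTypeR R | `|ratr (q.1 0 i) - y| < ratr q.2] =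
     ball (ratr (q.1 0 i) : R) (ratr q.2) by rewrite -ball_normE.
  by rewrite ball_itv; exact: measurable_itv.
have -> : @rowt n @^-1` U = \bigcup_q F q.
  apply/seteqP; split=> [t Ut|t [q _]]; last first.
    by rewrite /F; case: asboolP => // H /H.
  have /nbhs_ballP[e /= e0 He] : nbhs (rowt t) U by apply: open_nbhs_nbhs.
  have e20 : 0 < e / 2 by rewrite divr_gt0.
  have [r] := rat_in_itvoo e20.
  rewrite in_itv/= => /andP[r0 re].
  (* The rational centre is within [r] of [t] in each coordinate. As [2 * r < e], the cube of
     half-side [r] around it contains [t] and stays in the ball of radius [e]. *)
  have Hq i : exists q : rat, ratr q \in `]tnth t i, (tnth t i + ratr r)[.
    by apply: rat_in_itvoo; rewrite ltrDl.
  pose q : 'rV[rat]_n := \row_i sval (cid (Hq i)).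
  have qt : box (q, r) t.
    move=> i /=; rewrite mxE; case: cid => p /=.
    rewrite in_itv/= => /andP[p1 p2].
    by rewrite gtr0_norm ?subr_gt0// ltrBlDl.
  exists (q, r) => //; rewrite /F; case: asboolP => // -[] u /= Hu.
  apply: He; rewrite -ball_normE/= rV_norm_lt// => i.
  move: (qt i) => /= Ht; have /= := Hu i => {}Hu.
  rewrite !mxE; have -> : tnth t i - tnth u i =
    (ratr (q 0 i) - tnth u i) - (ratr (q 0 i) - tnth t i) by ring.
  rewrite (le_lt_trans (ler_normB _ _))//; lra.
apply: countable_bigcupT_measurable; first exact: countableP.
by move=> q; rewrite /F; case: asboolP.
Qed.

Lemma measurable_continuous n (f : 'rV[R]_n -> R) :
  continuous f -> measurable_fun setT (f \o @rowt n).
Proof.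
move=> cf; apply: (measurability _ (RGenOInfty.measurableE R)).
move=> _ [_ [a ->] <-]; rewrite setTI.
have oU : open (f @^-1` `]a, +oo[%classic).
  by apply: open_comp; [move=> x _; exact: cf|exact: interval_open].
exact: (measurable_rowt_preimage oU).
Qed.

Lemma lebesgue_Rn_tbox n (A : 'I_n -> set (measurableTypeR R)) :
  (forall i, measurable (A i)) ->
  lebesgue_Rn R n (tbox A) = (\prod_(i < n) (@lebesgue_measure R) (A i))%E.
Proof.
elim: n A => [|n IH] A mA.
  by rewrite big_ord0 /= diracE mem_set// => -[].
rewrite big_ord_recl /= /lebesgue_step /pushforward.
have -> : @tcons R n @^-1` tbox A = A ord0 `*` tbox (fun i => A (lift ord0 i)).
  apply/seteqP; split=> -[s t]/= H.
    split=> [|i] /=; first by have := H ord0; rewrite /tcons/= tnth0.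
    by have := H (lift ord0 i); rewrite /tcons/= tnthS.
  move=> i; case: (unliftP ord0 i) => [j|] ->; rewrite /tcons/= ?tnthS ?tnth0.
    by case: H => _; apply.
  by case: H.
by rewrite product_measure1E//; [rewrite IH|exact: measurable_tbox].
Qed.

Lemma lebesgue_Rn_itv n (a b : 'I_n -> R) : (forall i, a i <= b i) ->
  lebesgue_Rn R n (tbox (fun i => [set` `[a i, b i]%R])) =
  (\prod_(i < n) (b i - a i))%:E.
Proof.
move=> ab; rewrite lebesgue_Rn_tbox => [|i]; last exact: measurable_itv.
rewrite (big_morph EFin EFinM erefl); apply: eq_bigr => i _.
rewrite lebesgue_measure_itv/= lte_fin; case: ltgtP (ab i) => // -> _.
by rewrite subrr.
Qed.

Lemma integrable_Rn_tbox n (M : R) : 0 <= M ->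
  (lebesgue_Rn R n).-integrable setT
    (fun t => (\1_(tbox (fun=> [set` `[- M, M]%R])) t)%:E).
Proof.
move=> M0; set A := tbox _.
have mA : measurable A by apply: measurable_tbox => i; exact: measurable_itv.
apply/integrableP; split.
  by apply/measurable_EFinP; exact: measurable_indic.
under eq_integral => t _ do rewrite gee0_abs ?lee_fin//.
have MM (i : 'I_n) : - M <= M by rewrite -subr_ge0 opprK addr_ge0.
rewrite integral_indic// setIT.
have H : (lebesgue_Rn R n A < +oo)%E by rewrite (lebesgue_Rn_itv MM) ltry.
exact: H.
Qed.

Lemma rowt_tboxP n (t : n.-tuple (measurableTypeR R)) (M : R) : 0 <= M ->
  tbox (fun=> [set` `[- M, M]%R]) t <-> `|rowt t| <= M.
Proof.
move=> M0; rewrite rV_norm_le//; split=> H i; have := H i.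
  by rewrite /= in_itv/= mxE ler_norml.
by rewrite /= in_itv/= mxE ler_norml.
Qed.

Lemma integrable_Rn_bounded_support n (f : 'rV[R]_n -> R) (M C : R) :
  measurable_fun setT (f \o @rowt n) -> (forall x, `|f x| <= C) ->
  (forall x, M < `|x| -> f x = 0) -> integrable_Rn f.
Proof.
move=> mf fC fM; pose M' := Num.max M 0.
have M'0 : 0 <= M' by rewrite le_max lexx orbT.
apply: (@le_integrable _ _ _ _ _ measurableT _ (fun t => (C%:E *
   (\1_(tbox (fun=> [set` `[- M', M']%R])) t)%:E)%E)) => //.
- exact/measurable_EFinP.
- move=> t _; rewrite -EFinM !abse_EFin lee_fin indicE.
  have C0 : 0 <= C by apply: le_trans (fC (rowt t)).
  case: (boolP (t \in _)) => [_|/negP tM].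
    by rewrite mulr1 (ger0_norm C0).
  rewrite fM ?normr0 ?normr_ge0// ltNge; apply/negP => tM'; apply: tM.
  by rewrite inE; apply/rowt_tboxP => //; rewrite le_max tM'.
- by apply: integrableZl => //; exact: integrable_Rn_tbox.
Qed.

Lemma continuous_bounded_support n (f : 'rV[R]_n -> R) (M : R) :
  continuous f -> (forall x, M < `|x| -> f x = 0) ->
  exists C, forall x, `|f x| <= C.
Proof.
move=> cf fM; pose M' := Num.max M 0.
have M'0 : 0 <= M' by rewrite le_max lexx orbT.
pose K := [set x : 'rV[R]_n | `|x| <= M'].
have cK : compact K.
  apply: bounded_closed_compact.
    exists M'; split; first exact: num_real.
    by move=> x Mx y /= yM; rewrite (le_trans yM)// ltW.
  rewrite (_ : K = (fun x : 'rV[R]_n => `|x|) @^-1` [set r | r <= M'])//.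
  apply: closed_comp; last exact: closed_le.
  by move=> x _; exact: norm_continuous.
have K0 : K !=set0 by exists 0; rewrite /K/= normr0.
have [|c _ Hc] := EVT_max_rV (f := fun x => `|f x|) K0 cK.
  apply: continuous_subspaceT => x.
  by apply: continuous_comp; [exact: cf|exact: norm_continuous].
exists `|f c| => x; have [xM|xM] := leP `|x| M'; first by apply: Hc; rewrite inE.
by rewrite fM ?normr0// (le_lt_trans _ xM)// le_max lexx.
Qed.

Lemma integrable_Rn_continuous_support n (f : 'rV[R]_n -> R) (M : R) :
  continuous f -> (forall x, M < `|x| -> f x = 0) -> integrable_Rn f.
Proof.
move=> cf fM; have [C fC] := continuous_bounded_support cf fM.
by apply: (integrable_Rn_bounded_support (measurable_continuous cf) fC fM).
Qed.

Lemma integral_line_derive0 (g dg : R -> R) (M : R) : continuous dg ->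
  (forall s, is_derive s (1 : R) g (dg s)) ->
  (forall s, M < `|s| -> g s = 0) -> (forall s, M < `|s| -> dg s = 0) ->
  (\int[@lebesgue_measure R]_s (dg s)%:E = 0)%E.
Proof.
(* The [+ 1] puts the end points of [[- a, a]] strictly outside the support bound, so [g] vanishes
   at both and the fundamental theorem of calculus gives 0. *)
move=> cdg gdg gM dgM; pose a := Num.max M 0 + 1.
have a0 : 0 < a by rewrite ltr_wpDl// le_max lexx orbT.
have aM : M < a by rewrite ltr_pwDr// le_max lexx.
have cg : continuous g.
  by move=> s; have [d _] := gdg s; apply/differentiable_continuous/derivable1_diffP.
have -> : (\int[@lebesgue_measure R]_s (dg s)%:E =
    \int[@lebesgue_measure R]_(s in [set` `[- a, a]%R]) (dg s)%:E)%E.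
  rewrite [RHS]integral_mkcond; apply: eq_integral => s _; rewrite patchE.
  case: ifPn => // /negP sa; rewrite dgM// ltNge; apply/negP => sM; apply: sa.
  by rewrite inE/= in_itv/= -ler_norml (le_trans sM)// ltW.
rewrite (@continuous_FTC2 _ _ g).
- rewrite !gM ?subee//; first by rewrite normrN gtr0_norm.
  by rewrite gtr0_norm.
- by rewrite gtrN.
- exact: continuous_subspaceT.
- split; first by move=> s _; have [] := gdg s.
  - exact/cvg_at_right_filter/cg.
  - exact/cvg_at_left_filter/cg.
- by move=> s _; rewrite derive1E; have [] := gdg s.
Qed.

Definition consr n (s : R) (x : 'rV[R]_n) : 'rV[R]_n.+1 :=
  \row_i (if unlift ord0 i is Some j then x 0 j else s).

Lemma consr0 n s (x : 'rV[R]_n) : consr s x 0 ord0 = s.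
Proof. by rewrite mxE unlift_none. Qed.

Lemma consrS n s (x : 'rV[R]_n) j : consr s x 0 (lift ord0 j) = x 0 j.
Proof. by rewrite mxE liftK. Qed.

Lemma rowt_tcons n s (t : n.-tuple (measurableTypeR R)) :
  rowt (tcons (s, t)) = consr s (rowt t).
Proof.
apply/rowP => i; case: (unliftP ord0 i) => [j|] ->.
  by rewrite consrS !mxE /tcons/= tnthS.
by rewrite consr0 !mxE /tcons/= tnth0.
Qed.

Lemma continuous_consrl n (x : 'rV[R]_n) : continuous (fun s => consr s x).
Proof.
move=> s; apply/(@continuous_mxP R R^o) => i j.
rewrite /prop_for /continuous_at.
case: (unliftP ord0 j) => [k|] ->; rewrite (ord1 i).
  by under eq_fun do rewrite consrS; rewrite consrS; exact: cvg_cst.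
by under eq_fun do rewrite consr0; rewrite consr0; exact: cvg_id.
Qed.

Lemma continuous_consrr n (s : R) : continuous (@consr n s).
Proof.
move=> x; apply/(@continuous_mxP R 'rV[R]_n) => i j.
rewrite /prop_for /continuous_at.
case: (unliftP ord0 j) => [k|] ->; rewrite (ord1 i).
  by under eq_fun do rewrite consrS; rewrite consrS; apply: coord_continuous.
under eq_fun do rewrite consr0; rewrite consr0; exact: (@cvg_cst _ _ _ (nbhs x) (nbhs_filter x)).
Qed.

Lemma norm_consrl n (s : R) (x : 'rV[R]_n) : `|s| <= `|consr s x|.
Proof.
by have /rV_norm_le/(_ ord0) := lexx `|consr s x|; rewrite consr0; apply.
Qed.

Lemma norm_consrr n (s : R) (x : 'rV[R]_n) : `|x| <= `|consr s x|.
Proof.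
rewrite rV_norm_le// => j.
by have /rV_norm_le/(_ (lift ord0 j)) := lexx `|consr s x|; rewrite consrS; apply.
Qed.

Lemma consr_shift0 n (s h : R) (x : 'rV[R]_n) :
  consr (h *: (1 : R^o) + s) x = h *: basis_vec R ord0 + consr s x.
Proof.
apply/rowP => i; rewrite !mxE; case: (unliftP ord0 i) => [j|] ->.
  by rewrite (_ : (lift ord0 j == ord0) = false)// andbF mulr0 add0r.
by rewrite !eqxx mulr1 [h *: 1]mulr1.
Qed.

Lemma consr_shiftS n (s h : R) (x : 'rV[R]_n) j :
  consr s (h *: basis_vec R j + x) = h *: basis_vec R (lift ord0 j) + consr s x.
Proof.
apply/rowP => i; rewrite !mxE; case: (unliftP ord0 i) => [k|] ->.
  by rewrite !mxE (inj_eq lift_inj).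
by rewrite (_ : (ord0 == lift ord0 j) = false)// andbF mulr0 add0r.
Qed.

(** By definition the measure in dimension [n.+1] is the pushforward of a product measure along
    [tcons]; this lemma and the next are the resulting change of variables, which makes Fubini
    available. *)
Lemma integrable_Rn_tcons n (f : 'rV[R]_n.+1 -> R) : integrable_Rn f ->
  (@lebesgue_measure R \x lebesgue_Rn R n)%E.-integrable setT
    (fun p => (f (consr p.1 (rowt p.2)))%:E).
Proof.
move=> /integrableP[mf foo].
have mf' : measurable_fun setT (fun p : measurableTypeR R * n.-tuple (measurableTypeR R) =>
    (f (consr p.1 (rowt p.2)))%:E).
  rewrite (_ : (fun p => _) = (fun t => (f (rowt t))%:E) \o @tcons R n).
    by apply: measurableT_comp => //; exact: measurable_tcons.
  by apply/funext => -[s t] /=; rewrite rowt_tcons.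
apply/integrableP; split => //; move: foo.
have mabs : measurable_fun setT (fun t => `|(f (@rowt n.+1 t))%:E|%E).
  exact: measurableT_comp.
have := @ge0_integral_pushforward _ _ _ _ _ _ (@measurable_tcons R n)
  (@lebesgue_measure R \x lebesgue_Rn R n)%E setT
  (fun t => `|(f (rowt t))%:E|%E) measurableT mabs (fun _ _ => abse_ge0 _).
rewrite preimage_setT => E H.
have {E}H : (\int[(@lebesgue_measure R \x lebesgue_Rn R n)]_p
    ((fun t => `|(f (rowt t))%:E|) \o @tcons R n) p < +oo)%E.
  by move: H; apply: le_lt_trans; rewrite -E.
move: H; congr (_ < _)%E; apply: eq_integral => -[s t] _ /=.
by rewrite rowt_tcons.
Qed.

Lemma integral_Rn_tcons n (f : 'rV[R]_n.+1 -> R) : integrable_Rn f ->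
  (\int[lebesgue_Rn R n.+1]_t (f (rowt t))%:E =
   \int[(@lebesgue_measure R \x lebesgue_Rn R n)]_p
      (f (consr p.1 (rowt p.2)))%:E)%E.
Proof.
move=> intf; have /integrableP[mf _] := intf.
have E : (fun t => (f (rowt t))%:E) \o @tcons R n =
    (fun p => (f (consr p.1 (rowt p.2)))%:E).
  by apply/funext => -[s t] /=; rewrite rowt_tcons.
rewrite (@integral_pushforward _ _ _ _ _ _ (@measurable_tcons R n))//.
- by rewrite preimage_setT; congr (integral _ _ _).
- by rewrite preimage_setT E; exact: integrable_Rn_tcons.
Qed.

Lemma is_derive_support n (i : 'I_n) (u du : 'rV[R]_n -> R) (M : R) :
  (forall x, is_derive x (basis_vec R i) u (du x)) ->
  (forall x, M < `|x| -> u x = 0) -> forall x, M < `|x| -> du x = 0.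
Proof.
move=> hu uM x Mx; have [_ <-] := hu x.
rewrite (derive_near (D := [set y : 'rV[R]_n | M < `|y|]) (g := fun _ => 0)) //.
- by have [] := is_derive_const (0 : R) x (basis_vec R i).
- rewrite (_ : mkset _ = (fun x : 'rV[R]_n => `|x|) @^-1` [set r | M < r])//.
  apply: open_comp; last exact: open_gt.
  by move=> y _; exact: norm_continuous.
Qed.

(** Fubini, by induction on the dimension with the first coordinate split off. The order of
    integration is chosen so that the inner integral contains the direction of differentiation, and
    this inner integral already vanishes. *)
Lemma integral_Rn_partial n (i : 'I_n) (u du : 'rV[R]_n -> R) (M : R) :
  (forall x, is_derive x (basis_vec R i) u (du x)) -> continuous du ->
  (forall x, M < `|x| -> u x = 0) ->
  (\int[lebesgue_Rn R n]_t (du (rowt t))%:E = 0)%E.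
Proof.
elim: n i u du => [[] //|n IH] i u du hu cdu uM.
have duM := is_derive_support hu uM.
have idu : integrable_Rn du by apply: (integrable_Rn_continuous_support cdu duM).
rewrite integral_Rn_tcons//; have idu' := integrable_Rn_tcons idu.
case: (unliftP ord0 i) => [j|] Ei; rewrite {}Ei in hu.
  rewrite -integral12_prod_meas1//; apply: integral0_eq => s _.
  rewrite /fubini_F/=; apply: (IH j (fun x => u (consr s x)) (fun x => du (consr s x))).
  - move=> x; have H h := consr_shiftS s h x j.
    by apply: (@is_derive_affine R 'rV[R]_n 'rV[R]_n.+1 R^o (@consr n s) u x
      _ _ _ H).1; exact: hu.
  - by move=> x; apply: continuous_comp; [exact: continuous_consrr|exact: cdu].
  - by move=> x Mx; apply: uM; rewrite (lt_le_trans Mx)// norm_consrr.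
(* The derivative is along the first coordinate: integrate over it first, with the others frozen. *)
rewrite -integral21_prod_meas1//; apply: integral0_eq => t _.
rewrite /fubini_G/=; apply: (@integral_line_derive0
   (fun s => u (consr s (rowt t))) (fun s => du (consr s (rowt t))) M).
- by move=> s; apply: continuous_comp; [exact: continuous_consrl|exact: cdu].
- move=> s; have H h := consr_shift0 s h (rowt t).
  by apply: (@is_derive_affine R R^o 'rV[R]_n.+1 R^o (fun s => consr s (rowt t))
    u s _ _ _ H).1; exact: hu.
- by move=> s Ms; apply: uM; rewrite (lt_le_trans Ms)// norm_consrl.
- by move=> s Ms; apply: duM; rewrite (lt_le_trans Ms)// norm_consrl.
Qed.

End EuclideanMeasure.

(** * A smooth function that is flat at the origin *)

Section FlatFunction.
Context {R : realType}.

(** Each monomial [y ^+ i] is at most i! times the exponential, by its Taylor series. *)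
Lemma horner_le_expR (p : {poly R}) :
  exists C, forall y, 0 <= y -> `|p.[y]| <= C * expR y.
Proof.
exists (\sum_(i < size p) `|p`_i| * i`!%:R) => y y0.
rewrite horner_coef mulr_suml (le_trans (ler_norm_sum _ _ _))//.
apply: ler_sum => i _; rewrite normrM -mulrA ler_wpM2l//.
rewrite ger0_norm ?exprn_ge0//.
case: (nat_of_ord i) => [|k]; first by rewrite expr0 fact0 mul1r -expR0 ler_expR.
rewrite mulrC -ler_pdivrMr ?ltr0n ?fact_gt0//.
by apply: le_trans (expR_ge1Dxn k y0); rewrite lerDr.
Qed.

(* Closed under differentiation up to the change of polynomial [flat_deriv];
   [flat 1] is the classical function exp(-1/t). *)
Definition flat (p : {poly R}) (t : R) : R :=
  if 0 < t then p.[t^-1] * expR (- t^-1) else 0.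

(** With u = 1/t, the derivative in t of p(u) exp(-u) is u^2 (p(u) - p'(u)) exp(-u). *)
Definition flat_deriv (p : {poly R}) : {poly R} := 'X^2 * (p - p^`()).

Lemma flat_bounded p : exists C, forall t, `|flat p t| <= C.
Proof.
have [C HC] := horner_le_expR p; exists C => t; rewrite /flat.
have C0 : 0 <= C by have := HC 0 (lexx _); rewrite expR0 mulr1; exact: le_trans.
case: ifPn => t0; last by rewrite normr0.
rewrite normrM (ger0_norm (expR_ge0 _)) expRN ler_pdivrMr ?expR_gt0//.
by apply: HC; rewrite invr_ge0 ltW.
Qed.

(** Boundedness of [flat ('X^2 * p)], divided by [t ^- 2]. Quadratic vanishing at 0 is what makes
    the derivative there exist and equal 0. *)
Lemma flat_quadratic p : exists C, forall t, `|flat p t| <= C * t ^+ 2.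
Proof.
have [C HC] := flat_bounded ('X^2 * p); exists C => t; have := HC t.
rewrite /flat; case: ifPn => [t0|_]; last first.
  by rewrite normr0 => C0; rewrite mulr_ge0// sqr_ge0.
have t20 : 0 < t ^+ 2 by rewrite exprn_gt0.
rewrite hornerM hornerXn exprVn -mulrA normrM ger0_norm ?invr_ge0 ?(ltW t20)//.
by rewrite ler_pdivrMl// (mulrC C).
Qed.

Lemma is_derive_inv (t : R) : t != 0 -> is_derive t (1 : R) (fun y : R => y^-1) (- t ^- 2).
Proof.
move=> t0; have [d e] : is_derive t (1 : R) (fun y : R => y) (1 : R) by exact: is_derive_id.
by split; [exact: derivableV|rewrite deriveV// e [_ *: 1]mulr1].
Qed.

Lemma is_derive_flat p (t : R) : is_derive t (1 : R) (flat p) (flat (flat_deriv p) t).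
Proof.
have [t0|t0|->] := ltgtP t 0.
- rewrite {2}/flat ltNge (ltW t0)/=.
  apply: (@is_derive_near R R^o R^o [set y | y < 0] (fun=> 0)) => //.
  + by move=> y /= y0; rewrite /flat ltNge (ltW y0).
- rewrite {2}/flat t0.
  apply: (@is_derive_near R R^o R^o [set y | 0 < y]
      ((fun u => p.[u] * expR (- u)) \o (fun y => y^-1))) => //.
  + by move=> y /= y0; rewrite /flat y0.
  apply: (is_derive_eq (f' := (p^`().[t^-1] * expR (- t^-1) +
      p.[t^-1] * (expR (- t^-1) * -1)) * (- t ^- 2))).
    have He := is_derive_chain (is_derive_oppr (is_derive_id (t^-1) (1 : R)))
      (is_derive_expR (- t^-1)).
    exact: (is_derive_chain (is_derive_inv (lt0r_neq0 t0))
      (is_derive_mul (is_derive_poly p (t^-1)) He)).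
  rewrite /flat_deriv hornerM hornerXn hornerD hornerN exprVn; ring.
- have f0 q : flat q 0 = 0 by rewrite /flat ltxx.
  rewrite f0; have [C HC] := flat_quadratic p.
  have C0 : 0 <= C.
    by have := HC 1; rewrite expr1n mulr1; exact: le_trans.
  (* [C] may be 0, so the radius below is [e / (C + 1)]. *)
  have C1 : 0 < C + 1 by rewrite ltr_wpDl.
  suff H : (h^-1 *: ((flat p \o shift 0) (h *: 1) - flat p 0)) @[h --> 0^'] --> (0 : R).
    by split; [apply/cvg_ex; exists 0|exact/cvg_lim].
  apply/cvgrPdist_le => /= e e0; near=> h.
  rewrite sub0r normrN f0 subr0 addr0 [h *: 1]mulr1.
  have h0 : h != 0 by near: h; exact: nbhs_dnbhs_neq.
  rewrite normrZ normfV ler_pdivrMl ?normr_gt0// (le_trans (HC h))//.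
  rewrite -(real_normK (num_real h)) expr2 mulrCA ler_wpM2l//.
  have : `|h| < e / (C + 1).
    by near: h; apply: dnbhs0_lt; exact: divr_gt0.
  rewrite ltr_pdivlMr// => he; apply: ltW; apply: le_lt_trans he.
  by rewrite mulrC ler_wpM2l// lerDl.
Unshelve. all: by end_near. Qed.

Lemma continuous_flat p : continuous (flat p).
Proof.
move=> t; have [d _] := is_derive_flat p t.
exact/differentiable_continuous/derivable1_diffP.
Qed.

Lemma smooth_flat p : smooth_on [set: R] (flat p).
Proof.
move=> k; elim: k p => [|k IH] p; split=> //;
  try by move=> t _; exact: continuous_flat.
move=> v; have H t := is_derive_fun1 v (is_derive_flat p t).
split=> [t _|]; first by have [] := H t.
rewrite [X in Ck_on _ _ X](_ : _ = fun t => flat (flat_deriv p) t * v).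
  by apply: Ck_onM; [exact: openT|exact: IH|exact: Ck_on_cst].
by apply/funext => t; have [_ ->] := H t.
Qed.

End FlatFunction.

(** * Euclidean length and bump functions *)

Section Divergence.
Context {R : realType}.

Lemma sqnorm_ge0 n (x : 'rV[R]_n) : 0 <= sqnorm x.
Proof. by apply: sumr_ge0 => i _; exact: sqr_ge0. Qed.

Lemma sqr_coord_le n (x : 'rV[R]_n) i : x 0 i ^+ 2 <= sqnorm x.
Proof.
by rewrite /sqnorm (bigD1 i)//= lerDl; apply: sumr_ge0 => j _; exact: sqr_ge0.
Qed.

Lemma lt_norm_sqnorm n (x : 'rV[R]_n) (M : R) : 0 <= M ->
  M < `|x| -> M ^+ 2 < sqnorm x.
Proof.
move=> M0; rewrite !ltNge; apply: contra => xM; apply/rV_norm_le => // i.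
rewrite -(@ler_pXn2r _ 2)// ?nnegrE// real_normK ?num_real//.
exact: le_trans (sqr_coord_le x i) xM.
Qed.

Lemma is_derive_sqnorm n (x0 x v : 'rV[R]_n) :
  is_derive x v (fun y => sqnorm (y - x0)) (\sum_i 2 * (x - x0) 0 i * v 0 i).
Proof.
apply: is_derive_bigsum => i _; rewrite [X in is_derive _ _ X](_ : _ =
    fun y : 'rV[R]_n => (y - x0) 0 i * (y - x0) 0 i); last first.
  by apply/funext => y; rewrite expr2.
have H : is_derive x v (fun y : 'rV[R]_n => (y - x0) 0 i) (v 0 i).
  rewrite [X in is_derive _ _ X](_ : _ = fun y : 'rV[R]_n => y 0 i - x0 0 i); last first.
    by apply/funext => y; rewrite !mxE.
  have := is_derive_sub (is_derive_coord x v 0 i) (is_derive_const (x0 0 i) x v).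
  by rewrite subr0.
by apply: (is_derive_eq (is_derive_mul H H)); ring.
Qed.

Lemma is_derive_sqnorm_basis n (x0 x : 'rV[R]_n) i :
  is_derive x (basis_vec R i) (fun y => sqnorm (y - x0)) (2 * (x - x0) 0 i).
Proof.
apply: (is_derive_eq (is_derive_sqnorm x0 x (basis_vec R i))).
rewrite (bigD1 i)//= big1 ?addr0 => [|j ji]; rewrite !mxE eqxx/= ?eqxx ?mulr1//.
by rewrite (negbTE ji) mulr0.
Qed.

Lemma smooth_sqnorm n (x0 : 'rV[R]_n) D : open D ->
  smooth_on D (fun y => sqnorm (y - x0)).
Proof.
move=> oD; apply: smooth_on_sum => // i _.
under eq_fun do rewrite expr2.
have H : smooth_on D (fun y : 'rV[R]_n => (y - x0) 0 i).
  under eq_fun do rewrite !mxE.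
  by apply: smooth_onD => //; [exact: smooth_on_coord|exact: smooth_on_cst].
exact: smooth_onM.
Qed.

Lemma continuous_sqnorm n (x0 : 'rV[R]_n) : continuous (fun y : 'rV[R]_n => sqnorm (y - x0)).
Proof. by move=> x; apply: smooth_on_continuous (smooth_sqnorm x0 openT) I. Qed.

(** Keeping [p] arbitrary makes the family stable: a partial derivative of a bump is the bump of
    [flat_deriv p] times a linear factor. With [p = 1] the value at the centre is exp(-1), not 1. *)
Definition bump n (c : 'rV[R]_n) (rho : R) (p : {poly R}) (x : 'rV[R]_n) : R :=
  flat p (1 - rho ^- 2 * sqnorm (x - c)).

Lemma smooth_bump n (c : 'rV[R]_n) rho p : smooth_on setT (bump c rho p).
Proof.
apply: (@smooth_on_chain R 'rV[R]_n setT (flat p)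
  (fun y : 'rV[R]_n => 1 - rho ^- 2 * sqnorm (y - c))); first exact: openT.
  exact: smooth_flat.
under eq_fun do rewrite -mulNr.
apply: smooth_onD; first exact: openT; first exact: smooth_on_cst.
by apply: smooth_onM; [exact: openT|exact: smooth_on_cst|apply: smooth_sqnorm; exact: openT].
Qed.

Lemma continuous_bump n (c : 'rV[R]_n) rho p : continuous (bump c rho p).
Proof. by move=> x; apply: smooth_on_continuous (smooth_bump c rho p) I. Qed.

Lemma is_derive_bump n (c : 'rV[R]_n) rho p x i :
  is_derive x (basis_vec R i) (bump c rho p)
    (bump c rho (flat_deriv p) x * (- (rho ^- 2 * (2 * (x - c) 0 i)))).
Proof.
have H := is_derive_scale (rho ^- 2) (is_derive_sqnorm_basis c x i).
have H' := is_derive_sub (is_derive_const (1 : R) x (basis_vec R i)) H.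
rewrite sub0r in H'.
exact: (is_derive_chain H' (is_derive_flat p _)).
Qed.

Lemma bump_support n (c : 'rV[R]_n) rho p x : 0 < rho ->
  rho ^+ 2 <= sqnorm (x - c) -> bump c rho p x = 0.
Proof.
move=> r0 H; rewrite /bump /flat ltNge subr_le0.
by rewrite ler_pdivlMl ?mulr1 ?H// exprn_gt0.
Qed.

(** The Euclidean length dominates the sup norm, so a sup-norm bound, as used by the integration
    lemmas, suffices to leave the Euclidean ball. *)
Lemma bump_norm_support n (c : 'rV[R]_n) rho p x : 0 < rho ->
  `|c| + rho < `|x| -> bump c rho p x = 0.
Proof.
move=> r0 H; apply: bump_support => //; apply/ltW/lt_norm_sqnorm; first exact: ltW.
by rewrite -(ltrD2l `|c|) (lt_le_trans H)// -[X in `|X|](subrK c) addrC ler_normD.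
Qed.

(** Where the cutoff of radius k+1 is nonzero, each coordinate is at most k+1, so the factor 2 x_i /
    (k+1)^2 from the chain rule is at most 2 / (k+1). *)
Lemma is_derive_cutoff_bounded n p : exists C, forall (k : nat) (x : 'rV[R]_n) i,
  `|bump 0 k.+1%:R p x * (- (k.+1%:R ^- 2 * (2 * (x - 0) 0 i)))| <= C * k.+1%:R^-1.
Proof.
have [C HC] := flat_bounded p; exists (C * 2) => k x i.
have C0 : 0 <= C by apply: le_trans (HC 0).
have k0 : 0 < k.+1%:R :> R by rewrite ltr0n.
have [xk|kx] := leP `|x| k.+1%:R; last first.
  rewrite bump_norm_support ?normr0 ?add0r// ?mul0r ?normr0.
  by rewrite !mulr_ge0// invr_ge0 ltW.
rewrite normrM normrN -mulrA ler_pM//; first exact: HC.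
rewrite normrM normfV normrX (gtr0_norm k0) subr0 normrM normr_nat.
have xi : `|x 0 i| <= k.+1%:R by have /rV_norm_le := xk; apply; exact: ltW.
rewrite ler_pdivrMl ?exprn_gt0// expr2 mulrCA -mulrA mulfV ?gt_eqF// mulr1.
by rewrite ler_wpM2l.
Qed.

End Divergence.

(** * The divergence theorem for integrable fields *)

Section DivergenceTheorem.
Context {R : realType}.

Lemma continuous_sum (T : topologicalType) (I : Type) (s : seq I) (P : pred I)
    (f : I -> T -> R) :
  (forall i, P i -> continuous (f i)) ->
  continuous (fun x => \sum_(i <- s | P i) f i x).
Proof.
move=> cf x; elim: s => [|i s IH].
  rewrite /continuous_at big_nil; under eq_fun do rewrite big_nil.
  exact: (@cvg_cst _ _ _ (nbhs x) (nbhs_filter x)).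
rewrite /continuous_at big_cons; under eq_fun do rewrite big_cons.
case: (boolP (P i)) => // Pi; apply: (@cvgD _ _ _ (nbhs x) (nbhs_filter x)) => //.
exact: cf.
Qed.

Lemma continuous_mul (T : topologicalType) (f g : T -> R) :
  continuous f -> continuous g -> continuous (fun x => f x * g x).
Proof. by move=> cf cg x; apply: cvgM; [exact: cf|exact: cg]. Qed.

Lemma continuous_add (T : topologicalType) (f g : T -> R) :
  continuous f -> continuous g -> continuous (fun x => f x + g x).
Proof. by move=> cf cg x; apply: cvgD; [exact: cf|exact: cg]. Qed.

Lemma continuous_const (T : topologicalType) (c : R) :
  continuous (fun _ : T => c).
Proof. by move=> x; exact: cvg_cst. Qed.

Lemma integrable_Rn_sum n (I : Type) (s : seq I) (P : pred I)
    (f : I -> 'rV[R]_n -> R) :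
  (forall i, P i -> integrable_Rn (f i)) ->
  integrable_Rn (fun x => \sum_(i <- s | P i) f i x).
Proof.
move=> H; rewrite /integrable_Rn.
under eq_fun do rewrite -sumEFin.
by apply: (integrable_sum measurableT) => i Pi; exact: H.
Qed.

Lemma integral_Rn_sum n (I : Type) (s : seq I) (P : pred I)
    (f : I -> 'rV[R]_n -> R) :
  (forall i, integrable_Rn (f i)) ->
  (\int[lebesgue_Rn R n]_t (\sum_(i <- s | P i) f i (rowt t))%:E =
   \sum_(i <- s | P i) \int[lebesgue_Rn R n]_t (f i (rowt t))%:E)%E.
Proof.
move=> H; under eq_integral do rewrite -sumEFin.
exact: (integral_sum measurableT (f := fun i t => (f i (rowt t))%:E) H).
Qed.

Lemma integrable_RnD n (f g : 'rV[R]_n -> R) :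
  integrable_Rn f -> integrable_Rn g -> integrable_Rn (fun x => f x + g x).
Proof.
move=> hf hg; rewrite /integrable_Rn; under eq_fun do rewrite EFinD.
exact: (integrableD measurableT hf hg).
Qed.

Lemma integrable_RnZ n (k : R) (f : 'rV[R]_n -> R) :
  integrable_Rn f -> integrable_Rn (fun x => k * f x).
Proof.
move=> hf; rewrite /integrable_Rn; under eq_fun do rewrite EFinM.
exact: (integrableZl measurableT k hf).
Qed.

Lemma integrable_Rn_le n (f g : 'rV[R]_n -> R) :
  measurable_fun setT (f \o @rowt R n) -> (forall x, `|f x| <= g x) ->
  integrable_Rn g -> integrable_Rn f.
Proof.
move=> mf fg; apply: (le_integrable measurableT); first exact/measurable_EFinP.
by move=> t _ /=; rewrite lee_fin (le_trans (fg _))// ler_norm.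
Qed.

Lemma integrable_Rn_norm n (f : 'rV[R]_n -> R) :
  integrable_Rn f -> integrable_Rn (fun x => `|f x|).
Proof.
move=> hf; have /integrableP[/measurable_EFinP mf _] := hf.
apply: (le_integrable measurableT _ _ hf) => [|t _ /=]; last by rewrite normr_id.
by apply/measurable_EFinP; apply: measurableT_comp.
Qed.

Lemma integral_divergence_support n (X dX : 'I_n -> 'rV[R]_n -> R) (M : R) :
  (forall i x, is_derive x (basis_vec R i) (X i) (dX i x)) ->
  (forall i, continuous (dX i)) ->
  (forall i x, M < `|x| -> X i x = 0) ->
  (\int[lebesgue_Rn R n]_t (\sum_i dX i (rowt t))%:E = 0)%E.
Proof.
move=> hX cdX XM; rewrite integral_Rn_sum => [|i]; last first.
  apply: (integrable_Rn_continuous_support (M := M)) => //.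
  by apply: is_derive_support (hX i) (XM i).
by apply: big1 => i _; apply: (integral_Rn_partial (hX i) (cdX i) (XM i)).
Qed.

Lemma cvg_scale_harmonic (A : R) : A * k.+1%:R^-1 @[k --> \oo] --> (0 : R).
Proof.
have H : A * harmonic k @[k --> \oo] --> A * (0 : R).
  by apply: cvgM; [exact: cvg_cst|exact: cvg_harmonic].
by rewrite mulr0 in H.
Qed.

Lemma cvg_bump (p : {poly R}) n (x : 'rV[R]_n) :
  bump 0 k.+1%:R p x @[k --> \oo] --> flat p 1.
Proof.
have H : 1 - sqnorm (x - 0) * k.+1%:R^-1 * k.+1%:R^-1 @[k --> \oo] --> (1 : R).
  rewrite -[X in _ --> X]subr0; apply: cvgB; first exact: cvg_cst.
  rewrite -[X in _ --> X](mul0r 0); apply: cvgM; first exact: cvg_scale_harmonic.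
  exact: cvg_harmonic.
rewrite (_ : (fun k => _) = flat p \o
    (fun k => 1 - sqnorm (x - 0) * k.+1%:R^-1 * k.+1%:R^-1)).
  by apply: continuous_cvg H; exact: continuous_flat.
by apply/funext => k; rewrite /bump/= -mulrA -invfM -expr2 mulrC.
Qed.

(** The compactly supported field [phi k * X] has divergence of zero integral. As [k] grows, the
    gradient term tends to 0 and the other one to [c] times the divergence of [X], dominated by [g].
    Only the sum of the [dX i] has to be integrable, not each of them. *)
Lemma integral_divergence n (X dX : 'I_n -> 'rV[R]_n -> R) :
  (forall i x, is_derive x (basis_vec R i) (X i) (dX i x)) ->
  (forall i, continuous (X i)) -> (forall i, continuous (dX i)) ->
  (forall i, integrable_Rn (X i)) ->
  integrable_Rn (fun x => \sum_i dX i x) ->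
  (\int[lebesgue_Rn R n]_t (\sum_i dX i (rowt t))%:E = 0)%E.
Proof.
move=> hX cX cdX iX idX.
pose phi (k : nat) : 'rV[R]_n -> R := bump 0 k.+1%:R 1.
pose dphi (k : nat) (i : 'I_n) (x : 'rV[R]_n) : R :=
  bump 0 k.+1%:R (flat_deriv 1) x * (- (k.+1%:R ^- 2 * (2 * (x - 0) 0 i))).
(* The cutoffs are not normalised: they converge to exp(-1), a nonzero factor that is divided out at
   the end. *)
pose c : R := flat 1 1.
have c0 : c != 0.
  by rewrite /c /flat ltr01 hornerC mul1r gt_eqF// expR_gt0.
have [C1 HC1] := @flat_bounded R 1.
have [C2 HC2] := @is_derive_cutoff_bounded R n (flat_deriv 1).
(* Stated relative to an index, because for [n = 0] the bound [HC2] says nothing about the sign of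
   [C2]. *)
have C20 (i : 'I_n) : 0 <= C2.
  by have := HC2 0%N 0 i; rewrite invr1 mulr1; exact: le_trans.
pose f (k : nat) x := \sum_i (dphi k i x * X i x + phi k x * dX i x).
have f0 k : (\int[lebesgue_Rn R n]_t (f k (rowt t))%:E = 0)%E.
  apply: (@integral_divergence_support n (fun i x => phi k x * X i x)
    (fun i x => dphi k i x * X i x + phi k x * dX i x)
    (`|0 : 'rV[R]_n| + k.+1%:R)).
  - by move=> i x; exact: (is_derive_mul (is_derive_bump _ _ _ _ _) (hX i x)).
  - move=> i; apply: continuous_add; apply: continuous_mul => //.
    + apply: continuous_mul; first exact: continuous_bump.
      under eq_fun do rewrite subr0 mulrA -mulNr.
      apply: continuous_mul; first exact: continuous_const.
      exact: coord_continuous.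
    + exact: continuous_bump.
  - by move=> i x xM; rewrite /phi bump_norm_support ?mul0r.
pose g x := C2 * (\sum_i `|X i x|) + C1 * `|\sum_i dX i x|.
have fE k x : f k x = \sum_i dphi k i x * X i x + phi k x * \sum_i dX i x.
  by rewrite /f big_split/= mulr_sumr.
have fg k x : `|f k x| <= g x.
  rewrite fE /g (le_trans (ler_normD _ _))// lerD//.
    rewrite mulr_sumr (le_trans (ler_norm_sum _ _ _))//; apply: ler_sum => i _.
    rewrite normrM ler_wpM2r// (le_trans (HC2 k x i))// ler_piMr ?(C20 i)//.
    by rewrite invf_le1// ler1n.
  by rewrite normrM ler_wpM2r//; exact: HC1.
have cf x : f k x @[k --> \oo] --> c * \sum_i dX i x.
  under eq_fun do rewrite fE.
  rewrite -[c * _]add0r; apply: cvgD.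
    apply: norm_cvg0; have h0 := cvg_scale_harmonic (C2 * (\sum_i `|X i x|)).
    have Hk : \forall k \near \oo, (cst 0 k : R) <= `|\sum_i dphi k i x * X i x| <=
        C2 * (\sum_i `|X i x|) * k.+1%:R^-1.
      apply: nearW => k /=; rewrite normr_ge0/= (le_trans (ler_norm_sum _ _ _))//.
      rewrite mulrAC mulr_sumr; apply: ler_sum => i _.
      by rewrite normrM ler_wpM2r// HC2.
    exact: (squeeze_cvgr Hk (cvg_cst 0) h0).
  by apply: cvgM; [exact: cvg_bump|exact: cvg_cst].
have mf k : measurable_fun setT (fun t : n.-tuple (measurableTypeR R) => (f k (rowt t))%:E).
  apply/measurable_EFinP; apply: measurable_continuous.
  apply: continuous_sum => i _; apply: continuous_add; apply: continuous_mul => //.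
  + apply: continuous_mul; first exact: continuous_bump.
    under eq_fun do rewrite subr0 mulrA -mulNr.
    apply: continuous_mul; first exact: continuous_const.
    exact: coord_continuous.
  + exact: continuous_bump.
have iF : integrable_Rn (fun x => c * \sum_i dX i x) by exact: integrable_RnZ.
have /integrableP[mF _] := iF.
have ig : integrable_Rn g.
  apply: integrable_RnD; apply: integrable_RnZ.
    by apply: integrable_Rn_sum => i _; exact: integrable_Rn_norm.
  exact: integrable_Rn_norm.
have cf' t : (f k (rowt t))%:E @[k --> \oo] --> (c * \sum_i dX i (rowt t))%:E.
  by apply: cvg_EFin; [exact: nearW|exact: cf].
have [_ _ L] := @dominated_convergence _ _ _ (lebesgue_Rn R n) setT measurableT
  (fun k t => (f k (rowt t))%:E) (fun t => (c * \sum_i dX i (rowt t))%:E)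
  (fun t => (g (rowt t))%:E) mf mF
  (aeW _ (fun t _ => cf' t)) ig
  (aeW _ (fun t k _ => fg k (rowt t))).
have {}L : (\int[lebesgue_Rn R n]_t (c * \sum_i dX i (rowt t))%:E = 0)%E.
  apply: (cvg_unique _ L) => //.
  rewrite [X in X @ _](_ : _ = cst 0%E); first exact: cvg_cst.
  by apply/funext => k; exact: f0.
move: L; under eq_integral do rewrite EFinM.
rewrite integralZl// => /eqP; rewrite mule_eq0 eqe (negbTE c0)/= => /eqP.
exact.
Qed.

End DivergenceTheorem.

(** * Sections of the bundle of skew endomorphisms *)

Section MatrixIdentities.
Context {R : realType} {r : nat}.
Implicit Types (S T A B : 'M[R]_r).

Lemma addmxE m n (A B : 'M[R]_(m, n)) i j : (A + B) i j = A i j + B i j.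
Proof. by rewrite mxE. Qed.

Lemma oppmxE m n (A : 'M[R]_(m, n)) i j : (- A) i j = - A i j.
Proof. by rewrite mxE. Qed.

Lemma scalemxE m n (k : R) (A : 'M[R]_(m, n)) i j : (k *: A) i j = k * A i j.
Proof. by rewrite mxE. Qed.

(** Derivatives appear as free matrices here and in the identities below. The derivative of the
    transition matrix is eliminated through the transformation law of the connection; once products
    are distributed, the noncommutative identity is closed entrywise, with the entries of the
    products as atoms. *)
Lemma cov_gauge_mx (Sa Sb dSa dSb T dT Aa Ab : 'M[R]_r) :
  Sa *m T = T *m Sb -> dSa *m T + Sa *m dT = dT *m Sb + T *m dSb ->
  Aa *m T + dT = T *m Ab ->
  (dSa + commmx Aa Sa) *m T = T *m (dSb + commmx Ab Sb).
Proof.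
move=> ST dST AT; have {dST}-> : T *m (dSb + commmx Ab Sb) =
    dSa *m T + Sa *m dT - dT *m Sb + T *m commmx Ab Sb.
  by rewrite mulmxDr dST [dT *m Sb + _]addrC addrK.
have {AT}dTE : dT = T *m Ab - Aa *m T by rewrite -AT addrC addKr.
rewrite dTE /commmx !(mulmxDl, mulmxDr, mulNmx, mulmxN) !mulmxA.
rewrite -(mulmxA Aa Sa T) ST (mulmxA Aa T Sb).
by apply/matrixP => i j; rewrite !(addmxE, oppmxE); ring.
Qed.

(** The third hypothesis is the symmetry of the second derivatives of [T], each obtained by
    differentiating [dT = T *m B - A *m T] once more. *)
Lemma curv_gauge_mx (T Ai Aj Bi Bj dTi dTj dAij dAji dBij dBji : 'M[R]_r) :
  Ai *m T + dTi = T *m Bi -> Aj *m T + dTj = T *m Bj ->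
  dTi *m Bj + T *m dBij - (dAij *m T + Aj *m dTi) =
  dTj *m Bi + T *m dBji - (dAji *m T + Ai *m dTj) ->
  (dAij - dAji + commmx Ai Aj) *m T = T *m (dBij - dBji + commmx Bi Bj).
Proof.
move=> Hi Hj; have -> : dTi = T *m Bi - Ai *m T by rewrite -Hi addrC addKr.
have -> : dTj = T *m Bj - Aj *m T by rewrite -Hj addrC addKr.
rewrite /commmx !(mulmxDl, mulmxDr, mulNmx, mulmxN) !mulmxA.
move=> /matrixP H; apply/matrixP => i j; have := H i j.
rewrite !(addmxE, oppmxE); lra.
Qed.

(** Here [dmp] stands for the m-th partial derivative of the p-th connection matrix, [emlp] for its
    second derivative in directions m and l, and [f3], [f1], [f2] for the derivatives of the three
    curvature components. The last three hypotheses are the symmetry of second derivatives. *)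
Lemma bianchi_mx (A1 A2 A3 d12 d13 d21 d23 d31 d32 e312 e321 e123 e132 e231
    e213 f1 f2 f3 : 'M[R]_r) :
  f3 = e312 - e321 + (d31 *m A2 + A1 *m d32 - (d32 *m A1 + A2 *m d31)) ->
  f1 = e123 - e132 + (d12 *m A3 + A2 *m d13 - (d13 *m A2 + A3 *m d12)) ->
  f2 = e231 - e213 + (d23 *m A1 + A3 *m d21 - (d21 *m A3 + A1 *m d23)) ->
  e312 = e132 -> e321 = e231 -> e123 = e213 ->
  (f3 + commmx A3 (d12 - d21 + commmx A1 A2)) +
  (f1 + commmx A1 (d23 - d32 + commmx A2 A3)) +
  (f2 + commmx A2 (d31 - d13 + commmx A3 A1)) = 0.
Proof.
move=> -> -> -> -> -> ->.
rewrite /commmx !(mulmxDl, mulmxDr, mulNmx, mulmxN) !mulmxA.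
by apply/matrixP => i j; rewrite !(addmxE, oppmxE) [RHS]mxE; ring.
Qed.

Lemma curv_variation_mx (d1 d2 Ai Aj Bi Bj : 'M[R]_r) :
  d1 - d2 + (Bi *m Aj + Ai *m Bj - (Bj *m Ai + Aj *m Bi)) =
  d1 + commmx Ai Bj - (d2 + commmx Aj Bi).
Proof.
by rewrite /commmx; apply/matrixP => i j; rewrite !(addmxE, oppmxE); ring.
Qed.

Lemma curv_perturb_mx (s : R) (d1 d2 e1 e2 Ai Aj Bi Bj : 'M[R]_r) :
  d1 + s *: e1 - (d2 + s *: e2) + commmx (Ai + s *: Bi) (Aj + s *: Bj) =
  d1 - d2 + commmx Ai Aj +
  s *: (e1 + commmx Ai Bj - (e2 + commmx Aj Bi) + s *: commmx Bi Bj).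
Proof.
rewrite /commmx !(mulmxDl, mulmxDr) -!(scalemxAl, scalemxAr).
apply/matrixP => i j; rewrite !(addmxE, oppmxE).
do !rewrite !(scalemxE, addmxE, oppmxE); ring.
Qed.

Lemma commmx_skew S T : S^T = - S -> T^T = - T ->
  (commmx S T)^T = - commmx S T.
Proof.
move=> hS hT; rewrite /commmx linearB/= !trmx_mul hS hT.
by rewrite !mulmxN !mulNmx !opprK opprB.
Qed.

(** Invariance of the trace form under the adjoint action; it cancels the connection terms in the
    derivative of an inner product. *)
Lemma mxtrace_commmx A S T :
  \tr (commmx A S *m T) + \tr (S *m commmx A T) = 0.
Proof.
rewrite /commmx !(mulmxDl, mulmxDr, mulNmx, mulmxN) !mulmxA !linearD !linearN/=.
rewrite [\tr (S *m T *m A)]mxtrace_mulC !mulmxA; ring.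
Qed.

Lemma endo_sqnormE T : T^T = - T -> endo_sqnorm T = \sum_i \sum_j T i j ^+ 2.
Proof.
move=> hT; rewrite /endo_sqnorm -linearN/= -mulmxN -hT /mxtrace.
by apply: eq_bigr => i _; rewrite mxE; apply: eq_bigr => j _; rewrite mxE.
Qed.

Lemma endo_sqnorm_ge0 T : T^T = - T -> 0 <= endo_sqnorm T.
Proof.
by move=> hT; rewrite endo_sqnormE//; do 2![apply: sumr_ge0 => ? _]; exact: sqr_ge0.
Qed.

Lemma endo_sqnorm_eq0 T : T^T = - T -> endo_sqnorm T = 0 -> T = 0.
Proof.
move=> hT; rewrite endo_sqnormE// => /eqP; rewrite psumr_eq0 => [/allP H|i _].
  apply/matrixP => i j; have := H i (mem_index_enum _).
  rewrite psumr_eq0 => [/allP/(_ j (mem_index_enum _))|? _]; last exact: sqr_ge0.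
  by rewrite sqrf_eq0 => /eqP ->; rewrite mxE.
by apply: sumr_ge0 => ? _; exact: sqr_ge0.
Qed.

Lemma endo_sqnormD S T :
  endo_sqnorm (S + T) = endo_sqnorm S + endo_sqnorm T - 2 * \tr (S *m T).
Proof.
rewrite /endo_sqnorm mulmxDl !mulmxDr !mxtraceD (mxtrace_mulC T S); ring.
Qed.

Lemma endo_sqnormN T : endo_sqnorm (- T) = endo_sqnorm T.
Proof. by rewrite /endo_sqnorm mulNmx mulmxN opprK. Qed.

(** Expand the nonnegative squared norms of [S + T] and [S - T]. The missing factor 1/2 does no
    harm, since only integrability is deduced from this bound. *)
Lemma mxtrace_le S T : S^T = - S -> T^T = - T ->
  `|- \tr (S *m T)| <= endo_sqnorm S + endo_sqnorm T.
Proof.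
move=> hS hT.
have hN : (- T)^T = - - T by rewrite linearN/= hT.
have hp : (S + T)^T = - (S + T) by rewrite linearD/= hS hT opprD.
have hm : (S + - T)^T = - (S + - T) by rewrite linearD/= hS hN opprD.
have := endo_sqnorm_ge0 hp; have := endo_sqnorm_ge0 hm.
have := endo_sqnorm_ge0 hS; have := endo_sqnorm_ge0 hT.
rewrite !endo_sqnormD endo_sqnormN mulmxN raddfN/= ler_norml.
move: (endo_sqnorm S) (endo_sqnorm T) (\tr _) => a b c; lra.
Qed.

End MatrixIdentities.

(** The way an identity that holds on an open set is differentiated: both sides come with explicit
    derivatives, which must then agree. *)
Lemma is_derive_unique (R : realType) (V W : normedModType R) (f g : V -> W)
    x v df dg (D : set V) : open D -> D x -> (forall y, D y -> f y = g y) ->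
  is_derive x v f df -> is_derive x v g dg -> df = dg.
Proof.
move=> oD Dx fg hf [_ <-].
by have [_ <-] := is_derive_near oD Dx fg hf.
Qed.

(** * Gauge covariance of covariant derivatives and curvature *)

Section SkewSections.
Context {R : realType} {n r : nat} {E : metric_bundle R n r}.
Implicit Types (nabla : connection E) (S : chart E -> 'rV[R]_n -> 'M[R]_r).

(** The conjugation law is written without an inverse, so that differentiating it needs only the
    product rule. *)
Definition skew_section S : Prop :=
  [/\ forall a, smooth_on (dom a) (S a),
      forall a b x, dom a x -> dom b x ->
        S a x *m trans a b x = trans a b x *m S b x &
      forall a x, dom a x -> (S a x)^T = - S a x].

Lemma smooth_on_commmx (D : set 'rV[R]_n) (M N : 'rV[R]_n -> 'M[R]_r) : open D ->
  smooth_on D M -> smooth_on D N -> smooth_on D (fun x => commmx (M x) (N x)).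
Proof.
move=> oD hM hN; apply: smooth_onD => //; first exact: smooth_on_mulmx.
by apply: smooth_onN => //; exact: smooth_on_mulmx.
Qed.

Lemma skew_sectionD S S' : skew_section S -> skew_section S' ->
  skew_section (fun a x => S a x + S' a x).
Proof.
move=> [s1 g1 k1] [s2 g2 k2]; split=> [a|a b x ax bx|a x ax].
- by apply: smooth_onD => //; exact: dom_open.
- by rewrite mulmxDl mulmxDr g1// g2.
- by rewrite linearD/= k1// k2// opprD.
Qed.

Lemma skew_section_scale (f : 'rV[R]_n -> R) S : smooth_on setT f ->
  skew_section S -> skew_section (fun a x => f x *: S a x).
Proof.
move=> sf [s1 g1 k1]; split=> [a|a b x ax bx|a x ax].
- apply: smooth_on_scalemx => //; first exact: dom_open.
  exact: (smooth_onS _ sf).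
- by rewrite -scalemxAl -scalemxAr g1.
- by rewrite linearZ/= k1// scalerN.
Qed.

Lemma skew_section0 : skew_section (fun _ _ => 0).
Proof.
split=> [a|a b x _ _|a x _]; first exact: smooth_on_cst.
  by rewrite mul0mx mulmx0.
by rewrite linear0 oppr0.
Qed.

Lemma skew_sectionN S : skew_section S -> skew_section (fun a x => - S a x).
Proof.
move=> [s1 g1 k1]; split=> [a|a b x ax bx|a x ax].
- by apply: smooth_onN => //; exact: dom_open.
- by rewrite mulNmx mulmxN g1.
- by rewrite linearN/= k1.
Qed.

Lemma skew_section_sum (I : Type) (s : seq I) (P : pred I)
    (S : I -> chart E -> 'rV[R]_n -> 'M[R]_r) :
  (forall i, P i -> skew_section (S i)) ->
  skew_section (fun a x => \sum_(i <- s | P i) S i a x).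
Proof.
move=> H; elim: s => [|i s IH].
  have -> : (fun a x => \sum_(i <- [::] | P i) S i a x) = fun _ _ => 0.
    by apply/funext => a; apply/funext => x; rewrite big_nil.
  exact: skew_section0.
have [Pi|Pi] := boolP (P i); last first.
  rewrite (_ : (fun a x => _) = fun a x => \sum_(i <- s | P i) S i a x)//.
  by apply/funext => a; apply/funext => x; rewrite big_cons (negbTE Pi).
rewrite (_ : (fun a x => _) = fun a x => S i a x + \sum_(i <- s | P i) S i a x).
  by apply: skew_sectionD => //; exact: H.
by apply/funext => a; apply/funext => x; rewrite big_cons Pi.
Qed.

Lemma skew_section_comm S S' : skew_section S -> skew_section S' ->
  skew_section (fun a x => commmx (S a x) (S' a x)).
Proof.
move=> [s1 g1 k1] [s2 g2 k2]; split=> [a|a b x ax bx|a x ax].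
- by apply: smooth_on_commmx => //; exact: dom_open.
- rewrite /commmx mulmxBl mulmxBr -!mulmxA (g1 a b)// (g2 a b)// !mulmxA.
  by rewrite (g1 a b)// (g2 a b).
- by apply: commmx_skew; [exact: k1|exact: k2].
Qed.

Lemma open_domI (a b : chart E) : open (dom a `&` dom b).
Proof. by apply: openI; exact: dom_open. Qed.

Lemma smooth_skew_derive (D : set 'rV[R]_n) (M : 'rV[R]_n -> 'M[R]_r) v x :
  open D -> D x -> smooth_on D M -> (forall y, D y -> (M y)^T = - M y) ->
  ('D_v M x)^T = - 'D_v M x.
Proof.
move=> oD Dx sM kM; have H := smooth_on_is_derive v sM Dx.
exact: (is_derive_unique oD Dx kM (is_derive_trmx H) (is_derive_oppr H)).
Qed.

Lemma smooth_on_cov nabla i S a : smooth_on (dom a) (S a) ->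
  smooth_on (dom a) (cov (conn_form nabla a) i (S a)).
Proof.
move=> sS; apply: smooth_onD; [exact: dom_open|exact: smooth_on_derive|].
by apply: smooth_on_commmx => //; [exact: dom_open|exact: conn_smooth].
Qed.

Lemma skew_section_cov nabla i S : skew_section S ->
  skew_section (fun a => cov (conn_form nabla a) i (S a)).
Proof.
move=> [s1 g1 k1]; split=> [a|a b x ax bx|a x ax].
- exact: smooth_on_cov.
- have D := (@open_domI a b); have sT := @trans_smooth _ _ _ E a b.
  have abx : (dom a `&` dom b) x by [].
  have dT := smooth_on_is_derive (basis_vec R i) sT abx.
  have dSa := smooth_on_is_derive (basis_vec R i) (s1 a) ax.
  have dSb := smooth_on_is_derive (basis_vec R i) (s1 b) bx.
  have g' y : (dom a `&` dom b) y -> S a y *m trans a b y = trans a b y *m S b y.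
    by move=> [ay yb]; exact: g1.
  have H := is_derive_unique D abx g' (is_derive_mulmx dSa dT) (is_derive_mulmx dT dSb).
  exact: (cov_gauge_mx (g1 a b x ax bx) H (conn_trans nabla i ax bx)).
- rewrite /cov linearD/= (smooth_skew_derive _ (@dom_open _ _ _ E a) ax (s1 a) (k1 a)).
  rewrite (@commmx_skew _ _ (conn_form nabla a i x) (S a x)) ?opprD//.
  + exact: conn_skew.
  + exact: k1.
Qed.

Lemma skew_section_curv nabla i j :
  skew_section (fun a => curv (conn_form nabla a) i j).
Proof.
split=> [a|a b x ax bx|a x ax].
- apply: smooth_onD; first exact: dom_open.
    apply: smooth_onD; [exact: dom_open|exact/smooth_on_derive/conn_smooth|].
    by apply: smooth_onN; [exact: dom_open|exact/smooth_on_derive/conn_smooth].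
  by apply: smooth_on_commmx; [exact: dom_open|exact: conn_smooth|exact: conn_smooth].
- have D := (@open_domI a b); have sT := @trans_smooth _ _ _ E a b.
  have abx : (dom a `&` dom b) x by [].
  have dT k := smooth_on_is_derive (basis_vec R k) sT abx.
  have dA k l := smooth_on_is_derive (basis_vec R k) (conn_smooth nabla a l) ax.
  have dB k l := smooth_on_is_derive (basis_vec R k) (conn_smooth nabla b l) bx.
  have dTE k y : (dom a `&` dom b) y -> trans a b y *m conn_form nabla b k y -
      conn_form nabla a k y *m trans a b y = 'D_(basis_vec R k) (trans a b) y.
    by move=> [ay yb]; rewrite -(conn_trans nabla k ay yb) addrC addKr.
  (* The transformation law expresses a first derivative of the transition matrix by the connection
     matrices; differentiating it gives the second derivatives, whose symmetry is the hypothesis of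
     [curv_gauge_mx]. *)
  have ddT k l : 'D_(basis_vec R k) ('D_(basis_vec R l) (trans a b)) x =
     'D_(basis_vec R k) (trans a b) x *m conn_form nabla b l x +
     trans a b x *m 'D_(basis_vec R k) (conn_form nabla b l) x -
     ('D_(basis_vec R k) (conn_form nabla a l) x *m trans a b x +
      conn_form nabla a l x *m 'D_(basis_vec R k) (trans a b) x).
    apply/esym; apply: (is_derive_unique D abx (dTE l) _
      (smooth_on_is_derive (basis_vec R k) (smooth_on_derive (basis_vec R l) sT) abx)).
    exact: (is_derive_sub (is_derive_mulmx (dT k) (dB k l))
                          (is_derive_mulmx (dA k l) (dT k))).
  apply: (curv_gauge_mx (conn_trans nabla i ax bx) (conn_trans nabla j ax bx)).
  exact: etrans (esym (ddT i j)) (etrans (clairaut_mx _ _ D abx sT) (ddT j i)).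
- have k l m := smooth_skew_derive (basis_vec R m) (@dom_open _ _ _ E a) ax
    (conn_smooth nabla a l) (@conn_skew _ _ _ _ nabla a l).
  rewrite /curv linearD/= linearB/= !k (@commmx_skew _ _ (conn_form nabla a i x)).
  + by rewrite !opprD.
  + exact: conn_skew.
  + exact: conn_skew.
Qed.

Lemma bianchi nabla i j k a x : dom a x ->
  cov (conn_form nabla a) k (curv (conn_form nabla a) i j) x +
  cov (conn_form nabla a) i (curv (conn_form nabla a) j k) x +
  cov (conn_form nabla a) j (curv (conn_form nabla a) k i) x = 0.
Proof.
move=> ax.
have sA l := conn_smooth nabla a l.
have dA m l := smooth_on_is_derive (basis_vec R m) (sA l) ax.
have ddA m l p := smooth_on_is_derive (basis_vec R m)
   (smooth_on_derive (basis_vec R l) (sA p)) ax.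
have C m l p := clairaut_mx (basis_vec R m) (basis_vec R l) (@dom_open _ _ _ E a) ax (sA p).
have H m l p : 'D_(basis_vec R m) (curv (conn_form nabla a) l p) x =
    'D_(basis_vec R m) ('D_(basis_vec R l) (conn_form nabla a p)) x -
    'D_(basis_vec R m) ('D_(basis_vec R p) (conn_form nabla a l)) x +
    ('D_(basis_vec R m) (conn_form nabla a l) x *m conn_form nabla a p x +
     conn_form nabla a l x *m 'D_(basis_vec R m) (conn_form nabla a p) x -
     ('D_(basis_vec R m) (conn_form nabla a p) x *m conn_form nabla a l x +
      conn_form nabla a p x *m 'D_(basis_vec R m) (conn_form nabla a l) x)).
  have [_ <-] // := is_derive_add (is_derive_sub (ddA m l p) (ddA m p l))
    (is_derive_sub (is_derive_mulmx (dA m l) (dA m p)) (is_derive_mulmx (dA m p) (dA m l))).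
exact: (bianchi_mx (H k i j) (H i j k) (H j k i) (C k i j) (C k j i) (C i j k)).
Qed.

End SkewSections.

(** * The trace inner product of sections *)

Section InnerProduct.
Context {R : realType} {n r : nat} {E : metric_bundle R n r}.
Implicit Types (nabla : connection E) (S T : chart E -> 'rV[R]_n -> 'M[R]_r).

(* [<S, T>] at [x]; independent of the frame by [ip_frame]. *)
Definition ip S T (x : 'rV[R]_n) : R :=
  - \tr (S (frame_at E x) x *m T (frame_at E x) x).

Lemma frame_atP x : dom (frame_at E x) x.
Proof. by rewrite /frame_at; case: cid. Qed.

Lemma mxtrace_frame S T a b x : skew_section S -> skew_section T ->
  dom a x -> dom b x -> \tr (S b x *m T b x) = \tr (S a x *m T a x).
Proof.
move=> [_ gS _] [_ gT _] ax bx; have o := trans_orthogonal bx ax.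
rewrite -[LHS]/(\tr (S b x *m T b x)) -[X in \tr X]mulmx1 -(mulmx1C o) mulmxA.
rewrite -(mulmxA (S b x)) (gT b a)// mulmxA (gS b a)// mxtrace_mulC !mulmxA.
by rewrite o mul1mx.
Qed.

Lemma ip_frame S T a x : skew_section S -> skew_section T -> dom a x ->
  ip S T x = - \tr (S a x *m T a x).
Proof.
by move=> hS hT ax; rewrite /ip (mxtrace_frame hS hT ax (frame_atP x)).
Qed.

Lemma ipC S T x : ip S T x = ip T S x.
Proof. by rewrite /ip mxtrace_mulC. Qed.

Lemma ipNl S T x : ip (fun a y => - S a y) T x = - ip S T x.
Proof. by rewrite /ip mulNmx raddfN. Qed.

Lemma ipZl (f : 'rV[R]_n -> R) S T x : ip (fun a y => f y *: S a y) T x = f x * ip S T x.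
Proof. by rewrite /ip -scalemxAl mxtraceZ mulrN. Qed.

Lemma ip_ge0 S x : skew_section S -> 0 <= ip S S x.
Proof. by move=> [_ _ k]; apply/endo_sqnorm_ge0/k/frame_atP. Qed.

Lemma ip_le S T x : skew_section S -> skew_section T ->
  `|ip S T x| <= ip S S x + ip T T x.
Proof.
by move=> [_ _ k1] [_ _ k2]; apply: mxtrace_le; [apply: k1|apply: k2]; exact: frame_atP.
Qed.

Lemma ip_eq0 S a x : skew_section S -> dom a x -> ip S S x = 0 -> S a x = 0.
Proof.
move=> hS ax; rewrite (ip_frame hS hS ax); apply: endo_sqnorm_eq0.
by case: hS => _ _; apply.
Qed.

(** [ip] chooses a frame separately at each point, in no continuous way. Near [x] it agrees with the
    trace computed in the single frame chosen at [x], which is smooth there. *)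
Lemma continuous_ip S T : skew_section S -> skew_section T -> continuous (ip S T).
Proof.
move=> hS hT x; have ax := frame_atP x; set a := frame_at E x in ax.
have [sS _ _] := hS; have [sT _ _] := hT.
have sm : smooth_on (dom a) (fun y => \tr (S a y *m T a y) : R^o).
  apply: smooth_on_sum => [|i _]; first exact: dom_open.
  apply: (smooth_on_mxP _ _).1; first exact: dom_open.
  by apply: smooth_on_mulmx => //; exact: dom_open.
have eq y : dom a y -> - \tr (S a y *m T a y) = ip S T y.
  by move=> ay; rewrite (ip_frame hS hT ay).
by apply: (continuous_near (@dom_open _ _ _ E a) ax eq);
  exact: cvgN (smooth_on_continuous sm ax).
Qed.

Definition cov_section nabla i S : chart E -> 'rV[R]_n -> 'M[R]_r :=
  fun a => cov (conn_form nabla a) i (S a).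

Definition curv_section nabla i j : chart E -> 'rV[R]_n -> 'M[R]_r :=
  fun a => curv (conn_form nabla a) i j.

Definition soliton_section nabla x0 t0 j : chart E -> 'rV[R]_n -> 'M[R]_r :=
  fun a => soliton_form (conn_form nabla a) x0 t0 j.

(** Metric compatibility: in a fixed frame the product rule gives plain derivatives, and the
    commutators that turn them into covariant ones have total trace zero. *)
Lemma is_derive_ip nabla S T i x : skew_section S -> skew_section T ->
  is_derive x (basis_vec R i) (ip S T)
    (ip (cov_section nabla i S) T x + ip S (cov_section nabla i T) x).
Proof.
move=> hS hT; have ax := frame_atP x; set a := frame_at E x in ax.
have [sS _ _] := hS; have [sT _ _] := hT.
have dS := smooth_on_is_derive (basis_vec R i) (sS a) ax.
have dT := smooth_on_is_derive (basis_vec R i) (sT a) ax.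
have H := is_derive_oppr (is_derive_mxtrace (is_derive_mulmx dS dT)).
have eq y : dom a y -> - \tr (S a y *m T a y) = ip S T y.
  by move=> ay; rewrite (ip_frame hS hT ay).
have {}H := is_derive_near (@dom_open _ _ _ E a) ax eq H.
apply: (is_derive_eq H).
rewrite /ip -/a -opprD -!mxtraceD /cov_section /cov mulmxDl mulmxDr.
rewrite addrACA [in RHS]mxtraceD.
by rewrite [X in _ = - (_ + X)]mxtraceD mxtrace_commmx addr0.
Qed.

Lemma curv_sectionC nabla i j :
  curv_section nabla j i = fun a x => - curv_section nabla i j a x.
Proof.
apply/funext => a; apply/funext => x; rewrite /curv_section /curv.
by rewrite opprD opprB /commmx opprB.
Qed.

Lemma cov_sectionN nabla i S a x : skew_section S -> dom a x ->
  cov_section nabla i (fun a y => - S a y) a x = - cov_section nabla i S a x.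
Proof.
move=> [sS _ _] ax; rewrite /cov_section /cov opprD.
have [_ ->] := is_derive_oppr (smooth_on_is_derive (basis_vec R i) (sS a) ax).
by congr (_ + _); rewrite /commmx mulmxN mulNmx opprK opprB addrC.
Qed.

Lemma ip_cov_curvC nabla k i j T x :
  ip T (cov_section nabla k (curv_section nabla j i)) x =
  - ip T (cov_section nabla k (curv_section nabla i j)) x.
Proof.
rewrite curv_sectionC /ip cov_sectionN; last exact: frame_atP.
  by rewrite mulmxN raddfN.
exact: skew_section_curv.
Qed.

Lemma ip_bianchi nabla i j k T x :
  ip T (cov_section nabla k (curv_section nabla i j)) x +
  ip T (cov_section nabla i (curv_section nabla j k)) x +
  ip T (cov_section nabla j (curv_section nabla k i)) x = 0.
Proof.
rewrite /ip -!opprD -!mxtraceD -!mulmxDr.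
by rewrite (bianchi nabla i j k (frame_atP x)) mulmx0 mxtrace0 oppr0.
Qed.

(** Doubling the left side and exchanging [i] and [k] in one copy puts <F_ik, D_i F_jk - D_k F_ji>
    under the sum, using that F is skew in its indices; the Bianchi identity turns the bracket into
    D_j F_ik. *)
Lemma bianchi_contract nabla j x :
  2 * (\sum_i \sum_k ip (curv_section nabla i k)
      (cov_section nabla i (curv_section nabla j k)) x) =
  \sum_i \sum_k ip (curv_section nabla i k)
      (cov_section nabla j (curv_section nabla i k)) x.
Proof.
rewrite mulr_natl mulr2n; set s := \sum_i \sum_k _.
have -> : s + s = s + \sum_i \sum_k ip (curv_section nabla k i)
    (cov_section nabla k (curv_section nabla j i)) x by rewrite exchange_big.
rewrite /s -big_split/=; apply: eq_bigr => i _.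
rewrite -big_split/=; apply: eq_bigr => k _.
have := ip_bianchi nabla j k i (curv_section nabla i k) x.
rewrite (ip_cov_curvC nabla j i k) (curv_sectionC nabla i k) ipNl.
rewrite (ip_cov_curvC nabla k i j); lra.
Qed.

End InnerProduct.

(** * Weighted conservation laws *)

Section Fields.
Context {R : realType} {n r : nat} {E : metric_bundle R n r}.
Variables (nabla : connection E) (x0 : 'rV[R]_n) (t0 : R).
Hypothesis t0_neq0 : t0 != 0.

Local Notation F := (curv_section nabla).
Local Notation "'cov_' i" := (cov_section nabla i) (at level 10).
Local Notation g := (gaussian x0 t0).
Local Notation e := (energy_density nabla).

Lemma gaussian_gt0 x : 0 < g x.
Proof. exact: expR_gt0. Qed.

(** The logarithmic gradient of the weight is minus the vector contracted with F in the soliton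
    equation; this is how that term arises from integration by parts. *)
Lemma is_derive_gaussian x i :
  is_derive x (basis_vec R i) g (- ((2 * t0)^-1 * (x - x0) 0 i) * g x).
Proof.
have H := is_derive_oppr (is_derive_scale (4 * t0)^-1 (is_derive_sqnorm_basis x0 x i)).
have C := is_derive_chain H (is_derive_expR _).
have Eg : expR \o (fun y : 'rV[R]_n => - ((4 * t0)^-1 *: (sqnorm (y - x0) : R^o))) = g.
  by apply/funext => y /=; rewrite /gaussian [_ *: _]mulrC.
rewrite Eg in C; apply: (is_derive_eq C).
rewrite mulrC [X in X * _ = _](_ : _ = - ((2 * t0)^-1 * (x - x0) 0 i)); last first.
  move: ((x - x0) 0 i) => z.
  by change (- ((4 * t0)^-1 * (2 * z)) = - ((2 * t0)^-1 * z)); field.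
by rewrite /gaussian [_ *: _]mulrC.
Qed.

Lemma continuous_gaussian : continuous g.
Proof.
have c1 : continuous (fun y : 'rV[R]_n => - (sqnorm (y - x0) / (4 * t0))).
  under eq_fun do rewrite -mulrN.
  by apply: continuous_mul; [exact: continuous_sqnorm|exact: continuous_const].
by move=> x; exact: (continuous_comp (c1 x) (@continuous_expR R _)).
Qed.

Lemma skew_curv i j : skew_section (F i j).
Proof. exact: skew_section_curv. Qed.

Lemma skew_cov_curv k i j : skew_section (cov_ k (F i j)).
Proof. by apply: skew_section_cov; exact: skew_curv. Qed.

(** By conversion [energy_density] is a double sum of [ip], so frame independence is inherited from
    [continuous_ip]. *)
Lemma continuous_energy : continuous e.
Proof.
apply: (@continuous_sum R 'rV[R]_n _ _ _ (fun i x => \sum_j ip (F i j) (F i j) x)).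
move=> i _; apply: (@continuous_sum R 'rV[R]_n _ _ _ (fun j => ip (F i j) (F i j))).
by move=> j _; apply: continuous_ip; exact: skew_curv.
Qed.

Lemma energy_ge0 x : 0 <= e x.
Proof. by do 2![apply: sumr_ge0 => ? _]; exact: (ip_ge0 x (skew_curv _ _)). Qed.

Lemma is_derive_energy x k : is_derive x (basis_vec R k) e
  (2 * \sum_i \sum_j ip (F i j) (cov_ k (F i j)) x).
Proof.
have H := is_derive_bigsum (index_enum 'I_n) (P := xpredT) (fun i _ =>
  is_derive_bigsum (index_enum 'I_n) (P := xpredT) (fun j _ =>
   is_derive_ip nabla k x (skew_curv i j) (skew_curv i j))).
apply: (is_derive_eq H); rewrite mulr_sumr; apply: eq_bigr => i _.
rewrite mulr_sumr; apply: eq_bigr => j _.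
by rewrite [ip (cov_ k _) _ _]ipC mulr_natl mulr2n.
Qed.

Lemma ip_soliton j T x :
  ip (soliton_section nabla x0 t0 j) T x =
  \sum_i ((2 * t0)^-1 * (x - x0) 0 i * ip (F i j) T x - ip (cov_ i (F i j)) T x).
Proof.
rewrite /ip /soliton_section /soliton_form /coext_cov /contract mulmxDl mxtraceD.
rewrite mulNmx raddfN/= opprD opprK mulmx_suml raddf_sum/=.
rewrite mulmx_suml (raddf_sum (@mxtrace R r)) -sumrN -big_split/=.
apply: eq_bigr => i _; rewrite addrC opprK -scalemxAl mxtraceZ mulrN.
by rewrite !mxE.
Qed.

Lemma skew_soliton j : skew_section (soliton_section nabla x0 t0 j).
Proof.
have -> : soliton_section nabla x0 t0 j = fun a x =>
    - \sum_i cov_ i (F i j) a x + \sum_i ((2 * t0)^-1 * (x - x0) 0 i) *: F i j a x.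
  apply/funext => a; apply/funext => x.
  rewrite /soliton_section /soliton_form /contract; congr (_ + _).
  by apply: eq_bigr => i _; rewrite !mxE.
apply: skew_sectionD.
  by apply: skew_sectionN; apply: skew_section_sum => i _; exact: skew_cov_curv.
apply: skew_section_sum => i _; apply: skew_section_scale; last exact: skew_curv.
apply: smooth_onM; [exact: openT|exact: smooth_on_cst|].
under eq_fun do rewrite !mxE.
by apply: smooth_onD; [exact: openT|exact: smooth_on_coord|exact: smooth_on_cst].
Qed.

Section VariationField.
Variable B : 'I_n -> chart E -> 'rV[R]_n -> 'M[R]_r.
Hypothesis skB : forall j, skew_section (B j).

(** The field whose divergence trades the pairing of F with the derivative of [B] for the pairing of
    the soliton form with [B]. *)
Definition variation_field i x : R := g x * \sum_j ip (F i j) (B j) x.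

Definition variation_field_deriv i x : R :=
  - ((2 * t0)^-1 * (x - x0) 0 i) * g x * (\sum_j ip (F i j) (B j) x) +
  g x * \sum_j (ip (cov_ i (F i j)) (B j) x + ip (F i j) (cov_ i (B j)) x).

Lemma is_derive_variation_field i x :
  is_derive x (basis_vec R i) (variation_field i) (variation_field_deriv i x).
Proof.
exact: (is_derive_mul (is_derive_gaussian x i)
  (is_derive_bigsum (index_enum 'I_n) (P := xpredT) (fun j _ =>
  is_derive_ip nabla i x (skew_curv i j) (skB j)))).
Qed.

Lemma continuous_variation_field i : continuous (variation_field i).
Proof.
apply: continuous_mul; first exact: continuous_gaussian.
by apply: continuous_sum => j _; apply: continuous_ip; [exact: skew_curv|].
Qed.

Lemma continuous_coordB i : continuous (fun x : 'rV[R]_n => (x - x0) 0 i).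
Proof.
under eq_fun do rewrite mxE.
by apply: continuous_add; [exact: coord_continuous|exact: continuous_const].
Qed.

Lemma continuous_variation_field_deriv i : continuous (variation_field_deriv i).
Proof.
apply: continuous_add; apply: continuous_mul.
- apply: continuous_mul; last exact: continuous_gaussian.
  under eq_fun do rewrite -mulNr.
  by apply: continuous_mul; [exact: continuous_const|exact: continuous_coordB].
- by apply: continuous_sum => j _; apply: continuous_ip; [exact: skew_curv|].
- exact: continuous_gaussian.
- apply: continuous_sum => j _; apply: continuous_add; apply: continuous_ip => //.
  + exact: skew_cov_curv.
  + exact: skew_curv.
  + exact: skew_section_cov.
Qed.

Lemma div_variation_field x : \sum_i variation_field_deriv i x =
  g x * (\sum_i \sum_j ip (F i j) (cov_ i (B j)) x
         - \sum_j ip (soliton_section nabla x0 t0 j) (B j) x).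
Proof.
under [X in _ - X]eq_bigr do rewrite ip_soliton.
rewrite [X in _ - X]exchange_big/= -sumrB mulr_sumr; apply: eq_bigr => i _.
rewrite -sumrB /variation_field_deriv !mulr_sumr -big_split/=.
by apply: eq_bigr => j _; ring.
Qed.

End VariationField.

Section StressField.
Variables (y : 'rV[R]_n) (lam : R).

(** An infinitesimal translation plus a dilation about [x0], matching variations of the centre and
    of the scale. *)
Definition conformal_field j (x : 'rV[R]_n) : R := y 0 j + lam * (x - x0) 0 j.
Local Notation v := conformal_field.

Lemma is_derive_conformal i j x :
  is_derive x (basis_vec R i) (v j) (lam * (i == j)%:R).
Proof.
have H := is_derive_sub (is_derive_coord x (basis_vec R i) 0 j)
  (is_derive_const (x0 0 j) x (basis_vec R i)).
have := is_derive_add (is_derive_const (y 0 j) x (basis_vec R i)) (is_derive_scale lam H).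
rewrite add0r subr0 /basis_vec mxE eqxx/= [j == i]eq_sym => H'.
by apply: is_derive_compat H'; apply/funext => z; rewrite /v !mxE.
Qed.

Lemma continuous_conformal j : continuous (v j).
Proof.
apply: continuous_add; first exact: continuous_const.
by apply: continuous_mul; [exact: continuous_const|exact: continuous_coordB].
Qed.

(* The stress-energy tensor [S_ij = sum_k <F_ik, F_jk> - delta_ij |F|^2 / 4]
   contracted with the conformal field and weighted by the Gaussian. *)
Definition stress_field i x : R :=
  g x * (\sum_j \sum_k v j x * ip (F i k) (F j k) x - v i x * (4^-1 * e x)).

(** Exactly the expression returned by the product rules, trivial factor [(i == i)%:R] included, so
    that the derivative lemma is a bare composition of them. *)
Definition stress_field_deriv i x : R :=
  - ((2 * t0)^-1 * (x - x0) 0 i) * g x *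
    (\sum_j \sum_k v j x * ip (F i k) (F j k) x - v i x * (4^-1 * e x)) +
  g x * (\sum_j \sum_k (lam * (i == j)%:R * ip (F i k) (F j k) x +
     v j x * (ip (cov_ i (F i k)) (F j k) x + ip (F i k) (cov_ i (F j k)) x))
    - (lam * (i == i)%:R * (4^-1 * e x) + v i x *
       (4^-1 * (2 * \sum_a \sum_b ip (F a b) (cov_ i (F a b)) x)))).

Lemma is_derive_stress_field i x :
  is_derive x (basis_vec R i) (stress_field i) (stress_field_deriv i x).
Proof.
exact: (is_derive_mul (is_derive_gaussian x i) (is_derive_sub
  (is_derive_bigsum (index_enum 'I_n) (P := xpredT) (fun j _ =>
    is_derive_bigsum (index_enum 'I_n) (P := xpredT) (fun k _ =>
     is_derive_mul (is_derive_conformal i j x)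
       (is_derive_ip nabla i x (skew_curv i k) (skew_curv j k)))))
  (is_derive_mul (is_derive_conformal i i x)
     (is_derive_scale 4^-1 (is_derive_energy x i))))).
Qed.

Lemma continuous_stress_field i : continuous (stress_field i).
Proof.
apply: continuous_mul; first exact: continuous_gaussian.
under eq_fun do rewrite -mulNr.
apply: continuous_add.
  apply: (@continuous_sum R 'rV[R]_n _ _ _ (fun j x => \sum_k v j x * ip (F i k) (F j k) x)).
  move=> j _; apply: continuous_sum => k _.
  apply: continuous_mul; first exact: continuous_conformal.
  by apply: continuous_ip; exact: skew_curv.
apply: continuous_mul.
  by move=> x; exact: cvgN (@continuous_conformal i x).
by apply: continuous_mul; [exact: continuous_const|exact: continuous_energy].
Qed.

Lemma continuous_stress_field_deriv i : continuous (stress_field_deriv i).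
Proof.
have cN (f : 'rV[R]_n -> R) : continuous f -> continuous (fun x => - f x).
  by move=> cf x; exact: cvgN (cf x).
have ci a b a' b' : continuous (ip (F a b) (F a' b')).
  by apply: continuous_ip; exact: skew_curv.
have cc l a b a' b' : continuous (ip (F a b) (cov_ l (F a' b'))).
  by apply: continuous_ip; [exact: skew_curv|exact: skew_cov_curv].
have cc' l a b a' b' : continuous (ip (cov_ l (F a' b')) (F a b)).
  by apply: continuous_ip; [exact: skew_cov_curv|exact: skew_curv].
have ck := @continuous_const R 'rV[R]_n.
have ce := continuous_energy.
have cv := continuous_conformal.
have cg := continuous_gaussian.
have cx := continuous_coordB.
have cA := @continuous_add R 'rV[R]_n; have cM := @continuous_mul R 'rV[R]_n.
apply: (cA); apply: (cM) => //.
- by apply: (cM) => //; apply: (cN); apply: (cM).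
- apply: (cA); last by apply: (cN); apply: (cM) => //; apply: (cM).
  apply: (@continuous_sum R 'rV[R]_n _ _ _ (fun j x => \sum_k v j x * ip (F i k) (F j k) x)).
  by move=> j _; apply: continuous_sum => k _; apply: (cM).
- apply: (cA).
    apply: (@continuous_sum R 'rV[R]_n _ _ _ (fun j x => \sum_k
      (lam * (i == j)%:R * ip (F i k) (F j k) x +
       v j x * (ip (cov_ i (F i k)) (F j k) x + ip (F i k) (cov_ i (F j k)) x)))).
    move=> j _; apply: continuous_sum => k _; apply: (cA); first exact: (cM).
    by apply: (cM) => //; apply: (cA).
  apply: (cN); apply: (cA); first by apply: (cM) => //; apply: (cM).
  apply: (cM) => //; apply: (cM) => //; apply: (cM) => //.
  apply: (@continuous_sum R 'rV[R]_n _ _ _ (fun a x => \sum_b ip (F a b) (cov_ i (F a b)) x)).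
  by move=> a _; apply: continuous_sum => b _.
Qed.

(* Index algebra for the divergence of the stress field, with
   P i j k = <F_ik, F_jk>: the second hypothesis is the soliton equation and
   the third one the Bianchi identity. *)
Lemma stress_sum (c gx lm ex : R) (z w de : 'I_n -> R)
    (P Q W : 'I_n -> 'I_n -> 'I_n -> R) :
  \sum_i \sum_k P i i k = ex ->
  (forall j, \sum_i \sum_k Q i j k = c * \sum_i \sum_k z i * P i j k) ->
  (forall j, \sum_i \sum_k W i j k = 4^-1 * de j) ->
  \sum_i (- (c * z i) * gx * (\sum_j \sum_k w j * P i j k - w i * (4^-1 * ex)) +
    gx * (\sum_j \sum_k (lm * (i == j)%:R * P i j k + w j * (Q i j k + W i j k))
     - (lm * (i == i)%:R * (4^-1 * ex) + w i * (4^-1 * de i)))) =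
  gx * ex * (c / 4 * (\sum_i z i * w i) + lm * (1 - n%:R / 4)).
Proof.
move=> hP hQ hW.
have E1 : \sum_i \sum_j \sum_k lm * (i == j)%:R * P i j k = lm * ex.
  rewrite -hP mulr_sumr; apply: eq_bigr => i _.
  rewrite (bigD1 i)//= eqxx mulr1 [X in _ + X]big1 ?addr0 ?mulr_sumr// => j ji.
  by apply: big1 => k _; rewrite eq_sym (negbTE ji) mulr0 mul0r.
have E2 : \sum_i \sum_j \sum_k w j * Q i j k =
    \sum_i \sum_j \sum_k c * z i * (w j * P i j k).
  rewrite exchange_big [RHS]exchange_big; apply: eq_bigr => j _ /=.
  have -> : \sum_i \sum_k w j * Q i j k = w j * \sum_i \sum_k Q i j k.
    by rewrite mulr_sumr; apply: eq_bigr => i _; rewrite mulr_sumr.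
  rewrite hQ mulrA mulr_sumr; apply: eq_bigr => i _; rewrite mulr_sumr.
  by apply: eq_bigr => k _; ring.
have E3 : \sum_i \sum_j \sum_k w j * W i j k = \sum_i w i * (4^-1 * de i).
  rewrite exchange_big; apply: eq_bigr => j _ /=; rewrite -hW mulr_sumr.
  by apply: eq_bigr => i _; rewrite mulr_sumr.
have E4 : \sum_(i < n) lm * (4^-1 * ex) = n%:R * (lm * (4^-1 * ex)).
  by rewrite sumr_const card_ord mulr_natl.
(* The contributions are separated: by [E2] the terms with [Q] cancel the gradient of the weight
   paired with [P], by [E3] those with [W] cancel the gradient of [ex / 4]. The [ex] part of the
   weight term and the trace terms with [lm] remain. *)
transitivity (gx * (- \sum_i \sum_j \sum_k c * z i * (w j * P i j k)
   + \sum_i c * z i * (w i * (4^-1 * ex))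
   + (\sum_i \sum_j \sum_k lm * (i == j)%:R * P i j k
     + (\sum_i \sum_j \sum_k w j * Q i j k + \sum_i \sum_j \sum_k w j * W i j k))
   - (\sum_(i < n) lm * (4^-1 * ex) + \sum_i w i * (4^-1 * de i)))).
  rewrite -!big_split/= -!sumrN -!big_split/= mulr_sumr; apply: eq_bigr => i _.
  have -> : \sum_j \sum_k (lm * (i == j)%:R * P i j k + w j * (Q i j k + W i j k)) =
     \sum_j \sum_k lm * (i == j)%:R * P i j k +
     (\sum_j \sum_k w j * Q i j k + \sum_j \sum_k w j * W i j k).
    rewrite -!big_split/=; apply: eq_bigr => j _; rewrite -!big_split/=.
    by apply: eq_bigr => k _; ring.
  have -> : \sum_j \sum_k c * z i * (w j * P i j k) = c * z i * \sum_j \sum_k w j * P i j k.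
    by rewrite mulr_sumr; apply: eq_bigr => j _; rewrite mulr_sumr.
  by rewrite eqxx mulr1n; ring.
rewrite E1 E2 E3 E4.
have -> : \sum_i c * z i * (w i * (4^-1 * ex)) = c * (\sum_i z i * w i) * (4^-1 * ex).
  by rewrite mulr_sumr mulr_suml; apply: eq_bigr => i _; ring.
by field.
Qed.

Lemma div_stress_field x : soliton nabla x0 t0 ->
  \sum_i stress_field_deriv i x = g x * e x *
   ((2 * t0)^-1 / 4 * (\sum_i (x - x0) 0 i * v i x) + lam * (1 - n%:R / 4)).
Proof.
move=> sol.
have sol' j T : ip (soliton_section nabla x0 t0 j) T x = 0.
  by rewrite /ip /soliton_section sol ?mul0mx ?mxtrace0 ?oppr0//; exact: frame_atP.
apply: (@stress_sum _ _ _ _ (fun i => (x - x0) 0 i) (fun i => v i x)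
  (fun j => 2 * \sum_a \sum_b ip (F a b) (cov_ j (F a b)) x)
  (fun i j k => ip (F i k) (F j k) x)
  (fun i j k => ip (cov_ i (F i k)) (F j k) x)
  (fun i j k => ip (F i k) (cov_ i (F j k)) x)) => //.
(* For each [k], the soliton equation with index [k] is paired with F_jk; summing over [k] gives the
   contracted form. *)
- move=> j; rewrite exchange_big/= [in RHS]exchange_big/= mulr_sumr.
  apply: eq_bigr => k _; rewrite mulr_sumr.
  have := sol' k (F j k); rewrite ip_soliton sumrB => /subr0_eq <-.
  by apply: eq_bigr => i _; rewrite mulrA.
- move=> j; have <- := bianchi_contract nabla j x; by field.
Qed.

End StressField.

End Fields.

(** * First variation of the functional *)

Section PolynomialGrowth.
Context {R : realType}.

Lemma geometric_partial_le (q : R) k : 0 <= q -> q < 1 ->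
  \sum_(i < k) q ^+ i <= (1 - q)^-1.
Proof.
move=> q0 q1; have q1' : 0 < 1 - q by rewrite subr_gt0.
rewrite -(ler_pM2l q1') mulfV ?gt_eqF//.
have := subrX1 q k; rewrite -[1 - q]opprB mulNr => <-.
by rewrite opprB gerBl exprn_ge0.
Qed.

(** Completing the square in c (m - 1/c)^2 >= 0. The rate 2 beats a polynomial bounded by C exp(m +
    1) and still leaves geometric decay. *)
Lemma gaussian_shell_le (c : R) (m : nat) : 0 < c ->
  expR (- (c * m%:R ^+ 2)) <= expR c^-1 * expR (- (2 * m%:R)).
Proof.
move=> c0; rewrite -expRD ler_expR.
have : 0 <= c * (m%:R - c^-1) ^+ 2 by rewrite mulr_ge0 ?sqr_ge0// ltW.
have -> : c * (m%:R - c^-1) ^+ 2 = c * m%:R ^+ 2 - 2 * m%:R + c^-1.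
  by field; rewrite gt_eqF.
lra.
Qed.

(** The weighted function is dominated by the series of exp(-c m^2) times [f] restricted to the ball
    of radius m+1. The integral of the m-th term is at most [K * q ^+ m] with q = exp(-1), so the
    series of integrals is bounded by a convergent geometric one. *)
Lemma integrable_Rn_gaussian n (f : 'rV[R]_n -> R) (y : 'rV[R]_n)
    (p : {poly R}) (c : R) :
  continuous f -> (forall x, 0 <= f x) -> 0 < c ->
  (forall rho, 0 < rho -> (int_Rn (eball y rho) f <= (p.[rho])%:E)%E) ->
  integrable_Rn (fun x => f x * expR (- (c * sqnorm (x - y)))).
Proof.
move=> cf f0 c0 growth.
have cw : continuous (fun x : 'rV[R]_n => expR (- (c * sqnorm (x - y)))).
  have c1 : continuous (fun x : 'rV[R]_n => - (c * sqnorm (x - y))).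
    under eq_fun do rewrite -mulNr.
    by apply: continuous_mul; [exact: continuous_const|exact: continuous_sqnorm].
  by move=> x; exact: (continuous_comp (c1 x) (@continuous_expR R _)).
have mf := measurable_continuous cf.
have mfw := measurable_continuous (continuous_mul cf cw).
pose D m : set (n.-tuple (measurableTypeR R)) := [set t | eball y m.+1%:R (rowt t)].
have mD m : measurable (D m).
  apply: (@measurable_rowt_preimage R n (eball y m.+1%:R)).
  rewrite (_ : eball _ _ = (fun x : 'rV[R]_n => sqnorm (x - y)) @^-1` [set s | s < m.+1%:R ^+ 2])//.
  by apply: open_comp; [move=> x _; exact: continuous_sqnorm|exact: open_lt].
pose a (m : nat) : R := expR (- (c * m%:R ^+ 2)).
pose u m := (fun t => (a m)%:E * (f (rowt t))%:E)%E \_ (D m).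
have mu_ m : measurable_fun setT (u m).
  apply/(measurable_restrictT _ (mD m)); apply: measurable_funS (_ : measurable_fun setT _) => //.
  apply: measurable_funeM; exact/measurable_EFinP.
have u0 m t : (0 <= u m t)%E.
  apply: erestrict_ge0 => s _; rewrite -EFinM lee_fin mulr_ge0//.
  exact: expR_ge0.
have [C HC] := horner_le_expR p.
have C0 : 0 <= C by have := HC 0 (lexx _); rewrite expR0 mulr1; exact: le_trans.
pose K := expR c^-1 * (C * expR 1).
have K0 : 0 <= K by rewrite !mulr_ge0// expR_ge0.
pose q : R := expR (-1).
have q0 : 0 <= q by exact: expR_ge0.
have q1 : q < 1 by rewrite -expR0 ltr_expR ltrN10.
have iu m : (\int[lebesgue_Rn R n]_t u m t <= (K * q ^+ m)%:E)%E.
  rewrite -integral_mkcond ge0_integralZl_EFin//; last 3 first.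
  - by move=> t _; rewrite lee_fin.
  - by apply: measurable_funS (_ : measurable_fun setT _) => //; exact/measurable_EFinP.
  - exact: expR_ge0.
  apply: (@le_trans _ _ ((a m)%:E * (p.[m.+1%:R])%:E)%E).
    by apply: lee_wpmul2l; [rewrite lee_fin expR_ge0|exact: growth].
  rewrite -EFinM lee_fin.
  apply: (@le_trans _ _ (a m * (C * expR m.+1%:R))).
    by rewrite ler_wpM2l ?expR_ge0// (le_trans (ler_norm _))// HC.
  apply: (@le_trans _ _ ((expR c^-1 * expR (- (2 * m%:R))) * (C * expR m.+1%:R))).
    by rewrite ler_wpM2r ?mulr_ge0 ?expR_ge0// gaussian_shell_le.
  rewrite /q -expRM_natl /K -[m.+1%:R]natr1 expRD.
  have -> : expR (m%:R * -1) = expR (- (2 * m%:R)) * expR m%:R :> R.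
    by rewrite -expRD; congr expR; ring.
  by rewrite le_eqVlt; apply/orP; left; apply/eqP; ring.
apply/integrableP; split; first exact/measurable_EFinP.
apply: (@le_lt_trans _ _ (\int[lebesgue_Rn R n]_t (\sum_(0 <= m <oo) u m t))%E).
  apply: ge0_le_integral => //.
  - by apply: measurableT_comp => //; exact/measurable_EFinP.
  - exact: ge0_emeasurable_sum.
  - move=> t _; rewrite /= ger0_norm ?mulr_ge0 ?expR_ge0//.
    set s := sqnorm (rowt t - y); have s0 : 0 <= s by exact: sqnorm_ge0.
    (* With m the integer part of the distance to [y], the point lies in the ball of radius m+1 and
       its weight is at most exp(-c m^2): this single term of the series already dominates. *)
    pose m := Num.trunc (Num.sqrt s).
    have /andP[m1 m2] := truncn_itv (sqrtr_ge0 s).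
    apply: le_trans (nneseries_lim_ge m.+1 (fun k _ _ => u0 k t)).
    rewrite big_nat_recr//= -[leLHS]add0e; apply: leeD; first exact: sume_ge0.
    rewrite /u patchE mem_set; last first.
      by rewrite /D/= /eball/= -/s -(sqr_sqrtr s0) ltr_pXn2r// nnegrE ?sqrtr_ge0.
    rewrite -EFinM lee_fin mulrC ler_wpM2r// ler_expR lerN2 ler_wpM2l ?(ltW c0)//.
    by rewrite -(sqr_sqrtr s0) ler_pXn2r// nnegrE ?sqrtr_ge0.
rewrite integral_nneseries//.
apply: (@le_lt_trans _ _ (K * (1 - q)^-1)%:E); last exact: ltry.
apply: lime_le.
  by apply: is_cvg_nneseries => m _ _; exact: integral_ge0.
apply: nearW => k; rewrite big_mkord.
apply: (@le_trans _ _ (\sum_(i < k) (K * q ^+ i)%:E)%E).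
  by apply: lee_sum => i _; exact: iu.
rewrite sumEFin lee_fin -mulr_sumr ler_wpM2l//; exact: geometric_partial_le.
Qed.

End PolynomialGrowth.

(** * Differentiation under the integral sign at 0 *)

Section DeriveUnderIntegral.
Context d (T : measurableType d) (R : realType) (mu : {measure set T -> \bar R}).
Variables (h : R -> T -> R) (h' k : T -> R) (eps : R).
Hypothesis eps_gt0 : 0 < eps.
Hypothesis int_h : forall s, `|s| < eps -> mu.-integrable setT (fun x => (h s x)%:E).
Hypothesis der_h : forall x, is_derive (0 : R) (1 : R) (h ^~ x) (h' x).
Hypothesis int_k : mu.-integrable setT (fun x => (k x)%:E).
Hypothesis dom_h : forall s x, `|s| < eps -> `|h s x - h 0 x| <= `|s| * k x.

Let quotient s x := s^-1 * (h s x - h 0 x).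

Let eps0 : `|0 : R| < eps. Proof. by rewrite normr0. Qed.

Let quotient_cvg (v : R^nat) x : (forall m, v m != 0) -> v @ \oo --> (0 : R) ->
  quotient (v m) x @[m --> \oo] --> h' x.
Proof.
move=> v0 cv; have [/cvg_ex[l Hl] El] := der_h x.
have ll : l = h' x by rewrite -El; apply/esym/cvg_lim.
have {}Hl : s^-1 * (h s x - h 0 x) @[s --> 0^'] --> h' x.
  rewrite -ll; apply: cvg_trans Hl; apply: near_eq_cvg; apply: nearW => s /=.
  by rewrite addr0 [s *: 1]mulr1.
by move/cvgr_dnbhsP : Hl; apply; split.
Qed.

Let quotient_dom s x : s != 0 -> `|s| < eps -> `|quotient s x| <= k x.
Proof.
move=> s0 se; rewrite /quotient normrM normfV ler_pdivrMl ?normr_gt0//.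
exact: dom_h.
Qed.

Let quotient_int s : `|s| < eps -> mu.-integrable setT (fun x => (quotient s x)%:E).
Proof.
move=> se; rewrite /quotient; under eq_fun do rewrite EFinM.
apply: integrableZl => //; under eq_fun do rewrite EFinB.
by apply: integrableB => //; exact: int_h.
Qed.

Let seq_cvg (v : R^nat) : (forall m, v m != 0) -> v @ \oo --> (0 : R) ->
  (forall m, `|v m| < eps) ->
  mu.-integrable setT (fun x => (h' x)%:E) /\
  ((v m)^-1 * (\int[mu]_x h (v m) x - \int[mu]_x h 0 x))%R @[m --> \oo] -->
  \int[mu]_x h' x.
Proof.
move=> v0 cv ve.
have cE x : (quotient (v m) x)%:E @[m --> \oo] --> (h' x)%:E.
  by apply: cvg_EFin; [exact: nearW|exact: quotient_cvg].
have mq m : measurable_fun setT (fun x => (quotient (v m) x)%:E).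
  by have /integrableP[] := quotient_int (ve m).
(* Measurability of [h'] is not assumed; it is a pointwise limit of measurable difference
   quotients. *)
have mh' : measurable_fun setT (fun x => (h' x)%:E).
  apply: (emeasurable_fun_cvg (fun m x => (quotient (v m) x)%:E) _ mq).
  by move=> x _; exact: cE.
have [ih' _ L] := @dominated_convergence _ _ _ mu setT measurableT
  (fun m x => (quotient (v m) x)%:E) (fun x => (h' x)%:E) (fun x => (k x)%:E)
  mq mh' (aeW _ (fun x _ => cE x)) int_k
  (aeW _ (fun x m _ => quotient_dom x (v0 m) (ve m))).
split=> //.
have fE : (\int[mu]_x h' x)%:E = (\int[mu]_x (h' x)%:E)%E.
  by rewrite fineK//; exact: integrable_fin_num.
have {}L : (\int[mu]_x (quotient (v m) x)%:E)%E @[m --> \oo] --> (\int[mu]_x h' x)%:E.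
  by rewrite fE.
rewrite [X in X @ _](_ : _ = fine \o
    (fun m => (\int[mu]_x (quotient (v m) x)%:E)%E)); first exact: fine_cvg.
apply/funext => m /=; rewrite -RintegralB//; [|exact: int_h|exact: int_h].
rewrite -RintegralZl// /comp; under eq_fun do rewrite EFinB.
by apply: integrableB => //; exact: int_h.
Qed.

(** Dominated convergence concerns sequences, so the limit of the difference quotients is tested
    along every sequence of nonzero reals tending to 0. *)
Lemma derive_under_integral :
  mu.-integrable setT (fun x => (h' x)%:E) /\
  is_derive (0 : R) (1 : R) (fun s => Rintegral mu setT (h s)) (Rintegral mu setT h').
Proof.
have L (u : R^nat) : (forall m, u m != 0) -> u @ \oo --> (0 : R) ->
  mu.-integrable setT (fun x => (h' x)%:E) /\
  ((u m)^-1 * (\int[mu]_x h (u m) x - \int[mu]_x h 0 x))%R @[m --> \oo] -->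
  \int[mu]_x h' x.
  (* The finitely many terms of size at least [eps], where nothing is known about [h], are replaced
     by [eps / 2]. *)
  move=> u0 cu; pose v m := if `|u m| < eps then u m else eps / 2.
  have near_uv : \forall m \near \oo, v m = u m.
    near=> m; rewrite /v ifT//; near: m.
    by move/cvgr0_norm_lt : cu => /(_ _ eps_gt0).
  have [] := @seq_cvg v.
  - by move=> m; rewrite /v; case: ifP => // _; rewrite gt_eqF// divr_gt0.
  - by apply: cvg_trans cu; apply: near_eq_cvg; apply: filterS near_uv => m ->.
  - move=> m; rewrite /v; case: ifP => // _.
    by rewrite gtr0_norm ?divr_gt0// ltr_pdivrMr// ltr_pMr// ltr1n.
  move=> ih' H; split=> //; apply: cvg_trans H; apply: near_eq_cvg.
  by apply: filterS near_uv => m ->.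
(* Integrability of [h'] does not depend on the sequence; [harmonic] merely supplies one. *)
have [ih' _] : mu.-integrable setT (fun x => (h' x)%:E) /\ True.
  split=> //; have [] := L harmonic => //.
  - by move=> m; rewrite /harmonic/= invr_eq0 pnatr_eq0.
  - exact: cvg_harmonic.
split=> //.
suff H : (s^-1 *: (((fun s => Rintegral mu setT (h s)) \o shift 0) (s *: 1) -
    (fun s => Rintegral mu setT (h s)) 0)) @[s --> 0^'] --> (Rintegral mu setT h').
  by split; [apply/cvg_ex; eexists; exact: H|exact/cvg_lim].
have {}L : (s^-1 * (\int[mu]_x h s x - \int[mu]_x h 0 x))%R @[s --> (0 : R)^'] -->
    (Rintegral mu setT h').
  by apply/cvgr_dnbhsP => u [u0 cu]; have [] := L u u0 cu.
apply: cvg_trans L; apply: near_eq_cvg; apply: nearW => s /=.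
by rewrite addr0 [s *: 1]mulr1.
Unshelve. all: by end_near. Qed.

End DeriveUnderIntegral.

(** * Gaussians with moving centre and scale *)

Section GaussianFamily.
Context {R : realType} {n : nat}.

Lemma derivable_lipschitz (W : normedModType R) (f : R -> W) df :
  is_derive (0 : R) (1 : R) f df ->
  exists L, exists2 eps, 0 < eps &
    0 <= L /\ forall s, `|s| < eps -> `|f s - f 0| <= L * `|s|.
Proof.
move=> [/cvg_ex[l Hl] _]; exists (`|l| + 1).
have /cvgrPdist_lt/(_ _ ltr01) N := Hl.
have [e /= e0 He] := (nbhs_ballP (0 : R) _).1 N; exists e => //; split; first by rewrite addr_ge0.
move=> s se; have [->|s0] := eqVneq s 0; first by rewrite subrr !normr0 mulr0.
have /= := He s; rewrite /ball/= sub0r normrN => /(_ se s0).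
rewrite addr0 [s *: 1]mulr1 => H.
have -> : f s - f 0 = s *: (s^-1 *: (f s - f 0)) by rewrite scalerA mulfV// scale1r.
rewrite normrZ mulrC ler_wpM2r// -(subrK l (s^-1 *: _)) (le_trans (ler_normD _ _))//.
by rewrite addrC lerD2l distrC ltW.
Qed.

Lemma expR_diff_le (a b m : R) : m <= a -> m <= b ->
  `|expR (- a) - expR (- b)| <= `|a - b| * expR (- m).
Proof.
have key (u v : R) : m <= u -> u <= v -> `|expR (- u) - expR (- v)| <= `|u - v| * expR (- m).
  move=> mu uv; rewrite ger0_norm ?subr_ge0 ?ler_expR ?lerN2// distrC ger0_norm ?subr_ge0//.
  apply: (@le_trans _ _ ((v - u) * expR (- u))); last first.
    by rewrite ler_wpM2l ?subr_ge0// ler_expR lerN2.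
  have -> : expR (- v) = expR (- u) * expR (- (v - u)) by rewrite -expRD; congr expR; ring.
  have := expR_ge1Dx (- (v - u)); have := expR_ge0 (- u); nra.
move=> ma mb; have [ab|/ltW ba] := leP a b; first exact: key.
by rewrite distrC (distrC a); exact: key.
Qed.

(** Half of the decay is spent on the polynomial factor, by way of 1 + w q <= exp(w q). *)
Lemma weight_absorb (w q : R) : 0 < w -> 0 <= q ->
  (q + 1) * expR (- (2 * w * q)) <= (1 + w^-1) * expR (- (w * q)).
Proof.
move=> w0 q0.
have -> : expR (- (2 * w * q)) = expR (- (w * q)) * expR (- (w * q)).
  by rewrite -expRD; congr expR; ring.
rewrite mulrA ler_wpM2r ?expR_ge0// expRN ler_pdivrMr ?expR_gt0//.
have := expR_ge1Dx (w * q) => H.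
apply: (@le_trans _ _ ((1 + w^-1) * (1 + w * q))).
  rewrite (_ : (1 + w^-1) * (1 + w * q) = q + 1 + (w^-1 + w * q)); last first.
    by field; rewrite gt_eqF.
  by rewrite lerDl addr_ge0 ?mulr_ge0 ?invr_ge0// ltW.
by rewrite ler_wpM2l// addr_ge0// invr_ge0 ltW.
Qed.

(** In each coordinate, with displacement d and z the coordinate of [x - x0], the change is d^2 - 2
    z d. Here d^2 <= s L^2 because [s <= 1], and 2|z| <= z^2 + 1. The factor [n] comes from bounding
    every coordinate by the sup norm. *)
Lemma sqnorm_shift_le (x x0 x1 : 'rV[R]_n) (L s : R) : 0 <= L -> 0 <= s <= 1 ->
  `|x1 - x0| <= L * s ->
  `|sqnorm (x - x1) - sqnorm (x - x0)| <=
    s * (L + n%:R * (L + L ^+ 2)) * (sqnorm (x - x0) + 1).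
Proof.
move=> L0 /andP[s0 s1] d; set z := x - x0; pose dd := x1 - x0.
have di i : `|dd 0 i| <= L * s.
  by have /rV_norm_le := d; apply; rewrite mulr_ge0.
have -> : sqnorm (x - x1) - sqnorm z = \sum_i (dd 0 i ^+ 2 - 2 * (z 0 i * dd 0 i)).
  by rewrite /sqnorm -sumrB; apply: eq_bigr => i _; rewrite !mxE; ring.
rewrite (le_trans (ler_norm_sum _ _ _))//.
apply: (@le_trans _ _ (\sum_i (s * L * (z 0 i ^+ 2) + s * (L + L ^+ 2)))).
  apply: ler_sum => i _; have := di i; move: (dd 0 i) (z 0 i) => a b.
  rewrite !ler_norml => /andP[a1 a2].
  have a2s : a ^+ 2 <= s * L ^+ 2.
    have h1 : 0 <= (L * s - a) * (L * s + a) by rewrite mulr_ge0//; lra.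
    have h2 : 0 <= L ^+ 2 * (s * (1 - s)) by rewrite mulr_ge0 ?sqr_ge0// mulr_ge0// subr_ge0.
    by nra.
  have ab : `|2 * (b * a)| <= s * L * (b ^+ 2 + 1).
    rewrite !normrM normr_nat.
    have aL : `|a| <= s * L by rewrite ler_norml [s * L]mulrC a1 a2.
    have b2 : 2 * `|b| <= b ^+ 2 + 1.
      have := sqr_ge0 (`|b| - 1); rewrite sqrrB1 real_normK ?num_real//; lra.
    apply: (@le_trans _ _ ((b ^+ 2 + 1) * (s * L))); last by rewrite mulrC.
    by rewrite mulrA ler_pM// mulr_ge0.
  have := sqr_ge0 a; move: ab; rewrite ler_norml => /andP[]; lra.
rewrite big_split/= -mulr_sumr sumr_const card_ord -/(sqnorm z).
have z0 := sqnorm_ge0 z; rewrite -[X in _ + X]mulr_natl.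
have : 0 <= s * L by rewrite mulr_ge0.
have : 0 <= n%:R * (s * (L + L ^+ 2)) by rewrite !mulr_ge0// addr_ge0// sqr_ge0.
nra.
Qed.

Section Family.
Variables (x_ : R -> 'rV[R]_n) (t_ : R -> R) (x0 xd : 'rV[R]_n) (t0 td : R).
Hypotheses (t0_gt0 : 0 < t0) (x_0 : x_ 0 = x0) (t_0 : t_ 0 = t0).
Hypotheses (dx : is_derive (0 : R) (1 : R) x_ xd) (dt : is_derive (0 : R) (1 : R) t_ td).

Lemma is_derive_inv_family :
  is_derive (0 : R) (1 : R) (fun s => (4 * t_ s)^-1) (- (4 * t0) ^- 2 * (4 * td)).
Proof.
have t40 : 4 * t_ 0 != 0 by rewrite t_0 mulf_neq0// gt_eqF.
have H := is_derive_chain (is_derive_scale 4 dt) (is_derive_inv t40).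
by apply: (is_derive_eq H); rewrite t_0.
Qed.

Lemma is_derive_gaussian_family x :
  is_derive (0 : R) (1 : R) (fun s => gaussian (x_ s) (t_ s) x)
   (gaussian x0 t0 x * (\sum_i (2 * t0)^-1 * (x - x0) 0 i * xd 0 i
      + (4 * t0 ^+ 2)^-1 * sqnorm (x - x0) * td)).
Proof.
have Hx := is_derive_sub (is_derive_const x (0 : R) (1 : R)) dx.
have /is_derive_mxP Hx' := Hx.
have Hq : is_derive (0 : R) (1 : R) (fun s => sqnorm (x - x_ s))
    (\sum_i - (2 * (x - x0) 0 i * xd 0 i)).
  have H := is_derive_bigsum (index_enum 'I_n) (P := xpredT) (fun i _ =>
     is_derive_mul (Hx' 0 i) (Hx' 0 i)).
  have H' : is_derive (0 : R) (1 : R) (fun s => sqnorm (x - x_ s))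
     (\sum_i ((0 - xd) 0 i * (x - x_ 0) 0 i + (x - x_ 0) 0 i * (0 - xd) 0 i)).
    apply: is_derive_compat H; apply/funext => s; rewrite /sqnorm.
    by apply: eq_bigr => i _; rewrite expr2.
  apply: (is_derive_eq H'); apply: eq_bigr => i _; rewrite x_0 !mxE; ring.
have H := is_derive_chain (is_derive_oppr (is_derive_mul Hq is_derive_inv_family))
  (is_derive_expR _).
apply: (is_derive_eq H); rewrite /= x_0 t_0 -/(gaussian x0 t0 x); congr (_ * _).
rewrite sumrN mulNr opprD opprK mulr_suml; congr (_ + _); last first.
  by field; rewrite gt_eqF.
by apply: eq_bigr => i _; field; rewrite gt_eqF.
Qed.

(** The difference is bounded by |s| times a wider Gaussian. With u0 = 1/(4 t0), both exponents stay
    above u0 (q - 1)/4 for small [s], and [weight_absorb] spends half of this rate on the factor q +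
    1, which leaves u0/8. *)
Lemma gaussian_dominated : exists K c, exists2 eps, 0 < eps & 0 < c /\
  forall s, `|s| < eps -> forall x,
  `|gaussian (x_ s) (t_ s) x - gaussian x0 t0 x| <=
    `|s| * (K * expR (- (c * sqnorm (x - x0)))).
Proof.
have [L1 [e1 e10 [L10 HL1]]] := derivable_lipschitz dx.
have [L2 [e2 e20 [L20 HL2]]] := derivable_lipschitz is_derive_inv_family.
rewrite x_0 in HL1; rewrite t_0 in HL2.
set u0 := (4 * t0)^-1 in HL2; have u00 : 0 < u0 by rewrite invr_gt0 mulr_gt0.
pose L' := L1 + n%:R * (L1 + L1 ^+ 2).
have L'0 : 0 <= L' by rewrite addr_ge0// mulr_ge0// addr_ge0// sqr_ge0.
(* The Lipschitz constant of the exponent, read off from qs us - q u0 = qs (us - u0) + (qs - q)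
   u0. *)
pose M := L2 * (L' + 1) + u0 * L'.
have M0 : 0 <= M by apply: addr_ge0; apply: mulr_ge0 => //; [exact: addr_ge0|exact: ltW].
exists (M * expR (u0 / 4) * (1 + (u0 / 8)^-1)), (u0 / 8).
(* [e3] ensures |s| L' <= 1/2, hence qs >= q/2 - 1/2; [e4] below ensures us >= u0/2. *)
pose e3 := (2 * (L' + 1))^-1; have e30 : 0 < e3.
  by rewrite invr_gt0 mulr_gt0// ltr_wpDl.
pose e4 := u0 / (2 * (L2 + 1)); have e40 : 0 < e4.
  by rewrite divr_gt0// mulr_gt0// ltr_wpDl.
exists (Num.min (Num.min e1 e2) (Num.min 1 (Num.min e3 e4))).
  by rewrite !lt_min e10 e20 ltr01 e30.
split; first by rewrite divr_gt0.
move=> s; rewrite !lt_min => /andP[/andP[se1 se2] /andP[s1 /andP[se3 se4]]] x.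
set q := sqnorm (x - x0); have q0 : 0 <= q := sqnorm_ge0 _.
set qs := sqnorm (x - x_ s); have qs0 : 0 <= qs := sqnorm_ge0 _.
set us := (4 * t_ s)^-1; have Hu : `|us - u0| <= L2 * `|s| := HL2 s se2.
have s01 : 0 <= `|s| <= 1 by rewrite normr_ge0 ltW.
have Hq : `|qs - q| <= `|s| * L' * (q + 1) := sqnorm_shift_le x L10 s01 (HL1 s se1).
have n0 := normr_ge0 s.
have sL' : `|s| * L' <= 2^-1.
  have : `|s| * (2 * (L' + 1)) <= 1.
    by move: se3; rewrite /e3 -div1r ltr_pdivlMr ?mulr_gt0 ?ltr_wpDl// => /ltW.
  by nra.
have sL2 : L2 * `|s| <= u0 / 2.
  have : `|s| * (2 * (L2 + 1)) <= u0.
    by move: se4; rewrite /e4 ltr_pdivlMr ?mulr_gt0 ?ltr_wpDl// => /ltW.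
  by nra.
have gE y s' : gaussian y s' x = expR (- (sqnorm (x - y) * (4 * s')^-1)) by [].
rewrite !gE -/q -/qs -/us -/u0.
move: Hq; rewrite ler_norml => /andP[Hq1 Hq2].
move: Hu; rewrite ler_norml => /andP[Hu1 Hu2].
have qs_ge : q / 2 - 2^-1 <= qs.
  have : `|s| * L' * (q + 1) <= 2^-1 * (q + 1) by rewrite ler_wpM2r// addr_ge0.
  by lra.
have us_ge : u0 / 2 <= us by lra.
have b1 : u0 * q / 4 - u0 / 4 <= qs * us.
  have : qs * (u0 / 2) <= qs * us by rewrite ler_wpM2l.
  have : (q / 2 - 2^-1) * (u0 / 2) <= qs * (u0 / 2) by rewrite ler_wpM2r// divr_ge0// ltW.
  by lra.
have b2 : u0 * q / 4 - u0 / 4 <= q * u0 by have := mulr_ge0 q0 (ltW u00); lra.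
apply: (le_trans (expR_diff_le b1 b2)).
have diff : `|qs * us - q * u0| <= `|s| * M * (q + 1).
  have -> : qs * us - q * u0 = qs * (us - u0) + (qs - q) * u0 by ring.
  apply: (le_trans (ler_normD _ _)).
  have d1 : `|qs * (us - u0)| <= (q + `|s| * L' * (q + 1)) * (L2 * `|s|).
    rewrite normrM ger0_norm// ler_pM//; first by lra.
    by rewrite ler_norml Hu1 Hu2.
  have d2 : `|(qs - q) * u0| <= `|s| * L' * (q + 1) * u0.
    rewrite normrM (gtr0_norm u00) ler_wpM2r//; first exact: ltW.
    by rewrite ler_norml Hq1 Hq2.
  have d3 : (q + `|s| * L' * (q + 1)) * (L2 * `|s|) <= `|s| * (L2 * (L' + 1)) * (q + 1).
    have sl : `|s| * (L' * (q + 1)) <= L' * (q + 1).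
      by apply: ler_piMl; [apply: mulr_ge0 => //; exact: addr_ge0|exact: ltW].
    have : (q + `|s| * L' * (q + 1)) * (L2 * `|s|) <= ((q + 1) + L' * (q + 1)) * (L2 * `|s|).
      by rewrite ler_wpM2r ?mulr_ge0//; lra.
    by move=> /le_trans; apply; rewrite le_eqVlt; apply/orP; left; apply/eqP; ring.
  by rewrite /M; lra.
apply: (le_trans (ler_wpM2r (expR_ge0 _) diff)).
have -> : expR (- (u0 * q / 4 - u0 / 4)) = expR (u0 / 4) * expR (- (2 * (u0 / 8) * q)).
  by rewrite -expRD; congr expR; field.
have W := weight_absorb (divr_gt0 u00 (ltr0n R 8)) q0.
have -> : `|s| * M * (q + 1) * (expR (u0 / 4) * expR (- (2 * (u0 / 8) * q))) =
  `|s| * M * expR (u0 / 4) * ((q + 1) * expR (- (2 * (u0 / 8) * q))) by ring.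
have P : 0 <= `|s| * M * expR (u0 / 4) by rewrite !mulr_ge0// expR_ge0.
apply: (le_trans (ler_wpM2l P W)).
by rewrite le_eqVlt; apply/orP; left; apply/eqP; ring.
Qed.

End Family.

Lemma is_derive_prefactor (t : R) : 0 < t ->
  is_derive t (1 : R) (fun t => t ^+ 2 * (4 * pi * t) `^ (- (n%:R / 2)))
   (t ^+ 2 * (4 * pi * t) `^ (- (n%:R / 2)) * ((2 - n%:R / 2) / t)).
Proof.
move=> t0; set a := - (n%:R / 2).
have p0 : 0 < 4 * pi * t by rewrite !mulr_gt0// pi_gt0.
have Hp := is_derive_chain (is_derive_scale (4 * pi) (is_derive_id t (1 : R)))
  (is_derive1_powR a p0).
have Ht := is_derive_mul (is_derive_id t (1 : R)) (is_derive_id t (1 : R)).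
have := is_derive_mul Ht Hp => H.
have H' : is_derive t (1 : R) (fun t => t ^+ 2 * (4 * pi * t) `^ a) _ := H.
apply: (is_derive_eq H').
have E : (4 * pi * t) `^ a = (4 * pi * t) `^ (a - 1) * (4 * pi * t).
  rewrite -{3}(powRr1 (ltW p0)) -powRD ?subrK//.
  by apply/implyP => _; rewrite gt_eqF.
rewrite /= -[(4 * pi) *: t]/(4 * pi * t) -[(4 * pi) *: (1 : R)]/(4 * pi * 1) E /a.
by field; rewrite gt_eqF.
Qed.

End GaussianFamily.

Lemma curv_near (R : realType) (n r : nat) (D : set 'rV[R]_n)
    (A A' : 'I_n -> 'rV[R]_n -> 'M[R]_r) i j x :
  open D -> D x -> (forall k y, D y -> A k y = A' k y) ->
  curv A i j x = curv A' i j x.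
Proof.
move=> oD Dx AA'; rewrite /curv (AA' i x Dx) (AA' j x Dx).
by rewrite (derive_near _ oD Dx (AA' i)) (derive_near _ oD Dx (AA' j)).
Qed.

(** * Variation of curvature and energy along a family of connections *)

Section ConnectionFamily.
Context {R : realType} {n r : nat} {E : metric_bundle R n r}.
Variables (nabla : connection E) (nabla_ : R -> connection E) (eps : R).
Hypothesis eps_gt0 : 0 < eps.
Hypothesis nabla_0 : forall a i x, dom a x ->
  conn_form (nabla_ 0) a i x = conn_form nabla a i x.
Hypothesis smooth_family : forall a i,
  smooth_on [set p : R * 'rV[R]_n | `|p.1| < eps /\ dom a p.2]
    (fun p : R * 'rV[R]_n => conn_form (nabla_ p.1) a i p.2).

Let D (a : chart E) : set (R * 'rV[R]_n) :=
  [set p : R * 'rV[R]_n | `|p.1| < eps /\ dom a p.2].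
Let f (a : chart E) i (p : R * 'rV[R]_n) : 'M[R]_r :=
  conn_form (nabla_ p.1) a i p.2.
(** The parameter is treated as one more coordinate: derivatives in [s] and in [x] become
    directional derivatives on R x R^n, which [clairaut_mx] allows to commute. *)
Let ds : R * 'rV[R]_n := (1, 0).
Let dx (v : 'rV[R]_n) : R * 'rV[R]_n := (0, v).

Let open_D a : open (D a).
Proof.
rewrite (_ : D a = [set p : R * 'rV[R]_n | `|p.1| < eps] `&` [set p : R * 'rV[R]_n | dom a p.2])//.
apply: openI.
  apply: (@open_comp _ _ (fun p : R * 'rV[R]_n => `|p.1|) [set s | s < eps]); last exact: open_lt.
  by move=> p _; apply: cvg_norm; exact: cvg_fst.
apply: (@open_comp _ _ (fun p : R * 'rV[R]_n => p.2) (dom a)); last exact: dom_open.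
by move=> p _; exact: cvg_snd.
Qed.

Let D0 a x : dom a x -> D a (0, x).
Proof. by split; rewrite ?normr0. Qed.

Let line_s (x : 'rV[R]_n) (s h : R) : (h *: (1 : R^o) + s, x) = h *: ds + (s, x).
Proof.
by have -> : h *: ds + (s, x) = (h *: (1 : R^o) + s, h *: 0 + x) by [];
  rewrite scaler0 add0r.
Qed.

Let line_x (s : R) (x v : 'rV[R]_n) (h : R) : (s, h *: v + x) = h *: dx v + (s, x).
Proof.
by have -> : h *: dx v + (s, x) = (h *: (0 : R^o) + s, h *: v + x) by [];
  rewrite scaler0 add0r.
Qed.

Lemma variationE a i x : Defs.variation nabla_ a i x = 'D_ds (f a i) (0, x).
Proof.
rewrite /Defs.variation derive1E.
exact: (@derive_affine R R^o _ _ (fun s => (s, x)) (f a i) 0 1 ds (line_s x 0)).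
Qed.

Lemma is_derive_conn_family a i x : dom a x ->
  is_derive (0 : R) (1 : R) (fun s => conn_form (nabla_ s) a i x)
    (Defs.variation nabla_ a i x).
Proof.
move=> ax; rewrite variationE.
have H := smooth_on_is_derive ds (smooth_family a i) (D0 ax).
exact: (@is_derive_affine R R^o _ _ (fun s => (s, x)) (f a i) 0 1 ds _ (line_s x 0)).1.
Qed.

(** The inhomogeneous term of the transformation law does not depend on [s], so it disappears on
    differentiation and the variation transforms as a section. *)
Lemma skew_variation i : skew_section (fun a => Defs.variation nabla_ a i).
Proof.
split=> [a|a b x ax bx|a x ax].
- have c0 : continuous (fun y : 'rV[R]_n => (0 : R, y)).
    move=> y; have H1 : (fun _ : 'rV[R]_n => (0 : R)) @ nbhs y --> (0 : R) by exact: cvg_cst.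
    exact: (@cvg_pair _ _ _ (nbhs y) (nbhs (0 : R)) (nbhs y) _ _ _ _ id H1 cvg_id).
  have H := @smooth_on_affine R _ _ _ (D a) ('D_ds (f a i)) (fun y => (0, y)) dx c0
    (fun x v h => line_x 0 x v h) (smooth_on_derive ds (smooth_family a i)).
  apply: (smooth_on_ext (f := 'D_ds (f a i) \o (fun y => (0, y)))).
  + exact: dom_open.
  + by move=> y _; rewrite variationE.
  + by apply: smooth_onS H => y ay; exact: D0.
- have Ha := is_derive_add (is_derive_mulmx (is_derive_conn_family i ax)
     (is_derive_const (trans a b x) (0 : R) (1 : R)))
     (is_derive_const ('D_(basis_vec R i) (trans a b) x) (0 : R) (1 : R)).
  have Hb := is_derive_mulmx (is_derive_const (trans a b x) (0 : R) (1 : R))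
     (is_derive_conn_family i bx).
  have := is_derive_unique openT I (fun s _ => conn_trans (nabla_ s) i ax bx) Ha Hb.
  by rewrite mulmx0 mul0mx !addr0 add0r.
- exact: (is_derive_unique openT I (fun s _ => conn_skew (nabla_ s) i ax)
    (is_derive_trmx (is_derive_conn_family i ax))
    (is_derive_oppr (is_derive_conn_family i ax))).
Qed.

Lemma is_derive_partial_family a i v x : dom a x ->
  is_derive (0 : R) (1 : R) (fun s => 'D_v (conn_form (nabla_ s) a i) x)
    ('D_v (Defs.variation nabla_ a i) x).
Proof.
move=> ax.
have E1 s : 'D_(dx v) (f a i) (s, x) = 'D_v (conn_form (nabla_ s) a i) x.
  exact: esym (@derive_affine R _ _ _ (fun y => (s, y)) (f a i) x v (dx v)
    (line_x s x v)).
have E2 : 'D_ds ('D_(dx v) (f a i)) (0, x) = 'D_v (Defs.variation nabla_ a i) x.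
  apply: (etrans (clairaut_mx ds (dx v) (@open_D a) (D0 ax) (smooth_family a i))).
  have := @derive_affine R _ _ _ (fun y => (0, y)) ('D_ds (f a i)) x v (dx v)
    (line_x 0 x v).
  move=> <-; congr ('D_v _ x); apply/funext => y; exact: esym (variationE a i y).
have H := smooth_on_is_derive ds (smooth_on_derive (dx v) (smooth_family a i)) (D0 ax).
have H' := (@is_derive_affine R R^o _ _ (fun s => (s, x)) ('D_(dx v) (f a i)) 0 1 ds _
  (line_s x 0)).1 H.
have E3 : 'D_(dx v) (f a i) \o (fun s => (s, x)) =
    fun s => 'D_v (conn_form (nabla_ s) a i) x.
  by apply/funext => s; exact: E1.
exact: (is_derive_eq (is_derive_compat E3 H') E2).
Qed.

Lemma is_derive_curv_family a i j x : dom a x ->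
  is_derive (0 : R) (1 : R) (fun s => curv (conn_form (nabla_ s) a) i j x)
    (ext_cov (conn_form nabla a) (Defs.variation nabla_ a) i j x).
Proof.
move=> ax.
have Hi := is_derive_conn_family i ax; have Hj := is_derive_conn_family j ax.
have H := is_derive_add (is_derive_sub
    (is_derive_partial_family j (basis_vec R i) ax)
    (is_derive_partial_family i (basis_vec R j) ax))
  (is_derive_sub (is_derive_mulmx Hi Hj) (is_derive_mulmx Hj Hi)).
apply: (is_derive_eq H); rewrite (nabla_0 i ax) (nabla_0 j ax).
exact: curv_variation_mx.
Qed.

Lemma curv_family0 a i j x : dom a x ->
  curv (conn_form (nabla_ 0) a) i j x = curv (conn_form nabla a) i j x.
Proof.
move=> ax.
exact: (curv_near i j (@dom_open _ _ _ E a) ax (fun k y ay => nabla_0 k ay)).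
Qed.

Lemma energy_family0 x : energy_density (nabla_ 0) x = energy_density nabla x.
Proof.
apply: eq_bigr => i _; apply: eq_bigr => j _.
by rewrite curv_family0//; exact: frame_atP.
Qed.

(** One factor 2 comes from differentiating a square, the other from pairing the skew F_ij with both
    halves of the exterior derivative. *)
Lemma is_derive_energy_family x :
  is_derive (0 : R) (1 : R) (fun s => energy_density (nabla_ s) x)
    (4 * \sum_i \sum_j ip (curv_section nabla i j)
       (cov_section nabla i (fun a => Defs.variation nabla_ a j)) x).
Proof.
set a := frame_at E x; have ax : dom a x := frame_atP x.
have H := is_derive_bigsum (index_enum 'I_n) (P := xpredT) (fun i _ =>
  is_derive_bigsum (index_enum 'I_n) (P := xpredT) (fun j _ =>
   is_derive_oppr (is_derive_mxtrace
    (is_derive_mulmx (is_derive_curv_family i j ax) (is_derive_curv_family i j ax))))).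
apply: (is_derive_eq H).
pose B j : chart E -> 'rV[R]_n -> 'M[R]_r := fun a => Defs.variation nabla_ a j.
transitivity (2 * \sum_i \sum_j (ip (curv_section nabla i j) (cov_section nabla i (B j)) x
   - ip (curv_section nabla i j) (cov_section nabla j (B i)) x)).
  rewrite mulr_sumr; apply: eq_bigr => i _; rewrite mulr_sumr; apply: eq_bigr => j _.
  rewrite !curv_family0// mxtraceD [\tr (ext_cov _ _ _ _ _ *m _)]mxtrace_mulC.
  rewrite /ip -/a /ext_cov mulmxBr raddfB/= /curv_section /cov_section /B; ring.
have E1 : \sum_i \sum_j ip (curv_section nabla i j) (cov_section nabla j (B i)) x =
   - \sum_i \sum_j ip (curv_section nabla i j) (cov_section nabla i (B j)) x.
  rewrite exchange_big -sumrN; apply: eq_bigr => i _; rewrite -sumrN.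
  by apply: eq_bigr => j _; rewrite (curv_sectionC nabla i j) ipNl.
under eq_bigr do rewrite sumrB.
by rewrite sumrB E1 opprK /B; ring.
Qed.

End ConnectionFamily.

(** * Derivative of the functional along a family *)

Section FirstVariation.
Context {R : realType} {n r : nat} {E : metric_bundle R n r}.
Variables (nabla : connection E) (x0 : 'rV[R]_n) (t0 : R).
Hypothesis t0_gt0 : 0 < t0.
Hypothesis growth : exists y : 'rV[R]_n, polynomial_energy_growth nabla y.

(** Growth is known about [y] only. The inequality |x - y|^2 / 2 <= |x - z|^2 + |z - y|^2 recentres
    the Gaussian at the price of half its rate and a constant factor. *)
Lemma integrable_energy_gaussian (z : 'rV[R]_n) (c : R) : 0 < c ->
  integrable_Rn (fun x => energy_density nabla x * expR (- (c * sqnorm (x - z)))).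
Proof.
move=> c0; have [y [p Hp]] := growth.
have c2 : 0 < c / 2 by rewrite divr_gt0.
have I := integrable_Rn_gaussian (@continuous_energy _ _ _ _ nabla) (energy_ge0 nabla) c2 Hp.
have I' := integrable_RnZ (expR (c * sqnorm (z - y))) I.
apply: integrable_Rn_le I'.
  apply: measurable_continuous; apply: continuous_mul; first exact: continuous_energy.
  have c1 : continuous (fun x : 'rV[R]_n => - (c * sqnorm (x - z))).
    under eq_fun do rewrite -mulNr.
    by apply: continuous_mul; [exact: continuous_const|exact: continuous_sqnorm].
  by move=> x; exact: (continuous_comp (c1 x) (@continuous_expR R _)).
move=> x; have e0 := energy_ge0 nabla x.
rewrite ger0_norm ?mulr_ge0 ?expR_ge0// mulrCA ler_wpM2l// -expRD ler_expR.
have -> : c * sqnorm (z - y) - c / 2 * sqnorm (x - y) =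
  - (c * (sqnorm (x - y) / 2 - sqnorm (z - y))) by field.
rewrite lerN2 ler_wpM2l ?(ltW c0)// lerBlDr ler_pdivrMr//.
rewrite /sqnorm -big_split/= mulr_suml; apply: ler_sum => i _; rewrite !mxE.
by have := sqr_ge0 (x 0 i - z 0 i - (z 0 i - y 0 i)); nra.
Qed.

Lemma integrable_energy_weight (q : 'rV[R]_n -> R) (C : R) : continuous q ->
  (forall x, `|q x| <= C * (sqnorm (x - x0) + 1)) ->
  integrable_Rn (fun x => energy_density nabla x * (q x * gaussian x0 t0 x)).
Proof.
(* The rate of the Gaussian weight is 1/(4 t0), twice 1/(8 t0): the form required by
   [weight_absorb]. *)
move=> cq qC; have w0 : 0 < (8 * t0)^-1 by rewrite invr_gt0 mulr_gt0.
have I := integrable_RnZ (C * (1 + (8 * t0)^-1^-1)) (integrable_energy_gaussian x0 w0).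
apply: integrable_Rn_le I.
  apply: measurable_continuous; apply: continuous_mul; first exact: continuous_energy.
  by apply: continuous_mul => //; exact: continuous_gaussian.
move=> x; have e0 := energy_ge0 nabla x.
have C0 : 0 <= C.
  have := le_trans (normr_ge0 _) (qC x); rewrite pmulr_lge0//.
  by rewrite ltr_wpDl// sqnorm_ge0.
rewrite normrM (ger0_norm e0) mulrCA ler_wpM2l// normrM (gtr0_norm (gaussian_gt0 x0 t0 x)).
apply: (@le_trans _ _ (C * (sqnorm (x - x0) + 1) * gaussian x0 t0 x)).
  by rewrite ler_wpM2r ?qC// ltW// gaussian_gt0.
rewrite -!mulrA ler_wpM2l//.
have := weight_absorb w0 (sqnorm_ge0 (x - x0)); congr (_ * expR _ <= _).
by field; rewrite gt_eqF.
Qed.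

Lemma integrable_energy : integrable_Rn (fun x => energy_density nabla x * gaussian x0 t0 x).
Proof.
have -> : (fun x => energy_density nabla x * gaussian x0 t0 x) =
    fun x => energy_density nabla x * (1 * gaussian x0 t0 x).
  by apply/funext => x; rewrite mul1r.
apply: (@integrable_energy_weight (fun=> 1) 1); first exact: continuous_const.
by move=> x; rewrite normr1 mul1r lerDr sqnorm_ge0.
Qed.

Definition energy_variation (B : 'I_n -> chart E -> 'rV[R]_n -> 'M[R]_r) x : R :=
  4 * \sum_i \sum_j ip (curv_section nabla i j) (cov_section nabla i (B j)) x.

Definition gaussian_variation (xd : 'rV[R]_n) (td : R) x : R :=
  \sum_i (2 * t0)^-1 * (x - x0) 0 i * xd 0 i
    + (4 * t0 ^+ 2)^-1 * sqnorm (x - x0) * td.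

Lemma first_variation nabla_ x_ t_ :
  one_parameter_family nabla x0 t0 nabla_ x_ t_ -> dominated_energy nabla_ x_ t_ ->
  let h' := fun x : 'rV[R]_n =>
     energy_variation (fun j a => Defs.variation nabla_ a j) x * gaussian x0 t0 x
     + energy_density nabla x * (gaussian x0 t0 x *
       gaussian_variation ('D_1 x_ 0) ('D_1 t_ 0) x) in
  [/\ \forall s \near (0 : R), F_functional (nabla_ s) (x_ s) (t_ s) \is a fin_num,
   integrable_Rn h' &
   is_derive (0 : R) (1 : R)
     (fun s => fine (F_functional (nabla_ s) (x_ s) (t_ s)))
     (t0 ^+ 2 * (4 * pi * t0) `^ (- (n%:R / 2)) *
      (((2 - n%:R / 2) / t0 * 'D_1 t_ 0) *
         Rintegral (lebesgue_Rn R n) setT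
           (fun t => energy_density nabla (rowt t) * gaussian x0 t0 (rowt t)) +
       Rintegral (lebesgue_Rn R n) setT (fun t => h' (rowt t))))].
Proof.
move=> [nabla_0 x_0 t_0 [e1 e10 [sn sx st tpos]]] [g ig [e2 e20 Hg]] h'.
have z0 : [set s : R | `|s| < e1] 0 by rewrite /= normr0.
have dx := smooth_on_is_derive (1 : R) sx z0.
have dt := smooth_on_is_derive (1 : R) st z0.
have [K [c [e3 e30 [c0 HK]]]] := gaussian_dominated t0_gt0 x_0 t_0 dx dt.
pose eps := Num.min e2 e3.
have eps0 : 0 < eps by rewrite lt_min e20.
pose h s x := energy_density (nabla_ s) x * gaussian (x_ s) (t_ s) x.
pose k x := g x + K * (energy_density nabla x * expR (- (c * sqnorm (x - x0)))).
have en0 x : energy_density (nabla_ 0) x = energy_density nabla x.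
  exact: energy_family0.
have h0E x : h 0 x = energy_density nabla x * gaussian x0 t0 x.
  by rewrite /h en0 x_0 t_0.
have ik : integrable_Rn k.
  by apply: integrable_RnD => //; apply: integrable_RnZ; exact: integrable_energy_gaussian.
have hk s x : `|s| < eps -> `|h s x - h 0 x| <= `|s| * k x.
  rewrite lt_min => /andP[se2 se3].
  (* The energy difference keeps the moved Gaussian, as in [dominated_energy]; the Gaussian
     difference is paired with the fixed energy, where growth applies. *)
  have -> : h s x - h 0 x = (energy_density (nabla_ s) x - energy_density (nabla_ 0) x) *
     gaussian (x_ s) (t_ s) x + energy_density nabla x *
     (gaussian (x_ s) (t_ s) x - gaussian x0 t0 x) by rewrite h0E /h en0; ring.
  rewrite (le_trans (ler_normD _ _))// /k [leRHS]mulrDr lerD//.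
    by rewrite normrM (gtr0_norm (gaussian_gt0 _ _ _)); exact: Hg.
  rewrite normrM (ger0_norm (energy_ge0 _ _)).
  have := ler_wpM2l (energy_ge0 nabla x) (HK s se3 x).
  by move=> /le_trans; apply; rewrite le_eqVlt; apply/orP; left; apply/eqP; ring.
have mh s : measurable_fun setT (h s \o @rowt R n).
  apply: measurable_continuous; apply: continuous_mul; first exact: continuous_energy.
  exact: continuous_gaussian.
have ih s : `|s| < eps -> integrable_Rn (h s).
  move=> se; have I := integrable_RnD (integrable_Rn_norm integrable_energy)
     (integrable_RnZ `|s| ik).
  apply: integrable_Rn_le I => // x.
  have -> : h s x = h 0 x + (h s x - h 0 x) by rewrite addrC subrK.
  by rewrite (le_trans (ler_normD _ _))// h0E lerD2l -h0E; exact: hk.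
have dh x : is_derive (0 : R) (1 : R) (h ^~ x) (h' x).
  have de := is_derive_energy_family e10 nabla_0 sn x.
  have dg := is_derive_gaussian_family t0_gt0 x_0 t_0 dx dt x.
  have H := is_derive_mul de dg.
  by apply: (is_derive_eq H); rewrite en0 x_0 t_0.
have [ih' dI] := @derive_under_integral _ _ R (lebesgue_Rn R n)
  (fun s t => h s (rowt t)) (fun t => h' (rowt t)) (fun t => k (rowt t)) eps eps0
  ih (fun t => dh (rowt t)) ik (fun s t se => hk s (rowt t) se).
have near_eps : \forall s \near (0 : R), `|s| < eps.
  by apply/nbhs_ballP; exists eps => //= s; rewrite /ball/= sub0r normrN.
have FE s : `|s| < eps -> F_functional (nabla_ s) (x_ s) (t_ s) =
   (t_ s ^+ 2 * (4 * pi * t_ s) `^ (- (n%:R / 2)) *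
     Rintegral (lebesgue_Rn R n) setT (fun t => h s (rowt t)))%:E.
  move=> se; rewrite EFinM /F_functional fineK//.
  exact: (integrable_fin_num measurableT (ih s se)).
split.
- by apply: filterS near_eps => s /FE ->.
- exact: ih'.
- have dC := is_derive_chain dt (is_derive_prefactor (n := n) (t := t_ 0) _).
  rewrite t_0 in dC; have {}dC := dC t0_gt0.
  have dF := is_derive_mul dC dI.
  apply: (near_eq_is_derive (f := fun s => t_ s ^+ 2 * (4 * pi * t_ s) `^ (- (n%:R / 2)) *
     Rintegral (lebesgue_Rn R n) setT (fun t => h s (rowt t)))).
    by apply: filterS near_eps => s /FE ->.
  apply: (is_derive_eq dF); rewrite /= t_0.
  have -> : (fun t : n.-tuple _ => h 0 (rowt t)) =
    fun t => energy_density nabla (rowt t) * gaussian x0 t0 (rowt t).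
    by apply/funext => t; rewrite h0E.
  ring.
Qed.

End FirstVariation.

(** * Compactly supported variations *)

Section Positivity.
Context {R : realType}.

Lemma integral_Rn_eq0 n (f : 'rV[R]_n -> R) x : continuous f ->
  (forall y, 0 <= f y) ->
  (\int[lebesgue_Rn R n]_t (f (rowt t))%:E = 0)%E -> f x = 0.
Proof.
move=> cf f0 If; apply/eqP; rewrite eq_le f0 andbT leNgt; apply/negP => fx.
have fx2 : 0 < f x / 2 by rewrite divr_gt0.
have /cvgrPdist_lt/(_ _ fx2) N := cf x.
have [e /= e0 He] := (nbhs_ballP x _).1 N.
(* A cube of side [e] inside the ball of radius [e] on which [f] exceeds half its value at [x]; its
   measure is the positive number e^n. *)
pose A := tbox (fun i : 'I_n => [set` `[x 0 i - e / 2, x 0 i + e / 2]%R] : set (measurableTypeR R)).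
have mA : measurable A by apply: measurable_tbox => i; exact: measurable_itv.
have e20 : 0 < e / 2 by rewrite divr_gt0.
have lA : lebesgue_Rn R n A = (\prod_(i < n) e)%:E.
  rewrite /A (@lebesgue_Rn_itv R n (fun i => x 0 i - e / 2) (fun i => x 0 i + e / 2)).
    by congr EFin; apply: eq_bigr => i _; field.
  by move=> i; lra.
have : ((f x / 2)%:E * lebesgue_Rn R n A <= 0)%E.
  rewrite -If -[A in X in (X <= _)%E]setIT -integral_indic//.
  rewrite -ge0_integralZl_EFin//; last 2 first.
  - by apply/measurable_EFinP; exact: measurable_indic.
  - exact: ltW.
  apply: ge0_le_integral => //.
  - by move=> t _; rewrite -EFinM lee_fin mulr_ge0// ltW.
  - by apply: measurable_funeM; apply/measurable_EFinP; exact: measurable_indic.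
  - by apply/measurable_EFinP; exact: measurable_continuous.
  move=> t _; rewrite -EFinM lee_fin indicE; case: (boolP (t \in A)) => [|_]; last first.
    by rewrite mulr0.
  rewrite inE => tA; rewrite mulr1.
  have xt : ball x e (rowt t).
    rewrite -ball_normE/= rV_norm_lt// => i; rewrite !mxE.
    have := tA i; rewrite /= in_itv/= => /andP[t1 t2].
    by rewrite ltr_norml; apply/andP; split; lra.
  have := He _ xt; rewrite /= ltr_norml => /andP[_]; lra.
by rewrite lA -EFinM lee_fin leNgt mulr_gt0// prodr_gt0.
Qed.

End Positivity.

Section Perturbation.
Context {R : realType} {n r : nat} {E : metric_bundle R n r}.
Variables (nabla : connection E) (x0 : 'rV[R]_n) (t0 : R).
Variable B : 'I_n -> chart E -> 'rV[R]_n -> 'M[R]_r.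
Hypothesis skB : forall i, skew_section (B i).

Definition ext_section i j : chart E -> 'rV[R]_n -> 'M[R]_r :=
  fun a => ext_cov (conn_form nabla a) (fun i => B i a) i j.

Definition stability_section j : chart E -> 'rV[R]_n -> 'M[R]_r :=
  fun a => stability_op (conn_form nabla a) x0 t0 (fun i => B i a) j.

Lemma skew_ext i j : skew_section (ext_section i j).
Proof.
by apply: skew_sectionD; [|apply: skew_sectionN]; exact: skew_section_cov.
Qed.

Lemma skew_stability j : skew_section (stability_section j).
Proof.
apply: skew_sectionD; first apply: skew_sectionD.
- apply: skew_sectionN; apply: skew_section_sum => i _.
  by apply: (skew_section_cov nabla i (S := ext_section i j)); exact: skew_ext.
- apply: skew_section_sum => i _.
  apply: (skew_section_scale (S := ext_section i j)); last exact: skew_ext.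
  under eq_fun do rewrite !mxE.
  apply: smooth_onM; [exact: openT|exact: smooth_on_cst|].
  by apply: smooth_onD; [exact: openT|exact: smooth_on_coord|exact: smooth_on_cst].
- apply: skew_section_sum => i _; apply: skew_section_comm; first exact: skB.
  exact: skew_section_curv.
Qed.

(** Convertible to the integrand of [admissible], but phrased with [ip] so that continuity, hence
    measurability, is available. *)
Definition admissible_density x : R :=
  (\sum_j ip (B j) (B j) x
   + \sum_i \sum_j ip (cov_section nabla i (B j)) (cov_section nabla i (B j)) x
   + \sum_j ip (stability_section j) (stability_section j) x) * gaussian x0 t0 x.

Lemma continuous_admissible : continuous admissible_density.
Proof.
apply: continuous_mul; last exact: continuous_gaussian.
apply: continuous_add; first apply: continuous_add.
- by apply: continuous_sum => j _; apply: continuous_ip; exact: skB.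
- apply: (@continuous_sum R 'rV[R]_n _ _ _ (fun i x => \sum_j
     ip (cov_section nabla i (B j)) (cov_section nabla i (B j)) x)) => i _.
  by apply: continuous_sum => j _; apply: continuous_ip; exact: skew_section_cov.
- by apply: continuous_sum => j _; apply: continuous_ip; exact: skew_stability.
Qed.

Lemma admissible_integrable :
  admissible nabla x0 t0 (fun a i => B i a) -> integrable_Rn admissible_density.
Proof.
move=> H; apply/integrableP; split.
  by apply/measurable_EFinP; apply: measurable_continuous; exact: continuous_admissible.
move: H; apply: le_lt_trans; rewrite /int_Rn le_eqVlt; apply/orP; left; apply/eqP.
apply: eq_integral => t _; rewrite gee0_abs//.
rewrite lee_fin mulr_ge0//; last by rewrite ltW// gaussian_gt0.
have kc i j x : 0 <= ip (cov_section nabla i (B j)) (cov_section nabla i (B j)) x.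
  by apply: ip_ge0; exact: skew_section_cov.
have ks j x : 0 <= ip (stability_section j) (stability_section j) x.
  by apply: ip_ge0; exact: skew_stability.
by rewrite !addr_ge0// !sumr_ge0// => *; [exact: ip_ge0|exact: sumr_ge0].
Qed.

Lemma integrable_admissible :
  integrable_Rn admissible_density -> admissible nabla x0 t0 (fun a i => B i a).
Proof.
move=> /integrableP[_]; apply: le_lt_trans.
rewrite /admissible /int_Rn;
apply: (@le_trans _ _ (\int[lebesgue_Rn R n]_t (admissible_density (rowt t))%:E)%E).
  by rewrite le_eqVlt; apply/orP; left.
apply: (le_trans (lee_abs _)).
apply: le_abse_integral => //.
by apply/measurable_EFinP; apply: measurable_continuous; exact: continuous_admissible.
Qed.

Definition perturb_form (s : R) (a : chart E) i x : 'M[R]_r :=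
  conn_form nabla a i x + s *: B i a x.

Lemma perturb_smooth s a i : smooth_on (dom a) (perturb_form s a i).
Proof.
have [sB _ _] := skB i; apply: smooth_onD; [exact: dom_open|exact: conn_smooth|].
by apply: smooth_on_scalemx; [exact: dom_open|exact: smooth_on_cst|exact: sB].
Qed.

Lemma perturb_skew s a i x : dom a x -> (perturb_form s a i x)^T = - perturb_form s a i x.
Proof.
move=> ax; have [_ _ kB] := skB i.
by rewrite /perturb_form linearD linearZ/= conn_skew// kB// scalerN opprD.
Qed.

Lemma perturb_trans s a b i x : dom a x -> dom b x ->
  perturb_form s a i x *m trans a b x + 'D_(basis_vec R i) (trans a b) x
  = trans a b x *m perturb_form s b i x.
Proof.
move=> ax bx; have [_ gB _] := skB i.
rewrite /perturb_form mulmxDl mulmxDr -conn_trans// -scalemxAl -scalemxAr gB//.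
by rewrite addrAC.
Qed.

Definition perturb (s : R) : connection E :=
  Connection (perturb_smooth s) (@perturb_skew s) (@perturb_trans s).

Lemma curv_perturb s i j a x : dom a x ->
  curv (perturb_form s a) i j x = curv (conn_form nabla a) i j x
    + s *: (ext_section i j a x + s *: commmx (B i a x) (B j a x)).
Proof.
move=> ax; have dA k l := smooth_on_is_derive (basis_vec R k) (conn_smooth nabla a l) ax.
have dB k l : is_derive x (basis_vec R k) (B l a) ('D_(basis_vec R k) (B l a) x).
  by have [sB _ _] := skB l; exact: smooth_on_is_derive (sB a) ax.
have D k l : 'D_(basis_vec R k) (perturb_form s a l) x =
    'D_(basis_vec R k) (conn_form nabla a l) x + s *: 'D_(basis_vec R k) (B l a) x.
  by have [_ ->] := is_derive_add (dA k l) (is_derive_scale s (dB k l)).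
rewrite /curv !D /perturb_form /ext_section /ext_cov /cov.
exact: curv_perturb_mx.
Qed.

Lemma variation_perturb a i x : Defs.variation perturb a i x = B i a x.
Proof.
rewrite /Defs.variation derive1E.
have H := is_derive_add (is_derive_const (conn_form nabla a i x) (0 : R) (1 : R))
  (is_derive_scalemx (is_derive_id (0 : R) (1 : R)) (is_derive_const (B i a x) (0 : R) (1 : R))).
have [_ H2] := H; rewrite -[LHS]/('D_1 (fun s : R => conn_form nabla a i x + s *: B i a x) 0).
by rewrite H2 scaler0 addr0 add0r scale1r.
Qed.

Lemma perturb_family : 0 < t0 ->
  one_parameter_family nabla x0 t0 perturb (fun=> x0) (fun=> t0).
Proof.
move=> t00; split=> //; first by move=> a i x _ /=; rewrite /perturb_form scale0r addr0.
exists 1 => //; split=> //; [move=> a i|exact: smooth_on_cst|exact: smooth_on_cst].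
pose D := [set p : R * 'rV[R]_n | `|p.1| < 1 /\ dom a p.2].
have oD : open D.
  rewrite (_ : D = [set p : R * 'rV[R]_n | `|p.1| < 1] `&` [set p : R * 'rV[R]_n | dom a p.2])//.
  apply: openI.
    apply: (@open_comp _ _ (fun p : R * 'rV[R]_n => `|p.1|) [set s | s < 1]); last exact: open_lt.
    by move=> p _; apply: cvg_norm; exact: cvg_fst.
  apply: (@open_comp _ _ (fun p : R * 'rV[R]_n => p.2) (dom a)); last exact: dom_open.
  by move=> p _; exact: cvg_snd.
have snd_smooth (M : 'rV[R]_n -> 'M[R]_r) : smooth_on (dom a) M ->
    smooth_on D (fun p : R * 'rV[R]_n => M p.2).
  move=> sM; have c2 : continuous (fun p : R * 'rV[R]_n => p.2) by move=> p; exact: cvg_snd.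
  have H := @smooth_on_affine R _ _ _ (dom a) M (fun p : R * 'rV[R]_n => p.2)
    (fun p : R * 'rV[R]_n => p.2) c2 (fun _ _ _ => erefl) sM.
  by apply: smooth_onS H => p [].
have fst_smooth : smooth_on D (fun p : R * 'rV[R]_n => p.1 : R).
  have c1 : continuous (fun p : R * 'rV[R]_n => p.1) by move=> p; exact: cvg_fst.
  have sid : smooth_on [set: R] (fun s : R => s).
    case=> [|k]; split=> //; try by move=> s _; exact: cvg_id.
    move=> v; split=> [s _|]; first by have [] := is_derive_id s v.
    rewrite [X in Ck_on _ _ X](_ : _ = fun=> v); first exact: Ck_on_cst.
    by apply/funext => s; have [_ ->] := is_derive_id s v.
  have H := @smooth_on_affine R _ _ _ [set: R] (fun s : R => s) (fun p : R * 'rV[R]_n => p.1)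
    (fun p : R * 'rV[R]_n => p.1) c1 (fun _ _ _ => erefl) sid.
  exact: smooth_onS H.
have [sB _ _] := skB i.
apply: (smooth_onD oD (snd_smooth _ (conn_smooth nabla a i))).
exact: (smooth_on_scalemx oD fst_smooth (snd_smooth _ (sB a))).
Qed.

End Perturbation.

Section CompactPerturbation.
Context {R : realType} {n r : nat} {E : metric_bundle R n r}.
Variables (nabla : connection E) (x0 : 'rV[R]_n) (t0 : R).
Variable B : 'I_n -> chart E -> 'rV[R]_n -> 'M[R]_r.
Hypothesis skB : forall i, skew_section (B i).
Variable M : R.
Hypothesis B0 : forall i a x, M < `|x| -> B i a x = 0.

Lemma commmx0 (S : 'M[R]_r) : commmx S 0 = 0.
Proof. by rewrite /commmx mulmx0 mul0mx subr0. Qed.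

Lemma comm0mx (S : 'M[R]_r) : commmx 0 S = 0.
Proof. by rewrite /commmx mulmx0 mul0mx subr0. Qed.

Lemma cov_support (A : 'I_n -> 'rV[R]_n -> 'M[R]_r) i (S : 'rV[R]_n -> 'M[R]_r) x :
  (forall y, M < `|y| -> S y = 0) -> M < `|x| -> cov A i S x = 0.
Proof.
move=> S0 Mx; rewrite /cov S0// commmx0 addr0.
have oU : open [set y : 'rV[R]_n | M < `|y|].
  rewrite (_ : mkset _ = (fun x : 'rV[R]_n => `|x|) @^-1` [set s | M < s])//.
  by apply: open_comp; [move=> y _; exact: norm_continuous|exact: open_gt].
rewrite (derive_near (g := fun=> 0) (basis_vec R i) oU Mx)//.
by have [] := is_derive_const (0 : 'M[R]_r) x (basis_vec R i).
Qed.

Lemma ext_support i j a x : M < `|x| -> ext_section nabla B i j a x = 0.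
Proof.
by move=> Mx; rewrite /ext_section /ext_cov !cov_support ?subr0// => y; exact: B0.
Qed.

Lemma stability_support j a x : M < `|x| -> stability_section nabla x0 t0 B j a x = 0.
Proof.
move=> Mx; rewrite /stability_section /stability_op /coext_cov /Defs.contract /sharp_bracket.
rewrite !big1 ?oppr0 ?addr0// => i _.
- by rewrite B0// comm0mx.
- by rewrite -[ext_cov _ _ _ _ _]/(ext_section nabla B i j a x) ext_support// scaler0.
- by apply: cov_support => // y My; exact: ext_support.
Qed.

Lemma admissible_support : admissible nabla x0 t0 (fun a i => B i a).
Proof.
apply: integrable_admissible => //.
apply: (@integrable_Rn_continuous_support _ _ _ M).
  exact: continuous_admissible.
move=> x Mx; rewrite /admissible_density /ip /cov_section.
rewrite !big1 ?addr0 ?mul0r// => i _.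
- by rewrite stability_support// mulmx0 mxtrace0 oppr0.
- apply: big1 => j _; rewrite cov_support ?mulmx0 ?mxtrace0 ?oppr0// => y.
  exact: B0.
- by rewrite B0// mulmx0 mxtrace0 oppr0.
Qed.

(** The difference is a polynomial in [s] without constant term; after factoring out [s], the
    remaining powers are at most 1 in absolute value. *)
Lemma endo_sqnorm_perturb_le (F P Q : 'M[R]_r) (s : R) : `|s| < 1 ->
  0 <= endo_sqnorm P -> 0 <= endo_sqnorm Q ->
  `|endo_sqnorm (F + s *: (P + s *: Q)) - endo_sqnorm F| <=
  `|s| * (2 * `|- \tr (F *m P)| + 2 * `|- \tr (F *m Q)| + endo_sqnorm P
     + 2 * `|- \tr (P *m Q)| + endo_sqnorm Q).
Proof.
move=> s1 P0 Q0.
have Z (k : R) (T : 'M[R]_r) : endo_sqnorm (k *: T) = k ^+ 2 * endo_sqnorm T.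
  by rewrite /endo_sqnorm -scalemxAl -scalemxAr !mxtraceZ; ring.
rewrite endo_sqnormD Z endo_sqnormD Z -!scalemxAr !mxtraceZ mulmxDr mxtraceD.
rewrite -!scalemxAr !mxtraceZ !normrN.
move: (endo_sqnorm F) (endo_sqnorm P) P0 (endo_sqnorm Q) Q0 => f p p0 q q0.
move: (\tr (F *m P)) (\tr (F *m Q)) (\tr (P *m Q)) => a b c.
have -> : f + s ^+ 2 * (p + s ^+ 2 * q - 2 * (s * c)) - 2 * (s * (a + s * b)) - f =
  s * (- (2 * a) + s * (- (2 * b)) + s * p + s ^+ 2 * (- (2 * c)) + s ^+ 3 * q) by ring.
rewrite normrM ler_wpM2l//.
have sn k : `|s ^+ k| <= 1 by rewrite normrX exprn_ile1// ltW.
have tn k (y : R) : `|s ^+ k * y| <= `|y| by rewrite normrM ler_piMl.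
have n2 (y : R) : `|- (2 * y)| = 2 * `|y| by rewrite normrN normrM normr_nat.
apply: (le_trans (ler_normD _ _)); apply: lerD; last first.
  by rewrite (le_trans (tn 3%N q))// ger0_norm.
apply: (le_trans (ler_normD _ _)); apply: lerD; last first.
  by rewrite (le_trans (tn 2%N _))// n2.
apply: (le_trans (ler_normD _ _)); apply: lerD; last first.
  by rewrite (le_trans (tn 1%N p))// ger0_norm.
apply: (le_trans (ler_normD _ _)); apply: lerD; last first.
  by rewrite (le_trans (tn 1%N _))// n2.
by rewrite n2.
Qed.

Lemma dominated_support :
  dominated_energy (perturb nabla skB) (fun=> x0) (fun=> t0).
Proof.
pose F i j := curv_section nabla i j; pose P i j := ext_section nabla B i j.
pose Q i j : chart E -> 'rV[R]_n -> 'M[R]_r := fun a x => commmx (B i a x) (B j a x).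
have skF i j : skew_section (F i j) by exact: skew_section_curv.
have skP i j : skew_section (P i j) by exact: skew_ext.
have skQ i j : skew_section (Q i j) by exact: skew_section_comm.
pose q i j x := 2 * `|ip (F i j) (P i j) x| + 2 * `|ip (F i j) (Q i j) x|
  + ip (P i j) (P i j) x + 2 * `|ip (P i j) (Q i j) x| + ip (Q i j) (Q i j) x.
have cabs (f : 'rV[R]_n -> R) : continuous f -> continuous (fun x => 2 * `|f x|).
  move=> cf; apply: continuous_mul; first exact: continuous_const.
  by move=> x; exact: (continuous_comp (cf x) (@norm_continuous _ R^o (f x))).
have ci S T : skew_section S -> skew_section T -> continuous (@ip R n r E S T).
  by move=> hS hT; exact: continuous_ip.
exists (fun x => (\sum_i \sum_j q i j x) * gaussian x0 t0 x).
  apply: (@integrable_Rn_continuous_support _ _ _ M).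
    apply: continuous_mul; last exact: continuous_gaussian.
    apply: (@continuous_sum R 'rV[R]_n _ _ _ (fun i x => \sum_j q i j x)) => i _.
    apply: continuous_sum => j _; rewrite /q.
    do 4 (apply: continuous_add; last by [apply: ci|apply: cabs; apply: ci]).
    by apply: cabs; apply: ci.
  move=> x Mx; rewrite big1 ?mul0r// => i _; apply: big1 => j _.
  have P0 a : P i j a x = 0 by exact: ext_support.
  have Q0 a : Q i j a x = 0 by rewrite /Q !B0// commmx0.
  by rewrite /q /ip !P0 !Q0 !mulmx0 !mxtrace0 !oppr0 !normr0 !mulr0 !addr0.
exists 1 => // s s1 x; rewrite mulrA ler_wpM2r//; first exact/ltW/expR_gt0.
have ax : dom (frame_at E x) x := frame_atP x; set a := frame_at E x in ax.
rewrite /energy_density -sumrB mulr_sumr (le_trans (ler_norm_sum _ _ _))//.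
apply: ler_sum => i _; rewrite -sumrB mulr_sumr (le_trans (ler_norm_sum _ _ _))//.
apply: ler_sum => j _; rewrite -/a.
have E1 t : curv (conn_form (perturb nabla skB t) a) i j x =
    F i j a x + t *: (P i j a x + t *: Q i j a x).
  exact: curv_perturb.
rewrite !E1 scale0r addr0; apply: endo_sqnorm_perturb_le => //.
- exact: (ip_ge0 x (skP i j)).
- exact: (ip_ge0 x (skQ i j)).
Qed.

End CompactPerturbation.

(** * Critical points *)

Section Criticality.
Context {R : realType} {n r : nat} {E : metric_bundle R n r}.
Variables (nabla : connection E) (x0 : 'rV[R]_n) (t0 : R).
Hypothesis t0_gt0 : 0 < t0.
Hypothesis growth : exists y : 'rV[R]_n, polynomial_energy_growth nabla y.

Local Notation e := (energy_density nabla).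
Local Notation g := (gaussian x0 t0).

Let t0_neq0 : t0 != 0. Proof. by rewrite gt_eqF. Qed.

Lemma ip_sum_le (S T : 'I_n -> 'I_n -> chart E -> 'rV[R]_n -> 'M[R]_r) x :
  (forall i j, skew_section (S i j)) -> (forall i j, skew_section (T i j)) ->
  `|\sum_i \sum_j ip (S i j) (T i j) x| <=
  \sum_i \sum_j ip (S i j) (S i j) x + \sum_i \sum_j ip (T i j) (T i j) x.
Proof.
move=> hS hT; rewrite -big_split/= (le_trans (ler_norm_sum _ _ _))//.
apply: ler_sum => i _; rewrite -big_split/= (le_trans (ler_norm_sum _ _ _))//.
by apply: ler_sum => j _; exact: ip_le.
Qed.

(** On a soliton the integrand is four times the divergence of [variation_field], which the weighted
    |F|^2, |B|^2 and |DB|^2 make integrable together with the field itself. *)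
Lemma integral_energy_variation (B : 'I_n -> chart E -> 'rV[R]_n -> 'M[R]_r) :
  (forall j, skew_section (B j)) -> soliton nabla x0 t0 ->
  admissible nabla x0 t0 (fun a i => B i a) ->
  integrable_Rn (fun x => energy_variation nabla B x * g x) /\
  Rintegral (lebesgue_Rn R n) setT
    (fun t => energy_variation nabla B (rowt t) * g (rowt t)) = 0.
Proof.
move=> skB sol /(admissible_integrable skB) iB.
have sol' j x : ip (soliton_section nabla x0 t0 j) (B j) x = 0.
  by rewrite /ip /soliton_section sol ?mul0mx ?mxtrace0 ?oppr0//; exact: frame_atP.
have divE x : \sum_i variation_field_deriv nabla x0 t0 B i x =
    g x * \sum_i \sum_j ip (curv_section nabla i j) (cov_section nabla i (B j)) x.
  rewrite div_variation_field; congr (_ * _).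
  by rewrite [X in _ - X]big1 ?subr0.
have g0 x : 0 <= g x by rewrite ltW// gaussian_gt0.
have skC i j : skew_section (cov_section nabla i (B j)) by exact: skew_section_cov.
have skF i j : skew_section (curv_section nabla i j) by exact: skew_section_curv.
have st0 x : 0 <= \sum_j ip (stability_section nabla x0 t0 B j)
    (stability_section nabla x0 t0 B j) x.
  by apply: sumr_ge0 => j _; apply: ip_ge0; exact: skew_stability.
have b0 x : 0 <= \sum_j ip (B j) (B j) x by apply: sumr_ge0 => j _; exact: ip_ge0.
have c0 x : 0 <= \sum_i \sum_j ip (cov_section nabla i (B j)) (cov_section nabla i (B j)) x.
  by do 2![apply: sumr_ge0 => ? _]; exact: ip_ge0.
have idom := integrable_RnD (integrable_energy x0 t0_gt0 growth) iB.
have bound x y b : `|y| <= e x + b -> b <= \sum_j ip (B j) (B j) x + \sum_i \sum_j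
     ip (cov_section nabla i (B j)) (cov_section nabla i (B j)) x ->
   `|g x * y| <= e x * g x + admissible_density nabla x0 t0 B x.
  move=> hy hb; rewrite normrM (ger0_norm (g0 x)) /admissible_density -mulrDl mulrC.
  by rewrite ler_wpM2r// (le_trans hy)// lerD2l (le_trans hb)// lerDl.
have iX i : integrable_Rn (variation_field nabla x0 t0 B i).
  apply: integrable_Rn_le idom.
    by apply: measurable_continuous; exact: continuous_variation_field.
  move=> x; apply: (bound x _ (\sum_j ip (B j) (B j) x)); last by rewrite lerDl.
  rewrite (le_trans (ler_norm_sum _ _ _))//.
  apply: (@le_trans _ _ (\sum_j ip (curv_section nabla i j) (curv_section nabla i j) x +
      \sum_j ip (B j) (B j) x)).
    by rewrite -big_split/=; apply: ler_sum => j _; exact: ip_le.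
  rewrite lerD2r /energy_density [leRHS](bigD1 i)//= lerDl.
  by do 2![apply: sumr_ge0 => ? _]; exact: (ip_ge0 x (skF _ _)).
have idiv : integrable_Rn (fun x => \sum_i variation_field_deriv nabla x0 t0 B i x).
  apply: integrable_Rn_le idom.
    apply: measurable_continuous; apply: continuous_sum => i _.
    exact: continuous_variation_field_deriv.
  move=> x; rewrite divE; apply: (bound x _ (\sum_i \sum_j
     ip (cov_section nabla i (B j)) (cov_section nabla i (B j)) x)).
    exact: (ip_sum_le x skF skC).
  by rewrite lerDr.
have I0 := integral_divergence (is_derive_variation_field nabla x0 t0_neq0 skB)
  (fun i => @continuous_variation_field R n r E nabla x0 t0 B skB i)
  (fun i => @continuous_variation_field_deriv R n r E nabla x0 t0 B skB i) iX idiv.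
have EV x : energy_variation nabla B x * g x = 4 * \sum_i variation_field_deriv nabla x0 t0 B i x.
  by rewrite divE /energy_variation; ring.
have -> : (fun x => energy_variation nabla B x * g x) =
    fun x => 4 * \sum_i variation_field_deriv nabla x0 t0 B i x by apply/funext.
split; first exact: integrable_RnZ.
under eq_Rintegral do rewrite EV.
rewrite RintegralZl//.
by rewrite /Rintegral I0 mulr0.
Qed.

Lemma integrable_stress_field (y : 'rV[R]_n) (lam : R) i :
  integrable_Rn (stress_field nabla x0 t0 y lam i).
Proof.
pose v := conformal_field x0 y lam.
have cv j : continuous (v j) by exact: continuous_conformal.
(* Of the 3, two come from the quadratic part of the stress tensor ([S1]) and one bounds its trace
   part ([S2]). The field grows linearly, hence is below a constant times |x - x0|^2 + 1. *)
have cq : continuous (fun x => 3 * \sum_j `|v j x|).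
  apply: continuous_mul; first exact: continuous_const.
  apply: (@continuous_sum R 'rV[R]_n _ _ _ (fun j x => `|v j x|)) => j _.
  by move=> x; exact: (@cvg_norm R R^o _ _ _ (v j) _ (cv j x)).
have qC x : `|3 * \sum_j `|v j x| | <=
    (3 * \sum_j (`|y 0 j| + `|lam|)) * (sqnorm (x - x0) + 1).
  rewrite ger0_norm; last by rewrite mulr_ge0// sumr_ge0.
  rewrite -mulrA ler_wpM2l// mulr_suml; apply: ler_sum => j _.
  rewrite (le_trans (ler_normD _ _))// mulrDl normrM.
  have q0 := sqnorm_ge0 (x - x0); have := sqr_coord_le (x - x0) j.
  move: (sqnorm _) q0 => q q0; set z := (x - x0) 0 j => zq.
  have z1 : `|z| <= q + 1.
    have := sqr_ge0 (`|z| - 1); rewrite sqrrB1 real_normK ?num_real//.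
    by have := normr_ge0 z; nra.
  apply: lerD; last by rewrite ler_wpM2l.
  by rewrite ler_peMr// lerDr.
have I := integrable_energy_weight t0_gt0 growth cq qC.
apply: integrable_Rn_le I.
  by apply: measurable_continuous; exact: continuous_stress_field.
move=> x; rewrite /stress_field normrM (gtr0_norm (gaussian_gt0 _ _ _)).
rewrite [leRHS]mulrA [leLHS]mulrC ler_wpM2r ?(ltW (gaussian_gt0 _ _ _))//.
have e0 := energy_ge0 nabla x.
have row_le a : \sum_k ip (curv_section nabla a k) (curv_section nabla a k) x <= e x.
  rewrite /energy_density [leRHS](bigD1 a)//= lerDl.
  by do 2![apply: sumr_ge0 => ? _]; exact: (ip_ge0 x (skew_section_curv nabla _ _)).
have S1 : `|\sum_j \sum_k v j x * ip (curv_section nabla i k) (curv_section nabla j k) x|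
    <= 2 * e x * \sum_j `|v j x|.
  rewrite mulr_sumr (le_trans (ler_norm_sum _ _ _))//; apply: ler_sum => j _.
  rewrite -mulr_sumr normrM mulrC ler_wpM2r// (le_trans (ler_norm_sum _ _ _))//.
  rewrite (_ : 2 * e x = e x + e x); last by ring.
  apply: le_trans (lerD (row_le i) (row_le j)); rewrite -big_split/=.
  by apply: ler_sum => k _; apply: ip_le; exact: skew_section_curv.
have S2 : `|v i x * (4^-1 * e x)| <= e x * \sum_j `|v j x|.
  rewrite normrM mulrC; apply: ler_pM => //.
    by rewrite ger0_norm ?mulr_ge0// ler_piMl// invf_le1// ler1n.
  by rewrite [leRHS](bigD1 i)//= lerDl sumr_ge0.
apply: (le_trans (ler_normB _ _)); apply: (le_trans (lerD S1 S2)).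
by rewrite le_eqVlt; apply/orP; left; apply/eqP; ring.
Qed.

Lemma integral_gaussian_variation (xd : 'rV[R]_n) (td : R) :
  soliton nabla x0 t0 ->
  integrable_Rn (fun x => e x * (g x * gaussian_variation x0 t0 xd td x)) ->
  (2 - n%:R / 2) / t0 * td *
     Rintegral (lebesgue_Rn R n) setT (fun t => e (rowt t) * g (rowt t)) +
  Rintegral (lebesgue_Rn R n) setT
     (fun t => e (rowt t) * (g (rowt t) * gaussian_variation x0 t0 xd td (rowt t))) = 0.
Proof.
move=> sol ig; set k := (2 - n%:R / 2) / t0 * td.
have ie := integrable_energy x0 t0_gt0 growth.
(* The choice y = [xd], lam = [td / (2 * t0)] makes the two sides agree pointwise: lam |x - x0|^2 /
   (2 t0) reproduces the scale derivative of the Gaussian exponent, and 4 lam (1 - n/4) the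
   prefactor term. *)
have stE x : k * (e x * g x) + e x * (g x * gaussian_variation x0 t0 xd td x) =
    4 * \sum_i stress_field_deriv nabla x0 t0 xd (td / (2 * t0)) i x.
  rewrite (div_stress_field xd (td / (2 * t0)) x sol) /gaussian_variation.
  have -> : \sum_i (x - x0) 0 i * conformal_field x0 xd (td / (2 * t0)) i x =
     \sum_i (x - x0) 0 i * xd 0 i + td / (2 * t0) * sqnorm (x - x0).
    rewrite /sqnorm mulr_sumr -big_split/=; apply: eq_bigr => i _.
    by rewrite /conformal_field; ring.
  have -> : \sum_i (2 * t0)^-1 * (x - x0) 0 i * xd 0 i =
     (2 * t0)^-1 * \sum_i (x - x0) 0 i * xd 0 i.
    by rewrite mulr_sumr; apply: eq_bigr => i _; rewrite mulrA.
  by rewrite /k; field.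
have ist := integrable_RnD (integrable_RnZ k ie) ig.
have idiv : integrable_Rn (fun x => \sum_i stress_field_deriv nabla x0 t0 xd (td / (2 * t0)) i x).
  have := integrable_RnZ 4^-1 ist.
  rewrite (_ : (fun x => _) = fun x => \sum_i stress_field_deriv nabla x0 t0 xd (td / (2 * t0)) i x)//.
  by apply/funext => x; rewrite stE mulKf.
have I0 := integral_divergence (is_derive_stress_field nabla x0 t0_neq0 xd (td / (2 * t0)))
  (fun i => @continuous_stress_field R n r E nabla x0 t0 xd (td / (2 * t0)) i)
  (fun i => @continuous_stress_field_deriv R n r E nabla x0 t0 xd (td / (2 * t0)) i)
  (integrable_stress_field xd (td / (2 * t0))) idiv.
rewrite -RintegralZl//.
rewrite -RintegralD//; last exact: (integrable_RnZ k ie).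
under eq_Rintegral do rewrite stE.
rewrite RintegralZl//.
by rewrite /Rintegral I0 mulr0.
Qed.

Lemma soliton_critical : soliton nabla x0 t0 -> critical_point nabla x0 t0.
Proof.
move=> sol nabla_ x_ t_ fam adm dom.
have [fin ih' dF] := first_variation t0_gt0 growth fam dom.
have [nabla_0 x_0 t_0 [e1 e10 [sn _ _ _]]] := fam.
split; first exact: fin.
pose B j : chart E -> 'rV[R]_n -> 'M[R]_r := fun a => Defs.variation nabla_ a j.
have skB j : skew_section (B j) by exact: (skew_variation e10 sn j).
have [iA IA] := @integral_energy_variation B skB sol adm.
(* Obtained by subtraction: the whole derivative and its connection part are both known to be
   integrable. *)
have ig : integrable_Rn (fun x => e x * (g x *
    gaussian_variation x0 t0 ('D_1 x_ 0) ('D_1 t_ 0) x)).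
  have := integrable_RnD ih' (integrable_RnZ (-1) iA).
  rewrite (_ : (fun x => _) = (fun x => e x * (g x *
    gaussian_variation x0 t0 ('D_1 x_ 0) ('D_1 t_ 0) x)))//.
  by apply/funext => x; rewrite mulN1r addrAC subrr add0r.
apply: (is_derive_eq dF).
rewrite RintegralD//.
rewrite IA add0r (integral_gaussian_variation sol ig) mulr0.
by [].
Qed.

Lemma critical_soliton : critical_point nabla x0 t0 -> soliton nabla x0 t0.
Proof.
move=> crit a j x ax.
(* The bump is centred at the point under study, so it suffices that it is positive there. The
   centre and scale of the family stay fixed. *)
pose phi : 'rV[R]_n -> R := bump x 1 1.
pose S i := soliton_section nabla x0 t0 i.
pose B i : chart E -> 'rV[R]_n -> 'M[R]_r := fun b y => phi y *: S i b y.
have skS i : skew_section (S i) by exact: skew_soliton.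
have skB i : skew_section (B i).
  by apply: skew_section_scale; [exact: smooth_bump|exact: skS].
pose M := `|x| + 1.
have B0 i b y : M < `|y| -> B i b y = 0.
  by move=> My; rewrite /B /phi bump_norm_support// scale0r.
have fam := perturb_family nabla x0 skB t0_gt0.
have adm := admissible_support nabla x0 t0 skB B0.
have dom := dominated_support nabla x0 t0 skB B0.
have varE : Defs.variation (perturb nabla skB) = fun b i => B i b.
  by apply/funext => b; apply/funext => i; apply/funext => y; exact: variation_perturb.
have adm' : admissible nabla x0 t0 (Defs.variation (perturb nabla skB)) by rewrite varE.
have [_ d0] := crit _ _ _ fam adm' dom.
have [_ ih' dF] := first_variation t0_gt0 growth fam dom.
have Dx : 'D_1 (fun _ : R => x0) 0 = 0 by have [] := is_derive_const x0 (0 : R) (1 : R).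
have Dt : 'D_1 (fun _ : R => t0) 0 = 0 by have [] := is_derive_const t0 (0 : R) (1 : R).
have [_ F0] := d0; have [_ F1] := dF.
have C0 : 0 < t0 ^+ 2 * (4 * pi * t0) `^ (- (n%:R / 2)).
  by rewrite mulr_gt0 ?exprn_gt0// powR_gt0// !mulr_gt0// pi_gt0.
have I0 : Rintegral (lebesgue_Rn R n) setT
    (fun t => energy_variation nabla B (rowt t) * g (rowt t)) = 0.
  have := etrans (esym F1) F0.
  move=> /eqP; rewrite mulf_eq0 gt_eqF//= Dt mulr0 mul0r add0r => /eqP <-.
  apply: eq_Rintegral => t _.
  have -> : gaussian_variation x0 t0 ('D_1 (fun _ : R => x0) 0) 0 (rowt t) = 0.
    rewrite /gaussian_variation Dx mulr0 addr0 big1// => i _.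
    by rewrite [X in _ * X]mxE mulr0.
  by rewrite varE [X in _ + X]mulrA mulr0 addr0.
pose Q y := g y * (phi y * \sum_k ip (S k) (S k) y).
have ipB y : \sum_k ip (S k) (B k) y = phi y * \sum_k ip (S k) (S k) y.
  by rewrite mulr_sumr; apply: eq_bigr => k _; rewrite ipC ipZl.
pose dV i := variation_field_deriv nabla x0 t0 B i.
(* The divergence part has compact support and integrates to zero, so criticality forces the
   integral of the nonnegative continuous [Q] to vanish. *)
have EV y : energy_variation nabla B y * g y = 4 * (\sum_i dV i y + Q y).
  by rewrite /dV div_variation_field ipB /Q /energy_variation; ring.
have phic : continuous phi by exact: continuous_bump.
have phi0 y : 0 <= phi y.
  by rewrite /phi /bump /flat; case: ifP => // _; rewrite hornerC mul1r expR_ge0.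
have ScS k : continuous (ip (S k) (S k)) by apply: continuous_ip; exact: skS.
have Qc : continuous Q.
  apply: continuous_mul; first exact: continuous_gaussian.
  by apply: continuous_mul => //; apply: continuous_sum => k _; exact: ScS.
have iQ : integrable_Rn Q.
  apply: (@integrable_Rn_continuous_support _ _ _ M) => // y My.
  by rewrite /Q /phi bump_norm_support// mul0r mulr0.
have V0 i y : M < `|y| -> variation_field nabla x0 t0 B i y = 0.
  move=> My; rewrite /variation_field big1 ?mulr0// => k _.
  by rewrite /ip B0// mulmx0 mxtrace0 oppr0.
have dVc i : continuous (dV i) by exact: continuous_variation_field_deriv.
have dVI := integral_divergence_support (is_derive_variation_field nabla x0 t0_neq0 skB) dVc V0.
have iV : integrable_Rn (fun y => \sum_i dV i y).
  apply: (@integrable_Rn_continuous_support _ _ _ M).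
    by apply: continuous_sum => i _; exact: dVc.
  move=> y My; rewrite /dV div_variation_field ipB.
  rewrite /phi bump_norm_support// mul0r subr0 big1 ?mulr0// => i _.
  rewrite big1// => k _; rewrite /ip /cov_section (cov_support (M := M))//.
    by rewrite mulmx0 mxtrace0 oppr0.
  by move=> z; exact: B0.
have Q0 : (\int[lebesgue_Rn R n]_t (Q (rowt t))%:E = 0)%E.
  move: I0; under eq_Rintegral do rewrite EV.
  rewrite RintegralZl//; last exact: (integrable_RnD iV iQ).
  rewrite RintegralD//.
  rewrite /Rintegral dVI add0r => /eqP; rewrite mulf_eq0 pnatr_eq0/= => /eqP.
  move=> I0; rewrite -[LHS]fineK ?I0//.
  exact: (integrable_fin_num measurableT iQ).
have Qx : Q x = 0.
  apply: integral_Rn_eq0 => // y; rewrite /Q mulr_ge0//; first exact/ltW/gaussian_gt0.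
  by rewrite mulr_ge0// sumr_ge0// => k _; exact: ip_ge0.
have phix : phi x != 0.
  rewrite /phi /bump /flat subrr /sqnorm big1 => [|i _]; last by rewrite mxE expr0n.
  by rewrite mulr0 subr0 ltr01 hornerC mul1r gt_eqF// expR_gt0.
move: Qx => /eqP; rewrite /Q !mulf_eq0 gt_eqF ?gaussian_gt0//= (negbTE phix)/=.
rewrite psumr_eq0 => [/allP/(_ j)|k _]; last exact: ip_ge0.
rewrite mem_index_enum => /(_ isT)/eqP.
exact: (ip_eq0 (skS j) ax).
Qed.
End Criticality.

Theorem corollary3p7 (R : realType) (n r : nat) (E : metric_bundle R n r)
    (nabla : connection E) (x0 : 'rV[R]_n) (t0 : R)
    (growth : exists y : 'rV[R]_n, polynomial_energy_growth nabla y)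
    (t0_gt0 : 0 < t0) :
  critical_point nabla x0 t0 <-> soliton nabla x0 t0.
Proof. by split; [exact: critical_soliton|exact: soliton_critical]. Qed.
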